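(* Let $(u_k)_k$ be a sequence in $E$ and $u\in E$ such that $\|u_k\|=1$ for all $k$, $u_k\rightharpoonup u$ weakly in $E$, $u_k(x)\to u(x)$, $\nabla u_k(x)\to\nabla u(x)$ and $\Delta u_k(x)\to\Delta u(x)$ for a.e. $x\in B$, and $u\not\equiv 0$. Then $$\sup_k\int_B e^{p\,\alpha_\beta|u_k|^\gamma}\,dx<+\infty$$ for all $1<p<U(u)$, where $$U(u)=\begin{cases}\dfrac{1}{(1-\|u\|^{N/2})^{2\gamma/N}}&\text{if }\|u\|<1,\\[2mm]+\infty&\text{if }\|u\|=1.\end{cases}$$
   Context: $N\ge3$, $\beta\in(0,1)$, $B$ is the open unit ball of $\mathbb{R}^N$, $V_N$ is its volume, and $w(x)=\left(\log\frac{e}{|x|}\right)^{\beta(\frac N2-1)}$. $V:\overline B\to\mathbb{R}$ is continuous with $V(x)\ge V_0$ in $B$ for some constant $V_0>0$. Set $\gamma=\frac{N}{(N-2)(1-\beta)}$ and $\alpha_\beta=N[(N-2)NV_N]^{\frac{2}{(N-2)(1-\beta)}}(1-\beta)^{\frac{1}{1-\beta}}$. $W^{2,N/2}_0(B,w)$ is the closure of $C_0^\infty(B)$ with respect to the norm $\left(\int_B w|\Delta u|^{N/2}dx+\int_B|\nabla u|^{N/2}dx+\int_B|u|^{N/2}dx\right)^{2/N}$, and $E=W^{2,N/2}_{0,rad}(B,w)$ is its subspace of radial functions, endowed with the norm $$\|u\|=\left(\int_B w(x)|\Delta u|^{N/2}dx+\int_B|\nabla u|^{N/2}dx+\int_B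 V(x)|u|^{N/2}dx\right)^{2/N}.$$ *)

(* Defs.v *)
From HB Require Import structures.
From mathcomp Require Import all_boot all_order all_algebra.
From mathcomp Require Import all_classical all_reals all_analysis.

Set Implicit Arguments.
Unset Strict Implicit.
Unset Printing Implicit Defensive.

Import Order.TTheory GRing.Theory Num.Theory.
Import numFieldNormedType.Exports.

Local Open Scope classical_set_scope.
Local Open Scope ring_scope.

Section row_vector_measurable.
Context {R : realType} (n : nat).

Let coord (i : 'I_n) (x : 'rV[R]_n) : R := x ord0 i.

Let mrow : set (set 'rV[R]_n) := g_sigma_preimage coord.

Let mrow0 : mrow set0. Proof. exact: sigma_algebra0. Qed.

Let mrowC A : mrow A -> mrow (~` A). Proof. exact: sigma_algebraC. Qed.

Let mrowU (F : (set 'rV[R]_n)^nat) :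
  (forall i, mrow (F i)) -> mrow (\bigcup_i F i).
Proof. exact: sigma_algebra_bigcup. Qed.

(** The product sigma-algebra on R^n, i.e. the one generated by the
    coordinates; it is the Borel sigma-algebra. *)
HB.instance Definition _ := @isMeasurable.Build default_measure_display
  'rV[R]_n mrow mrow0 mrowC mrowU.

Lemma measurable_coord (i : 'I_n) :
  measurable_fun [set: 'rV[R]_n] (fun x : 'rV[R]_n => x ord0 i).
Proof.
move=> _ Y mY; rewrite setTI; apply: sub_sigma_algebra => /=.
rewrite -bigcup_seq/=; exists i => /=; first by rewrite mem_index_enum.
by exists Y => //; rewrite setTI.
Qed.

Lemma measurable_fun_coordP d (T : measurableType d) (f : T -> 'rV[R]_n) :
  (forall i, measurable_fun [set: T] (fun t => f t ord0 i)) ->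
  measurable_fun [set: T] f.
Proof.
move=> mf _ A mA; rewrite setTI.
suff : g_sigma_preimage coord `<=` [set B | measurable (f @^-1` B)] by apply.
apply: smallest_sub.
  split => /=.
  - by rewrite preimage_set0.
  - by move=> B mB; rewrite setTD preimage_setC; exact: measurableC.
  - by move=> F mF; rewrite preimage_bigcup; exact: bigcup_measurable.
rewrite -bigcup_seq => B [i _ [C mC <-]] /=.
rewrite setTI -comp_preimage -[X in measurable X]setTI.
exact: mf.
Qed.

End row_vector_measurable.

Section lebesgue_measure_rV.
Context {R : realType}.

Definition consv n (p : R * 'rV[R]_n) : 'rV[R]_n.+1 :=
  \row_i (if unlift ord0 i is Some j then p.2 ord0 j else p.1).

Definition unconsv n (x : 'rV[R]_n.+1) : R * 'rV[R]_n :=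
  (x ord0 ord0, \row_j x ord0 (lift ord0 j)).

Lemma consvK n : cancel (@consv n) (@unconsv n).
Proof.
move=> [a v]; rewrite /unconsv /consv !mxE unlift_none /=; congr pair.
by apply/rowP => j; rewrite !mxE liftK.
Qed.

Lemma unconsvK n : cancel (@unconsv n) (@consv n).
Proof.
move=> x; apply/rowP => i; rewrite !mxE /=.
by case: unliftP => [j ->|->]; rewrite ?mxE.
Qed.

Lemma measurable_consv n : measurable_fun setT (@consv n).
Proof.
apply: measurable_fun_coordP => i; rewrite /consv.
under eq_fun do rewrite mxE.
case: unliftP => [j _|_]; last exact: measurable_fst.
exact: (measurableT_comp (measurable_coord j) measurable_snd).
Qed.

Lemma measurable_unconsv n : measurable_fun setT (@unconsv n).
Proof.
apply/measurable_fun_pairP; split; first exact: measurable_coord.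
apply: measurable_fun_coordP => j /=.
by under eq_fun do rewrite mxE; exact: measurable_coord.
Qed.

Section step.
Local Open Scope ereal_scope.
Context (n : nat) (m : {sigma_finite_measure set 'rV[R]_n -> \bar R}).

Definition consv_measure : set 'rV[R]_n.+1 -> \bar R :=
  pushforward ((@lebesgue_measure R) \x m) (@consv n).

Let preim_measurable A : measurable A -> measurable (@consv n @^-1` A).
Proof.
by move=> mA; rewrite -[X in measurable X]setTI; exact: measurable_consv.
Qed.

Let consv_measure0 : consv_measure set0 = 0.
Proof. by rewrite /consv_measure /pushforward preimage_set0 measure0. Qed.

Let consv_measure_ge0 A : 0 <= consv_measure A.
Proof. by rewrite /consv_measure /pushforward; exact: measure_ge0. Qed.

Let consv_measure_sigma_additive : semi_sigma_additive consv_measure.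
Proof.
move=> F mF tF mUF; rewrite /consv_measure /pushforward preimage_bigcup.
apply: measure_semi_sigma_additive.
- by move=> k; exact: preim_measurable.
- apply/trivIsetP => i j _ _ ij; rewrite -preimage_setI.
  by move/trivIsetP : tF => /(_ _ _ _ _ ij) -> //; rewrite preimage_set0.
- by rewrite -preimage_bigcup; exact: preim_measurable.
Qed.

HB.instance Definition _ := isMeasure.Build _ _ _
  consv_measure consv_measure0 consv_measure_ge0 consv_measure_sigma_additive.

Let consv_measure_sigma_finite : sigma_finite setT consv_measure.
Proof.
have /sigma_finiteP[F [TF ndF Foo]] := sigma_finiteT (@lebesgue_measure R).
have /sigma_finiteP[G [TG ndG Goo]] := sigma_finiteT m.
exists (fun k => @unconsv n @^-1` (F k `*` G k)).
  apply/esym; rewrite -subTset => x _.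
  have [k _ Fk] : (\bigcup_i F i) (unconsv x).1 by rewrite -TF.
  have [l _ Gl] : (\bigcup_i G i) (unconsv x).2 by rewrite -TG.
  exists (maxn k l) => //; split.
  - by move: Fk; exact/subsetPset/ndF/leq_maxl.
  - by move: Gl; exact/subsetPset/ndG/leq_maxr.
move=> k; have [mF Fk] := Foo k; have [mG Gk] := Goo k; split.
  rewrite -[X in measurable X]setTI; apply: measurable_unconsv => //.
  exact: measurableX.
rewrite /consv_measure /pushforward -comp_preimage.
rewrite (_ : _ \o _ = id); last by apply/funext => x /=; rewrite consvK.
by rewrite preimage_id product_measure1E// lte_mul_pinfty// ge0_fin_numE.
Qed.

HB.instance Definition _ := Measure_isSigmaFinite.Build _ _ _
  consv_measure consv_measure_sigma_finite.

End step.

(** Lebesgue measure on (the Borel sets of) R^n, by induction on the dimension: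
    R^0 has mass 1 and R^(n+1) is identified with R * R^n. *)
Fixpoint lebesgue_rV n : {sigma_finite_measure set 'rV[R]_n -> \bar R} :=
  match n with
  | 0 => (\d_(0 : 'rV[R]_0) : {sigma_finite_measure set _ -> \bar R})
  | n'.+1 => consv_measure (lebesgue_rV n')
  end.

End lebesgue_measure_rV.

Section ball_and_test_functions.
Context {R : realType} {N : nat}.
Implicit Types (x : 'rV[R]_N) (f phi : 'rV[R]_N -> R).

(** The norm of the library's normed module structure on ['rV[R]_N] is the
    sup norm; the Euclidean norm has to be introduced separately. *)
Definition enorm x : R := Num.sqrt (\sum_(i < N) x ord0 i ^+ 2).

Definition unit_ball : set 'rV[R]_N := [set x | enorm x < 1].

Definition closed_unit_ball : set 'rV[R]_N := [set x | enorm x <= 1].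

Definition partial (i : 'I_N) f : 'rV[R]_N -> R := 'D_(delta_mx ord0 i) f.

Definition iter_partial (s : seq 'I_N) f : 'rV[R]_N -> R := foldr partial f s.

(** C^oo: all iterated partial derivatives exist and are continuous. *)
Definition smooth f := forall s : seq 'I_N,
  continuous (iter_partial s f) /\
  forall (i : 'I_N) x, derivable (iter_partial s f) x (delta_mx ord0 i).

Definition test_function phi := [/\ smooth phi,
  compact (closure [set x | phi x != 0]) &
  closure [set x | phi x != 0] `<=` unit_ball].

Definition laplacian f x : R := \sum_(i < N) partial i (partial i f) x.

End ball_and_test_functions.

Section weak_derivatives.
Context {R : realType} {N : nat}.
Local Notation mu := (@lebesgue_rV R N).
Local Notation B := (@unit_ball R N).
Implicit Types (u g : 'rV[R]_N -> R).

(** Functions on B are encoded as functions on R^N of which only the values on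
    B matter. *)
Definition loc_integrable u := measurable_fun B u /\
  forall K : set 'rV[R]_N, compact K -> K `<=` B ->
    mu.-integrable K (EFin \o u).

Definition is_weak_partial (i : 'I_N) u g := loc_integrable g /\
  forall phi, test_function phi ->
    \int[mu]_(x in B) (u x * partial i phi x) =
    - \int[mu]_(x in B) (g x * phi x).

Definition is_weak_laplacian u g := loc_integrable g /\
  forall phi, test_function phi ->
    \int[mu]_(x in B) (u x * laplacian phi x) =
    \int[mu]_(x in B) (g x * phi x).

(** Weak derivatives are unique up to a null set; [wgrad] and [wlaplacian] pick
    a representative (0 if there is none, a case excluded in [sobolev0]). *)
Definition wpartial (i : 'I_N) u : 'rV[R]_N -> R :=
  xget (cst 0) [set g | is_weak_partial i u g].

Definition wgrad u (x : 'rV[R]_N) : 'rV[R]_N := \row_i wpartial i u x.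

Definition wlaplacian u : 'rV[R]_N -> R :=
  xget (cst 0) [set g | is_weak_laplacian u g].

End weak_derivatives.

Section weighted_sobolev.
Context {R : realType} {N : nat}.
Variable beta : R.
Local Notation mu := (@lebesgue_rV R N).
Local Notation B := (@unit_ball R N).
Implicit Types (u c : 'rV[R]_N -> R).

Definition weight (x : 'rV[R]_N) : R :=
  ln (expR 1 / enorm x) `^ (beta * (N%:R / 2 - 1)).

(** (int_B w |Delta u|^(N/2) + int_B |grad u|^(N/2) + int_B c |u|^(N/2))^(2/N),
    possibly infinite. *)
Definition sobolev_enorm c u : \bar R :=
  ((\int[mu]_(x in B) (weight x * `|wlaplacian u x| `^ (N%:R / 2))%:E
    + \int[mu]_(x in B) (enorm (wgrad u x) `^ (N%:R / 2))%:E
    + \int[mu]_(x in B) (c x * `|u x| `^ (N%:R / 2))%:E)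
   `^ (2 / N%:R))%E.

(** W^{2,N/2}_0(B,w): the closure of the test functions in the space of weakly
    differentiable functions, for the norm with c = 1. *)
Definition sobolev0 u := [/\ loc_integrable u,
  (forall i : 'I_N, exists g, is_weak_partial i u g),
  (exists g, is_weak_laplacian u g) &
  exists2 phi : nat -> 'rV[R]_N -> R, (forall n, test_function (phi n)) &
    sobolev_enorm (cst 1) (fun x => u x - phi n x) @[n --> \oo] --> 0%E].

Definition radial u := exists f : R -> R,
  {ae mu, forall x, B x -> u x = f (enorm x)}.

Definition sobolev0_rad : set ('rV[R]_N -> R) :=
  [set u | sobolev0 u /\ radial u].

Definition sobolev_norm (V : 'rV[R]_N -> R) u : R := fine (sobolev_enorm V u).

(** Bounded linear functionals on [sobolev0_rad] normed by [sobolev_norm V].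
    Functions are not identified when equal almost everywhere, but boundedness
    forces [l] to take the same value on such functions. The values of [l]
    outside [sobolev0_rad] are irrelevant. *)
Definition bounded_functional (V : 'rV[R]_N -> R)
    (l : ('rV[R]_N -> R) -> R) :=
  (forall (a b : R) u v, sobolev0_rad u -> sobolev0_rad v ->
     l (fun x => a * u x + b * v x) = a * l u + b * l v) /\
  (exists C : R, forall u, sobolev0_rad u -> `|l u| <= C * sobolev_norm V u).

Definition weak_cvg (V : 'rV[R]_N -> R) (u_ : nat -> 'rV[R]_N -> R) u :=
  forall l, bounded_functional V l -> l (u_ k) @[k --> \oo] --> l u.

End weighted_sobolev.

Section constants.
Context {R : realType}.

Definition gamma_exp (N : nat) (beta : R) : R :=
  N%:R / ((N%:R - 2) * (1 - beta)).

Definition ball_volume (N : nat) : R :=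
  fine (@lebesgue_rV R N (@unit_ball R N)).

Definition alpha_const (N : nat) (beta : R) : R :=
  N%:R
  * ((N%:R - 2) * N%:R * ball_volume N) `^ (2 / ((N%:R - 2) * (1 - beta)))
  * (1 - beta) `^ (1 / (1 - beta)).

(** The threshold U(u) as a function of t = ||u||, for 0 <= t <= 1. *)
Definition threshold (N : nat) (beta t : R) : \bar R :=
  if t < 1
  then (1 / (1 - t `^ (N%:R / 2)) `^ (2 * gamma_exp N beta / N%:R))%:E
  else +oo%E.

End constants.

(* Main.v *)
Require Import Defs.
From HB Require Import structures.
From mathcomp Require Import all_boot all_order all_algebra.
From mathcomp Require Import all_classical all_reals all_analysis.
From mathcomp Require Import measurable_realfun.
From mathcomp Require Import ring lra.

Set Implicit Arguments.
Unset Strict Implicit.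
Unset Printing Implicit Defensive.

Import Order.TTheory GRing.Theory Num.Theory.
Import numFieldNormedType.Exports.

Local Open Scope classical_set_scope.
Local Open Scope ring_scope.

(** Testing the weak Laplacian [g] of a radial [u] with radial test functions
    whose Laplacian is [a(|x|^2) - lam b(|x|^2)], where [b] is a fixed bump and
    [a >= 0] is arbitrary, bounds the average of [u] against [a(|x|^2)] by a
    multiple of [int |u| + int |g| max(|x|, r)^(2-N)], [r] being the inner radius
    of the support of [a].  Hoelder's inequality against the weight turns this into
    [|u x| <= C + kappa M^(2/N) (2 - log |x|)^(1/gamma)] almost everywhere, where
    [M] is the integral of [w |g|^(N/2)] over a small ball around 0, [C] only
    depends on that ball and on the norm of [u], and [alpha_beta kappa^gamma <= N].
    Hence the exponential integral of order [p] is bounded as soon as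
    [p M^(2 gamma/N) < 1].  By Fatou's lemma, applied to the energy of [u_k] outside
    a small ball (inside it, only the Laplacian term is dropped), [M] is
    eventually at most [1 - ||u||^(N/2) + eps] along the sequence, and the finitely
    many remaining [u_k] are treated one by one with smaller balls. *)

(** * Lebesgue measure on R^n *)

(** Functions are only weakly differentiable and known up to null sets, so no differential equation
    in |x| is integrated: each estimate tests against smooth functions, and the pointwise bound is
    recovered from averages over sets where |x|^2 lies in a given set. Compact support of a test
    function forces the integral of its Laplacian to vanish, whence the subtraction of lam b; as b
    is fixed, its contribution is controlled by the L^1 norm of u alone. Radial functions are
    written in s = |x|^2 when smoothness matters and in y = |x|^N when integrating, since there
    Lebesgue measure becomes V_N dy.

    The constant kappa is the factor 1/((N-2) N V_N) of the fundamental solution times the dual norm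
    of the kernel in Hoelder's inequality. The exponent gamma is the one for which |u|^gamma grows
    at most linearly in -log |x|, so that the exponential is bounded by a power |x|^(-t), integrable
    for t < N. For M just above 1 - ||u||^(N/2), the condition p M^(2 gamma/N) < 1 amounts to p <
    U(u); its strictness leaves room for an M' > M, which absorbs the additive constant C. *)

Section borel_rV.
Context {R : realType} {n : nat}.
Implicit Types (U A : set 'rV[R]_n) (x : 'rV[R]_n).

Lemma measurable_ball_rV x (e : R) : measurable (ball x e).
Proof.
(* In dimension 0 the intersection over no coordinate is the whole space, while a ball of
   nonpositive radius is empty. *)
have [e0|e0] := ltP 0 e; last first.
  rewrite (_ : ball x e = set0) //.
  by rewrite -subset0 => y [/lt_le_trans/(_ e0)]; rewrite ltxx.
rewrite (_ : ball x e = \bigcap_(i in [set: 'I_n])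
    ((fun y : 'rV[R]_n => y ord0 i) @^-1` (ball (x ord0 i) e))).
  apply: fin_bigcap_measurable => // i _.
  rewrite -[X in measurable X]setTI; apply: measurable_coord => //.
  by rewrite ball_itv; exact: measurable_itv.
apply/seteqP; split => [y [_ xy] i _ //=|y xy]; split => // i j.
by rewrite (ord1 i); exact: xy.
Qed.

(** Rational centres and radii 1/(k+1) give countably many sup-norm balls, each measurable for the
    coordinate sigma-algebra; an open set is the union of those it contains. *)
Lemma open_measurable_rV U : open U -> measurable U.
Proof.
move=> oU.
pose emb (q : 'rV[rat]_n) : 'rV[R]_n := map_mx ratr q.
pose F (qk : 'rV[rat]_n * nat) : set 'rV[R]_n :=
  if pselect (ball (emb qk.1) (qk.2.+1%:R^-1) `<=` U)
  then ball (emb qk.1) (qk.2.+1%:R^-1) else set0.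
rewrite (_ : U = \bigcup_qk F qk); last first.
  apply/seteqP; split => [x Ux|x [[q k] _]]; last first.
    by rewrite /F /=; case: pselect => // sub /sub.
  have /nbhs_ballP[e /= e0 eU] : nbhs x U by exact: open_nbhs_nbhs.
  have [k ke] : exists k : nat, k.+1%:R^-1 < e / 2 :> R.
    have := @near_infty_natSinv_lt R (PosNum (divr_gt0 e0 (ltr0Sn R 1))).
    by case=> k _ /(_ k (leqnn _)) /=; exists k.
  have /choice[f fP] : forall i : 'I_n, exists q : rat,
      `|x ord0 i - ratr q| < k.+1%:R^-1 :> R.
    move=> i; have kp : 0 < k.+1%:R^-1 :> R by rewrite invr_gt0.
    have /rat_in_itvoo[q] : x ord0 i - k.+1%:R^-1 < x ord0 i + k.+1%:R^-1 :> R.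
      by rewrite ltrBlDr -addrA ltrDl addr_gt0.
    rewrite in_itv /= => /andP[q1 q2]; exists q.
    by rewrite ltr_distlC q1.
  exists (\row_i f i, k) => //; rewrite /F /=.
  have kp : 0 < k.+1%:R^-1 :> R by rewrite invr_gt0.
  have bx : ball (emb (\row_i f i)) k.+1%:R^-1 x.
    split => // i j; rewrite (ord1 i) !mxE -ball_normE /= distrC.
    exact: fP.
  case: pselect => //; case; move=> y yb; apply: eU.
  have xb := ball_sym bx.
  move: (ball_triangle xb yb); apply: le_ball.
  by rewrite (splitr e) lerD // ltW.
apply: countable_bigcupT_measurable; first exact: countableP.
by move=> qk; rewrite /F; case: pselect => h /=; [exact: measurable_ball_rV|exact: measurable0].
Qed.

Lemma closed_measurable_rV U : closed U -> measurable U.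
Proof.
move=> cU; rewrite -(setCK U); apply: measurableC; apply: open_measurable_rV.
exact: closed_openC.
Qed.

Section regularity.
Variable m : {measure set 'rV[R]_n -> \bar R}.
Hypothesis m_fin : (m setT < +oo)%E.

Let m_lty A : measurable A -> (m A < +oo)%E.
Proof. by move=> mA; apply: le_lt_trans m_fin; rewrite le_measure ?inE. Qed.

(** Approximation from both sides makes the property stable under complement, so that the sets
    having it form a sigma-algebra and only coordinate half-spaces remain to be checked. *)
Let regular A := measurable A /\ forall e : R, 0 < e ->
  exists C W, [/\ closed C, open W, C `<=` A, A `<=` W &
    (m (W `\` C) < e%:E)%E].

Let cvg_small (F : (set 'rV[R]_n)^nat) (e : \bar R) :
  (forall i, measurable (F i)) -> nonincreasing_seq F ->
  (m (\bigcap_i F i) < e)%E -> exists i, (m (F i) < e)%E.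
Proof.
move=> mF niF lte.
have : m \o F @ \oo --> m (\bigcap_n F n).
  apply: nonincreasing_cvg_mu => //; first exact: m_lty.
  exact: bigcapT_measurable.
move=> /(_ [set y | (y < e)%E]) [].
  by apply: open_nbhs_nbhs; split => //; exact: open_ereal_lt_ereal.
by move=> i _ /(_ i (leqnn _)) /= ?; exists i.
Qed.

Let regularC A : regular A -> regular (~` A).
Proof.
move=> [mA rA]; split; first exact: measurableC.
move=> e e0; have [C [W [cC oO CA AO me]]] := rA e e0.
exists (~` W), (~` C); split; [exact: open_closedC|exact: closed_openC| | |].
- exact: subsetC.
- exact: subsetC.
- by rewrite setDE setCK setIC -setDE.
Qed.

Let regularU (F : (set 'rV[R]_n)^nat) :
  (forall i, regular (F i)) -> regular (\bigcup_i F i).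
Proof.
move=> rF; split; first by apply: bigcupT_measurable => i; have [] := rF i.
move=> e e0.
have e2 : 0 < e / 2 by rewrite divr_gt0.
have /choice[CO COP] : forall i, exists CO : set 'rV[R]_n * set 'rV[R]_n,
    [/\ closed CO.1, open CO.2, CO.1 `<=` F i, F i `<=` CO.2 &
    (m (CO.2 `\` CO.1) < (e / 2 / (2 ^ i.+1)%:R)%:E)%E].
  move=> i; have [_ /(_ (e / 2 / (2 ^ i.+1)%:R)) +] := rF i; case.
    by rewrite divr_gt0 // ltr0n expn_gt0.
  by move=> C [W ?]; exists (C, W).
pose C i := (CO i).1; pose W i := (CO i).2.
have mC i : measurable (C i).
  by apply: closed_measurable_rV; rewrite /C; have [] := COP i.
have mO i : measurable (W i).
  by apply: open_measurable_rV; rewrite /W; have [] := COP i.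
have oO : open (\bigcup_i W i).
  by apply: bigcup_open => i _; rewrite /W; have [] := COP i.
(* Only finite unions of the [C i] are closed. The missing part [G k] decreases to a set covered by
   the [W i] minus [C i], of total measure at most e/2. *)
pose G k := \bigcup_i W i `\` \bigcup_(i < k) C i.
have mCk k : measurable (\bigcup_(i < k) C i).
  by apply: bigcup_measurable => ? _.
have [k mk] : exists k, (m (G k) < e%:E)%E.
  apply: cvg_small.
  - by move=> i; apply: measurableD => //; apply: bigcupT_measurable.
  - move=> i j ij; apply/subsetPset; apply: setDS => x [l /= li Cl].
    by exists l => //=; exact: leq_trans li ij.
  - apply: (@le_lt_trans _ _ (\sum_(i <oo) (e / 2 / (2 ^ i.+1)%:R)%:E)%E);
      last first.
      apply: (le_lt_trans (epsilon_trick0 _ (ltW e2))).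
      by rewrite lte_fin; lra.
    apply: (@le_trans _ _ (\sum_(i <oo) m (W i `\` C i))%E); last first.
      apply: lee_nneseries => // i _.
      by apply: ltW; rewrite /W /C; have [] := COP i.
    have mOC i : measurable (W i `\` C i) by exact: measurableD.
    apply: measure_sigma_subadditive => //.
      apply: bigcapT_measurable => i; apply: measurableD => //.
      exact: bigcupT_measurable.
    move=> x Gx; have [[i _ Oi] _] := Gx 0%N I.
    exists i => //; split => // Ci.
    by have [_] := Gx i.+1 I; apply; exists i => /=.
exists (\bigcup_(i < k) C i), (\bigcup_i W i); split => //.
- by apply: closed_bigcup => // i _; rewrite /C; have [] := COP i.
- by move=> x [i _ Ci]; exists i => //; have [_ _ + _ _] := COP i; apply.
- by move=> x [i _ Fi]; exists i => //; have [_ _ _ + _] := COP i; apply.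
Qed.

Let regular0 : regular set0.
Proof.
split=> // e e0; exists set0, set0; split => //; first exact: closed0.
by rewrite setD0 measure0.
Qed.

Let regular_coord (i : 'I_n) (y : R) :
  regular ((fun x : 'rV[R]_n => x ord0 i) @^-1` `[y, +oo[%classic).
Proof.
have mpre (z : R) b : measurable
    ((fun x : 'rV[R]_n => x ord0 i) @^-1` [set` Interval (BSide b z) +oo%O]).
  by rewrite -[X in measurable X]setTI; apply: measurable_coord.
split => // e e0.
pose Wk k := (fun x : 'rV[R]_n => x ord0 i) @^-1`
  `]y - k.+1%:R^-1, +oo[%classic.
pose C := (fun x : 'rV[R]_n => x ord0 i) @^-1` `[y, +oo[%classic.
have subC k : C `<=` Wk k.
  move=> x; rewrite /C /Wk /= !in_itv /= !andbT; apply: lt_le_trans.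
  by rewrite ltrBlDr ltrDl invr_gt0.
have [k mk] : exists k, (m (Wk k `\` C) < e%:E)%E.
  apply: (@cvg_small (fun k => Wk k `\` C)).
  - by move=> k; apply: measurableD; exact: mpre.
  - move=> a b ab; apply/subsetPset; apply: setSD => x.
    rewrite /Wk /= !in_itv /= !andbT; apply: le_lt_trans.
    by rewrite lerB // lef_pV2 ?posrE // ler_nat.
  - rewrite (_ : \bigcap_k _ = set0) ?measure0 //.
    rewrite -subset0 => x Gx; have [_ nC] := Gx 0%N I; apply: nC.
    rewrite /C /= in_itv /= andbT.
    apply/ler_addgt0Pl => d d0.
    have [k kd] : exists k : nat, k.+1%:R^-1 < d :> R.
      have := @near_infty_natSinv_lt R (PosNum d0).
      by case=> k _ /(_ k (leqnn _)) /=; exists k.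
    have [] := Gx k I; rewrite /Wk /= in_itv /= andbT => h _.
    by rewrite -lerBlDl (le_trans _ (ltW h)) // lerB // ltW.
have cc := @coord_continuous R 1 n ord0 i.
exists C, (Wk k); split => //.
- by apply: closed_comp; [move=> ? _; exact: cc|exact: interval_closed].
- by apply: open_comp; [move=> ? _; exact: cc|exact: interval_open].
Qed.

(** Serves in [ae_radial_le]: the image under |x|^2 of a measurable set may fail to be measurable,
    whereas a bounded closed set has a compact image. *)
Lemma closed_inner_regular A (e : R) : measurable A -> 0 < e ->
  exists2 C, closed C & C `<=` A /\ (m (A `\` C) < e%:E)%E.
Proof.
move=> mA e0.
suff [_ /(_ e e0)[C [W [cC oO CA AO me]]]] : regular A.
  exists C => //; split => //; apply: le_lt_trans me.
  have mC := closed_measurable_rV cC.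
  have mO := open_measurable_rV oO.
  by rewrite le_measure ?inE //; [exact: measurableD|exact: measurableD|
    exact: setSD].
have : measurable `<=` regular; last exact.
apply: smallest_sub.
  split; [exact: regular0|by move=> B rB; rewrite setTD; exact: regularC|].
  by move=> F rF; exact: regularU.
rewrite -bigcup_seq => B [i _ [Y mY <-]] /=; rewrite setTI.
have : (@measurable _ R) `<=`
    [set Y | regular ((fun x : 'rV[R]_n => x ord0 i) @^-1` Y)]; last exact.
rewrite /measurable /= /measurableR RGenCInfty.measurableE.
apply: smallest_sub => /=.
  split => /=.
  - by rewrite preimage_set0.
  - by move=> Z; rewrite setTD preimage_setC; exact: regularC.
  - by move=> F; rewrite preimage_bigcup; exact: regularU.
by move=> Z [y ->] /=; exact: regular_coord.
Qed.

End regularity.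

End borel_rV.

(** * Scaling of Lebesgue measure and volumes of cubes *)

Section scaling.
Context {R : realType}.

(** Packages a multiple of an image measure as a measure, the input that uniqueness of Lebesgue and
    product measures requires. *)
Lemma pushforward_measureP d d' (T : measurableType d) (T' : measurableType d')
    (m : {measure set T -> \bar R}) (f : T -> T') (c : R) :
  measurable_fun setT f -> 0 <= c ->
  exists m' : {measure set T' -> \bar R},
    forall A, m' A = (c%:E * m (f @^-1` A))%E.
Proof.
move=> mf c0.
by exists (mscale (NngNum c0)
  (measure_function_pushforward__canonical__measure_function_Measure m mf)).
Qed.

Lemma measurable_mulrl (c : R) : measurable_fun setT ( *%R c).
Proof. exact: mulrl_measurable. Qed.

Lemma lebesgue_measure_scale (c : R) (A : set R) : 0 < c -> measurable A ->
  lebesgue_measure ( *%R c @^-1` A) = (c^-1%:E * lebesgue_measure A)%E.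
Proof.
move=> c0 mA.
have [m' m'E] := @pushforward_measureP _ _ _ (measurableTypeR R)
  (@lebesgue_measure R) ( *%R c) c (measurable_mulrl c) (ltW c0).
have : lebesgue_measure A = m' A.
  apply: lebesgue_measure_unique => // _ [[a b] _ <-].
  rewrite m'E (_ : _ @^-1` _ = `]c^-1 * a, c^-1 * b]%classic); last first.
    apply/seteqP; split => x /=; rewrite !in_itv /= !ltr_pdivrMl //
      !ler_pdivlMl //.
  rewrite lebesgue_measure_itv [X in (_ * X)%E]lebesgue_measure_itv /= !lte_fin.
  rewrite ltr_pM2l ?invr_gt0 //.
  case: ifPn => _; last by rewrite mule0.
  by rewrite -EFinM -mulrBr mulVKf // gt_eqF.
by move=> ->; rewrite m'E muleA -EFinM mulVf ?gt_eqF // mul1e.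
Qed.

Lemma measurable_scaler_rV n (c : R) :
  measurable_fun setT ( *:%R c : 'rV[R]_n -> 'rV[R]_n).
Proof.
apply: measurable_fun_coordP => i.
under eq_fun do rewrite mxE.
exact: (measurableT_comp (measurable_mulrl c) (measurable_coord i)).
Qed.

(** By uniqueness of the product measure: [c ^+ n.+1] times the image of the product under [sc] has
    the right values on rectangles, by the one-dimensional case and induction. *)
Lemma lebesgue_rV_scale n (c : R) (A : set 'rV[R]_n) : 0 < c -> measurable A ->
  lebesgue_rV n ( *:%R c @^-1` A) = ((c^-1 ^+ n)%:E * lebesgue_rV n A)%E.
Proof.
move=> c0; elim: n A => [|n IH] A mA.
  rewrite expr0 mul1e /= /dirac !indicE; congr (_%:R%:E).
  by apply: congr1; apply/idP/idP; rewrite !inE /= scaler0.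
have cn0 : c != 0 by rewrite gt_eqF.
pose sc (p : R * 'rV[R]_n) := (c * p.1, c *: p.2).
have msc : measurable_fun setT sc.
  apply/measurable_fun_pairP; split.
    exact: (measurableT_comp (measurable_mulrl c) measurable_fst).
  exact: (measurableT_comp (@measurable_scaler_rV n c) measurable_snd).
have [m' m'E] := @pushforward_measureP _ _ _
  (measurableTypeR R * 'rV[R]_n)%type
  ((@lebesgue_measure R) \x (lebesgue_rV n))%E sc (c ^+ n.+1) msc
  (exprn_ge0 _ (ltW c0)).
rewrite /= /consv_measure /pushforward.
set A' := @consv R n @^-1` A.
have mA' : measurable A'.
  by rewrite -[X in measurable X]setTI; apply: measurable_consv.
have scE p : c *: consv p = consv (sc p).
  apply/rowP => i; rewrite !mxE.
  by case: unliftP => [j|] _; rewrite ?mxE.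
have -> : @consv R n @^-1` ( *:%R c @^-1` A) = sc @^-1` A'.
  by apply/seteqP; split => p; rewrite /A' /preimage /mkset scE.
have -> : (lebesgue_measure \x lebesgue_rV n)%E A' = m' A'.
  apply: product_measure_unique => // X Y mX mY; rewrite m'E.
  rewrite (_ : sc @^-1` _ = ( *%R c @^-1` X) `*` ( *:%R c @^-1` Y)) //.
  have msX : measurable ( *%R c @^-1` X).
    by rewrite -[X in measurable X]setTI; apply: measurable_mulrl.
  have msY : measurable ( *:%R c @^-1` Y).
    by rewrite -[X in measurable X]setTI; apply: measurable_scaler_rV.
  transitivity ((c ^+ n.+1)%:E * (lebesgue_measure ( *%R c @^-1` X) *
      lebesgue_rV n ( *:%R c @^-1` Y)))%E.
    by congr (_ * _)%E; exact: product_measure1E.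
  rewrite lebesgue_measure_scale // IH //.
  rewrite muleACA.
  have cE (z : \bar R) :
      ((c ^+ n.+1)%:E * (c^-1%:E * (c^-1 ^+ n)%:E * z) = z)%E.
    by rewrite -EFinM -exprS muleA -EFinM -exprMn divff // expr1n mul1e.
  exact: cE.
by rewrite m'E muleA -EFinM -exprMn mulVf // expr1n mul1e.
Qed.

(** Comparison sets of explicit measure: placed around and inside balls, they show that
    [ball_volume] is finite and positive. *)
Definition cube n (c : R) : set 'rV[R]_n :=
  [set x | forall i, `|x ord0 i| <= c].

Lemma measurable_cube n (c : R) : measurable (@cube n c).
Proof.
rewrite (_ : cube c = \bigcap_(i in [set: 'I_n])
    ((fun y : 'rV[R]_n => y ord0 i) @^-1` `[- c, c]%classic)).
  apply: fin_bigcap_measurable => // i _.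
  by rewrite -[X in measurable X]setTI; apply: measurable_coord.
apply/seteqP; split => y h i; first by rewrite /= in_itv /= -ler_norml.
by have := h i I; rewrite /= in_itv /= -ler_norml.
Qed.

Lemma lebesgue_rV_cube n (c : R) : 0 <= c ->
  lebesgue_rV n (cube c) = ((2 * c) ^+ n)%:E.
Proof.
move=> c0; elim: n => [|n IH].
  by rewrite /= /dirac indicE mem_set //= => -[].
rewrite /= /consv_measure /pushforward (_ : _ @^-1` _ =
    `[- c, c]%classic `*` @cube n c).
  transitivity (lebesgue_measure (`[(- c)%R, c]%classic : set R) *
      lebesgue_rV n (cube c))%E.
    by apply: product_measure1E => //; exact: measurable_cube.
  rewrite IH lebesgue_measure_itv /= lte_fin.
  have [c00|c00] := ltP (- c) c.
    by rewrite -EFinD -EFinM exprS opprK -mulr2n mulr_natl.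
  have -> : c = 0 by lra.
  by rewrite mul0e mulr0 expr0n.
apply/seteqP; split => -[a v] /=.
  move=> h; split.
    by have := h ord0; rewrite !mxE unlift_none /= in_itv /= ler_norml.
  by move=> i; have := h (lift ord0 i); rewrite !mxE liftK.
move=> [+ h2]; rewrite in_itv /= -ler_norml => h1 i.
by rewrite mxE; case: unliftP.
Qed.

End scaling.

(** * Volumes of Euclidean balls and integrals of radial functions *)

Section radial_measure.
Context {R : realType} {N : nat}.
Implicit Types x : 'rV[R]_N.

(** Unlike [enorm], the squared norm is smooth at the origin; smooth radial functions are therefore
    written [f (sqn x)]. *)
Definition sqn x : R := \sum_(i < N) x ord0 i ^+ 2.

Lemma sqn_ge0 x : 0 <= sqn x.
Proof. by apply: sumr_ge0 => i _; exact: sqr_ge0. Qed.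

Lemma enormE x : enorm x = Num.sqrt (sqn x). Proof. by []. Qed.

Lemma enorm_ge0 x : 0 <= enorm x. Proof. exact: sqrtr_ge0. Qed.

Lemma sqr_enorm x : enorm x ^+ 2 = sqn x.
Proof. by rewrite enormE sqr_sqrtr // sqn_ge0. Qed.

Lemma enormZ (c : R) x : 0 <= c -> enorm (c *: x) = c * enorm x.
Proof.
move=> c0; rewrite !enormE (_ : sqn (c *: x) = c ^+ 2 * sqn x).
  by rewrite sqrtrM ?sqr_ge0 // sqrtr_sqr ger0_norm.
by rewrite /sqn mulr_sumr; apply: eq_bigr => i _; rewrite mxE exprMn.
Qed.

Lemma measurable_sqn : measurable_fun setT sqn.
Proof.
by apply: measurable_sum => i; apply: measurable_funX; exact: measurable_coord.
Qed.

Lemma measurable_enorm : measurable_fun setT (@enorm R N).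
Proof.
have -> : @enorm R N = (fun t : R => t `^ 2^-1) \o sqn.
  by apply/funext => x /=; rewrite powR12_sqrt // sqn_ge0.
by apply: measurableT_comp measurable_sqn; exact: measurable_powR.
Qed.

Definition oball (r : R) : set 'rV[R]_N := [set x | enorm x < r].

Lemma measurable_oball (r : R) : measurable (oball r).
Proof.
rewrite (_ : oball r = @enorm R N @^-1` `]-oo, r[%classic); last first.
  by apply/seteqP; split => x /=; rewrite in_itv.
by rewrite -[X in measurable X]setTI; apply: measurable_enorm.
Qed.

Lemma measurable_unit_ball : measurable (@unit_ball R N).
Proof. exact: measurable_oball. Qed.

Lemma normr_coord_le_enorm x i : `|x ord0 i| <= enorm x.
Proof.
rewrite -sqrtr_sqr enormE ler_sqrt ?sqn_ge0 // /sqn (bigD1 i) //= lerDl.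
by apply: sumr_ge0 => j _; exact: sqr_ge0.
Qed.

Lemma lebesgue_rV_ball_lty (r : R) :
  (lebesgue_rV N (oball r) < +oo)%E.
Proof.
apply: (@le_lt_trans _ _ (lebesgue_rV N (@cube R N (Num.max r 0)))).
  rewrite le_measure ?inE //; first exact: measurable_oball.
    exact: measurable_cube.
  move=> x /= xr i; apply: (le_trans (normr_coord_le_enorm x i)).
  by rewrite le_max (ltW xr).
by rewrite lebesgue_rV_cube ?ltry // le_max lexx orbT.
Qed.

Lemma lebesgue_rV_unit_ballE :
  lebesgue_rV N (@unit_ball R N) = (ball_volume N)%:E.
Proof. by rewrite fineK // ge0_fin_numE // lebesgue_rV_ball_lty. Qed.

Lemma ball_volume_gt0 : 0 < ball_volume N :> R.
Proof.
have Np : 0 < (N.+1%:R : R)^-1 by rewrite invr_gt0.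
rewrite -lte_fin -lebesgue_rV_unit_ballE.
(* With half-side 1/(N+1) each of the N squares is at most 1/(N+1), so their sum stays below 1, even
   for N = 0. *)
apply: (@lt_le_trans _ _ (lebesgue_rV N (@cube R N N.+1%:R^-1))).
  by rewrite lebesgue_rV_cube ?(ltW Np) // lte_fin exprn_gt0 // mulr_gt0.
rewrite le_measure ?inE //.
- exact: measurable_cube.
- exact: measurable_unit_ball.
- move=> x /= h; rewrite /unit_ball /= enormE -[X in _ < X]sqrtr1 ltr_sqrt //.
  apply: (@le_lt_trans _ _ (\sum_(i < N) (N.+1%:R : R)^-1)).
    apply: ler_sum => i _; rewrite -real_normK ?num_real //.
    rewrite expr2; apply: (le_trans _ (h i)).
    by rewrite ler_piMr // (le_trans (h i)) // invf_le1 ?ltr0n // ler1n.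
  by rewrite sumr_const card_ord -[_ *+ N]mulr_natl ltr_pdivrMr // mul1r ltr_nat.
Qed.

Lemma lebesgue_rV_ball (r : R) : 0 < r ->
  lebesgue_rV N (oball r) = (r ^+ N * ball_volume N)%:E.
Proof.
move=> r0; have ri : 0 < r^-1 by rewrite invr_gt0.
rewrite (_ : oball r = *:%R r^-1 @^-1` (@unit_ball R N)); last first.
  apply/seteqP; split => x; rewrite /unit_ball /= enormZ ?(ltW ri) //;
  by rewrite ltr_pdivrMl // mulr1.
rewrite lebesgue_rV_scale //; last exact: measurable_unit_ball.
by rewrite invrK lebesgue_rV_unit_ballE.
Qed.

End radial_measure.

Section integral_radial.
Context {R : realType} {N : nat}.
Hypothesis N_gt0 : (0 < N)%N.

Let f (x : 'rV[R]_N) : measurableTypeR R := enorm x ^+ N.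

Let mf : measurable_fun setT f.
Proof. by apply: measurable_funX; exact: measurable_enorm. Qed.

Let V := @ball_volume R N.

Let V0 : 0 <= V. Proof. exact/ltW/ball_volume_gt0. Qed.

Let preimage_ray (r : R) :
  lebesgue_rV N (f @^-1` `]-oo, r[%classic) = (V * Num.max 0 r)%:E.
Proof.
have [r0|r0] := leP r 0.
  rewrite (_ : _ @^-1` _ = set0) ?measure0 ?mulr0 //.
  rewrite -subset0 => x; rewrite /= in_itv /= => /lt_le_trans/(_ r0).
  by rewrite ltNge exprn_ge0 // enorm_ge0.
have rN0 : 0 < r `^ N%:R^-1 by rewrite powR_gt0.
have rNE : (r `^ N%:R^-1) ^+ N = r.
  rewrite -powR_mulrn ?powR_ge0 // -powRrM mulVf ?powRr1 ?ltW //.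
  by rewrite pnatr_eq0 -lt0n.
rewrite mulrC -[in RHS]rNE -lebesgue_rV_ball //; congr (lebesgue_rV N _).
apply/seteqP; split => x; rewrite /= in_itv /= -[X in f x < X]rNE.
all: by rewrite ltr_pXn2r // nnegrE ?enorm_ge0 ?ltW.
Qed.

(** The set where |x|^N < r has measure V_N r, so the image of Lebesgue measure under [f] and V_N
    times Lebesgue measure on the half-line agree on rays, hence everywhere. The N-th power leaves
    no Jacobian. *)
Lemma integral_radial (h : R -> \bar R) : measurable_fun setT h ->
  (forall y, (0 <= h y)%E) ->
  (\int[lebesgue_rV N]_(x in unit_ball) h (enorm x ^+ N)%R =
   (ball_volume N)%:E * \int[lebesgue_measure]_(y in `[0%R, 1%R[) h y)%E.
Proof.
move=> mh h0.
have -> : @unit_ball R N = f @^-1` `[0, 1[%classic.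
  apply/seteqP; split => x; rewrite /unit_ball /= in_itv /=.
    by move=> x1; rewrite exprn_ge0 ?enorm_ge0 // exprn_ilt1 ?enorm_ge0 // -lt0n.
  by case/andP => _; rewrite expr_lt1 ?enorm_ge0.
have mh' D : measurable_fun D h by exact: measurable_funTS.
rewrite -(@ge0_integral_pushforward _ _ _ _ _ _ mf) //.
have -> : (\int[lebesgue_measure]_(y in `[0%R, 1%R[) h y =
    \int[mrestr (@lebesgue_measure R) (measurable_itv `[0%R, +oo[)]_(
      y in `[0%R, 1%R[) h y)%E.
  apply: eq_measure_integral => A mA AI; rewrite /mrestr.
  congr (lebesgue_measure _); apply/esym/setIidl => y /AI /=.
  by rewrite !in_itv /= andbT => /andP[].
rewrite -(@ge0_integral_mscale _ _ _ _ _ _ (NngNum V0)) //.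
pose pm := measure_function_pushforward__canonical__measure_function_Measure
  (lebesgue_rV N) mf.
apply: (@eq_measure_integral _ _ _ _ _ pm) => A mA _.
pose sm : {measure set (measurableTypeR R) -> \bar R} := mscale (NngNum V0)
  (mrestr (@lebesgue_measure R) (measurable_itv `[0%R, +oo[)).
rewrite -[LHS]/(pm A) -[RHS]/(sm A).
apply: (@measure_unique _ R (measurableTypeR R) (@measurable_realfun.RGenInftyO.G R)
  (fun k => `]-oo, k%:R[%classic) _ _ _ _ pm sm) => //.
- exact: measurable_realfun.RGenInftyO.measurableE.
- move=> _ _ [x ->] [y ->]; exists (Num.min x y).
  by apply/seteqP; split => z /=; rewrite !in_itv /= lt_min => /andP.
- by move=> k; exists k%:R.
- rewrite -subTset => y _; exists (Num.bound `|y|) => //=.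
  by rewrite in_itv /= (le_lt_trans (ler_norm _)) // archi_boundP.
- move=> _ [r ->].
  rewrite [LHS]preimage_ray /= /mscale /= /mrestr EFinM; congr (_ * _)%E.
  have -> : `]-oo, r[%classic `&` `[0, +oo[%classic = `[0, r[%classic.
    by apply/seteqP; split => z /=; rewrite !in_itv /= andbT andbC => /andP.
  rewrite lebesgue_measure_itv /= lte_fin.
  by case: ltP => // _; rewrite sube0.
- by move=> k; rewrite /pushforward [X in (X < _)%E]preimage_ray ltry.
- exact: mh'.
- exact: mh'.
Qed.

End integral_radial.

(** * Smooth radial functions *)

Section smooth_on.
Context {R : realType}.
Implicit Types (k : nat) (D : set R) (f g : R -> R).

(** Continuity of the last derivative is not demanded: in [smooth_on] it follows from the next
    order. *)
Fixpoint cdiff k D f : Prop :=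
  if k is k'.+1 then (forall x, D x -> derivable f x 1) /\ cdiff k' D f^`()%classic
  else True.

Definition smooth_on D f := forall k, cdiff k D f.

Lemma eq_derive1_on D f g x : open D -> {in D, f =1 g} -> D x ->
  \forall y \near x, f y = g y.
Proof.
move=> oD fg Dx; apply: filterS (open_nbhs_nbhs (conj oD Dx)).
by move=> y Dy; apply: fg; rewrite inE.
Qed.

Lemma eq_cdiff k D f g : open D -> {in D, f =1 g} -> cdiff k D f -> cdiff k D g.
Proof.
move=> oD; elim: k f g => // k IH f g fg [df cf]; split.
  move=> x Dx; apply: (near_eq_derivable _ (df x Dx)).
  exact: (eq_derive1_on oD fg Dx).
apply: IH cf => x; rewrite inE => Dx; rewrite !derive1E; apply: near_eq_derive.
exact: (eq_derive1_on oD fg Dx).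
Qed.

Lemma cdiffW k D f : cdiff k.+1 D f -> cdiff k D f.
Proof. by elim: k f => // k IH f [df cf]; split => //; exact: IH. Qed.

Lemma cdiffU k D E f : cdiff k D f -> cdiff k E f -> cdiff k (D `|` E) f.
Proof.
elim: k f => // k IH f [df cf] [ef cf']; split; last exact: IH.
by move=> x [/df|/ef].
Qed.

Lemma sub_cdiff k D E f : D `<=` E -> cdiff k E f -> cdiff k D f.
Proof.
move=> DE; elim: k f => // k IH f [ef cf]; split; last exact: IH.
by move=> x /DE /ef.
Qed.

Lemma cdiffS k D f g : open D -> (forall x, D x -> is_derive x 1 f (g x)) ->
  cdiff k D g -> cdiff k.+1 D f.
Proof.
move=> oD fg cg; split; first by move=> x Dx; have [] := fg x Dx.
apply: eq_cdiff cg => // x; rewrite inE => Dx; rewrite derive1E.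
by have [_ ->] := fg x Dx.
Qed.

Lemma cdiff_derive k D f x : cdiff k.+1 D f -> D x ->
  is_derive x 1 f (f^`()%classic x).
Proof. by move=> [df _] Dx; rewrite derive1E; apply/derivableP/df. Qed.

Lemma cdiff_cst k D (c : R) : open D -> cdiff k D (cst c).
Proof.
move=> oD; elim: k c => // k IH c.
by apply: (@cdiffS _ _ _ (cst 0)) => // x _; exact: is_derive_cst.
Qed.

Lemma cdiffD k D f g : open D -> cdiff k D f -> cdiff k D g ->
  cdiff k D (fun x => f x + g x).
Proof.
move=> oD; elim: k f g => // k IH f g cf cg.
apply: (@cdiffS _ _ _ (fun x => f^`()%classic x + g^`()%classic x)) => //.
  move=> x Dx; exact: (is_deriveD (cdiff_derive cf Dx) (cdiff_derive cg Dx)).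
by apply: IH; [case: cf|case: cg].
Qed.

Lemma cdiffM k D f g : open D -> cdiff k D f -> cdiff k D g ->
  cdiff k D (fun x => f x * g x).
Proof.
move=> oD; elim: k f g => // k IH f g cf cg.
apply: (@cdiffS _ _ _ (fun x => f x * g^`()%classic x + g x * f^`()%classic x)) => //.
  move=> x Dx; exact: (is_deriveM (cdiff_derive cf Dx) (cdiff_derive cg Dx)).
by apply: cdiffD => //; apply: IH;
  [exact: cdiffW|case: cg|exact: cdiffW|case: cf].
Qed.

Lemma cdiff_affine k f (a b : R) : cdiff k setT f ->
  cdiff k setT (fun x => f (a * x + b)).
Proof.
elim: k f => // k IH f cf.
apply: (@cdiffS _ _ _ (fun x => f^`()%classic (a * x + b) * a)); first exact: openT.
  move=> x _; apply: (@is_derive1_comp _ f (fun x => a * x + b)).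
    exact: cdiff_derive cf _.
  apply: is_derive_eq.
  by rewrite addr0 /GRing.scale /= mulr1.
apply: cdiffM; [exact: openT|by apply: IH; case: cf|].
exact: (cdiff_cst _ _ openT).
Qed.

Lemma cdiff_powR k (a : R) : cdiff k [set x | 0 < x] (fun x => x `^ a).
Proof.
have op : open [set x : R | 0 < x] by exact: open_gt.
elim: k a => // k IH a.
apply: (@cdiffS _ _ _ (fun x => a * x `^ (a - 1))) => //.
by apply: (@cdiffM _ _ (cst a) (fun x => x `^ (a - 1))) => //; exact: cdiff_cst.
Qed.

Lemma smooth_on_derive D f : smooth_on D f -> smooth_on D f^`()%classic.
Proof. by move=> sf k; have [] := sf k.+1. Qed.

Lemma smooth_on_is_derive D f x : smooth_on D f -> D x ->
  is_derive x 1 f (f^`()%classic x).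
Proof. by move=> sf; exact: cdiff_derive (sf 1%N). Qed.

Lemma smooth_on_continuous D f x : smooth_on D f -> D x ->
  {for x, continuous f}.
Proof.
move=> sf Dx; apply/differentiable_continuous/derivable1_diffP.
by have [] := sf 1%N; move=> + _; exact.
Qed.

End smooth_on.

(** * A smooth bump function on the line *)

Section bump.
Context {R : realType}.
Implicit Types (x : R) (m : nat).

(** The powers x^(-m) make the family closed under differentiation: the derivative of [h m] is a
    combination of [h m.+2] and [h m.+1], so smoothness is one induction for all m. *)
Let h m x : R := if 0 < x then (x ^+ m)^-1 * expR (- x^-1) else 0.

(** A quadratic bound makes the difference quotient at 0 tend to 0. It comes from the term of degree
    m+2 of the exponential series at 1/x. *)
Let h_small m x : `|h m x| <= (m.+2)`!%:R * x ^+ 2.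
Proof.
rewrite /h; case: ltP => x0; last first.
  by rewrite normr0 mulr_ge0 ?sqr_ge0.
have y0 : 0 < x^-1 by rewrite invr_gt0.
rewrite ger0_norm; last by rewrite mulr_ge0 ?expR_ge0 // invr_ge0 exprn_ge0 ?ltW.
rewrite expRN ler_pdivrMr ?expR_gt0 // -mulrA -exprVn.
have := expR_ge1Dxn m.+1 (ltW y0); set e := expR _ => le.
have f0 : 0 < (m.+2)`!%:R :> R by rewrite ltr0n fact_gt0.
have {}le : x^-1 ^+ m.+2 <= (m.+2)`!%:R * e.
  rewrite -ler_pdivrMl // mulrC; apply: le_trans le.
  by rewrite lerDr.
have -> : x^-1 ^+ m = x ^+ 2 * x^-1 ^+ m.+2.
  by rewrite -[m.+2]addn2 exprD mulrCA -exprMn divff ?gt_eqF // expr1n mulr1.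
by rewrite [leRHS]mulrCA ler_pM2l // exprn_gt0.
Qed.

Let h_derive m x :
  is_derive x 1 (h m) (h m.+2 x + (- m%:R) * h m.+1 x).
Proof.
have [x0|x0|x0] := ltgtP x 0.
- rewrite /h ltNge (ltW x0) /= mulr0 addr0.
  apply: (@near_eq_is_derive _ _ _ (cst 0)).
  near=> y; rewrite ltNge (_ : y <= 0) //; apply/ltW.
  by near: y; exact: lt_nbhsl.
- have xm : x ^+ m != 0 by rewrite expf_neq0 // gt_eqF.
  have xn0 : x != 0 by rewrite gt_eqF.
  have d1 : is_derive x 1 (fun y : R => (y ^+ m)^-1)
      (- (x ^+ m) ^- 2 *: (m%:R * x ^+ m.-1)).
    apply: is_deriveV => //.
    apply: DeriveDef; first exact: exprn_derivable.
    by rewrite exp_derive /GRing.scale /= mulr1.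
  have d2 : is_derive x 1 (fun y : R => expR (- y^-1))
      (expR (- x^-1) * (x ^- 2)).
    apply: (@is_derive1_comp _ expR (fun y => - y^-1)).
    apply: is_derive_eq; first by apply: is_deriveN; exact: is_deriveV.
    by rewrite /GRing.scale /= mulr1 opprK.
  have d3 : is_derive x 1 (fun y : R => (y ^+ m)^-1 * expR (- y^-1))
      (h m.+2 x + (- m%:R) * h m.+1 x).
    move: (is_deriveM d1 d2); congr (is_derive _ _ _ _).
    rewrite /h x0 /GRing.scale /=.
    case: (m) xm => [|k] xk.
      rewrite !expr0 mul0r !mulr0 oppr0 mul0r addr0 invr1 mul1r.
      by field.
    by rewrite /= !exprS; field; rewrite xn0 expf_neq0.
  apply: near_eq_is_derive d3.
  near=> y; rewrite /h (_ : 0 < y) //.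
  by near: y; exact: lt_nbhsr.
- rewrite x0 /h ltxx mulr0 addr0.
  have c : (fun t : R => t^-1 *: ((h m \o shift 0) (t *: 1) - h m 0)) @ 0^' --> 0.
    apply: norm_cvg0. 
    apply: (@squeeze_cvgr _ _ _ _ (cst 0) (fun t => (m.+2)`!%:R * `|t|)).
    + near=> t; rewrite normr_ge0 /=.
      rewrite {2}/h ltxx subr0 /= addr0 /GRing.scale /= mulr1 normrM normfV.
      have t0 : t != 0 by near: t; exact: nbhs_dnbhs_neq.
      rewrite ler_pdivrMl ?normr_gt0 //; apply: (le_trans (h_small m t)).
      by rewrite [leRHS]mulrCA -expr2 real_normK ?num_real.
    + exact: cvg_cst.
    + rewrite -[X in _ --> X](mulr0 (m.+2)`!%:R); apply: cvgMr.
      rewrite -[X in _ --> X](@normr0 R R); apply: cvg_norm.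
      exact: cvg_within.
  by split; [exact: cvgP c|exact: cvg_lim c].
Unshelve. all: by end_near. Qed.

Let h_smooth m k : cdiff k setT (h m).
Proof.
elim: k m => // k IH m.
apply: (cdiffS openT (fun x _ => h_derive m x)).
by apply: cdiffD; [exact: openT|exact: IH|apply: cdiffM; [exact: openT|
  exact: (cdiff_cst _ _ openT)|exact: IH]].
Qed.

Lemma smooth_bump (a b : R) : exists f : R -> R, [/\ smooth_on setT f,
  forall x, 0 <= f x <= 1 & forall x, (0 < f x) = (a < x < b)].
Proof.
have h_ge0 x : 0 <= h 0 x.
  by rewrite /h; case: ifP => // _; rewrite mulr_ge0 ?expR_ge0 // expr0 invr1.
have h_le1 x : h 0 x <= 1.
  rewrite /h; case: ifPn => // x0; rewrite expr0 invr1 mul1r -expR0 ler_expR.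
  by rewrite oppr_le0 invr_ge0 ltW.
have h_gt0 x : (0 < h 0 x) = (0 < x).
  rewrite /h; case: (ltP 0 x) => x0; last by rewrite ltxx.
  by rewrite expr0 invr1 mul1r expR_gt0.
exists (fun x => h 0 (1 * x + - a) * h 0 (- 1 * x + b)); split.
- by move=> k; apply: cdiffM; [exact: openT|exact: cdiff_affine|exact: cdiff_affine].
- by move=> x; rewrite mulr_ge0 // mulr_ile1.
- move=> x; apply/idP/idP.
    rewrite lt_neqAle eq_sym mulf_eq0 negb_or => /andP[/andP[h1 h2] _].
    have : 0 < h 0 (1 * x - a) by rewrite lt_neqAle eq_sym h1 h_ge0.
    have : 0 < h 0 (- 1 * x + b) by rewrite lt_neqAle eq_sym h2 h_ge0.
    rewrite !h_gt0 mul1r subr_gt0 mulN1r addrC subr_gt0 => -> ->.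
    by [].
  move=> /andP[ax xb]; rewrite mulr_gt0 // h_gt0.
    by rewrite mul1r subr_gt0.
  by rewrite mulN1r addrC subr_gt0.
Qed.

End bump.

(** * Radial test functions and their Laplacian *)

Section radial_test.
Context {R : realType} {N : nat}.
Implicit Types (x : 'rV[R]_N) (g Phi : R -> R) (f : 'rV[R]_N -> R).
Local Notation e_ i := (delta_mx ord0 i : 'rV[R]_N).

Lemma is_derive_line f x v (df : R) :
  is_derive (0 : R) 1 (fun h : R => f (h *: v + x)) df -> is_derive x v f df.
Proof.
have E : (fun h : R => h^-1 *: ((f \o shift x) (h *: v) - f x)) =
   (fun h : R => h^-1 *: (((fun h : R => f (h *: v + x)) \o shift 0) (h *: 1) -
     f (0 *: v + x))).
  by apply/funext => h /=; rewrite addr0 scale0r add0r /GRing.scale /= mulr1.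
by move=> [d1 d2]; split; [rewrite /derivable E; exact: d1|rewrite /derive E].
Qed.

Lemma sqn_line x i (h : R) :
  sqn (h *: e_ i + x) = sqn x + (2 * x ord0 i * h + h ^+ 2).
Proof.
rewrite /sqn (bigD1 i) //= [in RHS](bigD1 i) //= !mxE !eqxx mulr1.
rewrite (eq_bigr (fun j => x ord0 j ^+ 2)); last first.
  by move=> j /negbTE ji; rewrite !mxE ji andbF mulr0 add0r.
by rewrite sqrrD; ring.
Qed.

Lemma continuous_sqn : continuous (@sqn R N).
Proof.
apply: continuous_big; first exact: add_continuous.
move=> i _ x; apply: (@continuous_comp _ _ _ (fun x : 'rV[R]_N => x ord0 i)
  (fun t : R => t ^+ 2) x); first exact: coord_continuous.
exact: exprn_continuous.
Qed.

(** A class stable under partial derivatives, which makes smoothness of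
    [g (|x|^2)] an easy induction. *)
Inductive radpoly : ('rV[R]_N -> R) -> Prop :=
| radpoly_comp g : smooth_on setT g -> radpoly (fun x => g (sqn x))
| radpoly_coord i : radpoly (fun x => x ord0 i)
| radpolyD f1 f2 : radpoly f1 -> radpoly f2 -> radpoly (fun x => f1 x + f2 x)
| radpolyM f1 f2 : radpoly f1 -> radpoly f2 -> radpoly (fun x => f1 x * f2 x).

Lemma smooth_on_cst (c : R) : smooth_on setT (cst c).
Proof. by move=> k; apply: cdiff_cst; exact: openT. Qed.

Lemma radpoly_cst (c : R) : radpoly (cst c).
Proof. exact: (radpoly_comp (smooth_on_cst c)). Qed.

Lemma is_derive_comp_sqn g i x : smooth_on setT g ->
  is_derive x (e_ i) (fun x => g (sqn x)) (g^`()%classic (sqn x) * (2 * x ord0 i)).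
Proof.
move=> sg; apply: is_derive_line.
under eq_fun do rewrite sqn_line.
apply: (@is_derive1_comp _ g (fun h => sqn x + (2 * x ord0 i * h + h ^+ 2))).
  rewrite mulr0 expr0n /= !addr0.
  exact: smooth_on_is_derive sg I.
apply: is_derive_eq.
by rewrite /GRing.scale /= !mulr1; ring.
Qed.

Lemma is_derive_coord i j x :
  is_derive x (e_ i) (fun x : 'rV[R]_N => x ord0 j) (i == j)%:R.
Proof.
apply: is_derive_line.
under eq_fun do rewrite !mxE eqxx /=.
apply: is_derive_eq.
by rewrite addr0 /GRing.scale /= mul0r add0r mulr1 eq_sym.
Qed.

Lemma radpoly_partial f i : radpoly f ->
  (forall x, derivable f x (e_ i)) /\ radpoly (partial i f).
Proof.
elim=> {f} [g sg|j|f1 f2 _ [d1 r1] _ [d2 r2]|f1 f2 rf1 [d1 r1] rf2 [d2 r2]].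
- split=> [x|]; first by have [] := is_derive_comp_sqn i x sg.
  rewrite (_ : partial i _ = fun x => g^`()%classic (sqn x) * (2 * x ord0 i)).
    apply: radpolyM; first by apply: radpoly_comp; exact: smooth_on_derive.
    by apply: radpolyM; [exact: radpoly_cst|exact: radpoly_coord].
  by apply/funext => x; have [_] := is_derive_comp_sqn i x sg.
- split=> [x|]; first by have [] := is_derive_coord i j x.
  rewrite (_ : partial i _ = cst (i == j)%:R); first exact: radpoly_cst.
  by apply/funext => x; have [_] := is_derive_coord i j x.
- split=> [x|]; first exact: derivableD.
  rewrite (_ : partial i _ = fun x => partial i f1 x + partial i f2 x).
    exact: radpolyD.
  by apply/funext => x; rewrite /partial deriveD.
- split=> [x|]; first exact: derivableM.
  rewrite (_ : partial i _ = fun x => f1 x * partial i f2 x +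
    f2 x * partial i f1 x).
    by apply: radpolyD; exact: radpolyM.
  by apply/funext => x; rewrite /partial deriveM.
Qed.

Lemma radpoly_continuous f : radpoly f -> continuous f.
Proof.
elim=> {f} [g sg|j|f1 f2 _ c1 _ c2|f1 f2 _ c1 _ c2] x.
- apply: (@continuous_comp _ _ _ (@sqn R N) g x); first exact: continuous_sqn.
  exact: smooth_on_continuous sg I.
- exact: coord_continuous.
- exact: cvgD (c1 x) (c2 x).
- exact: cvgM (c1 x) (c2 x).
Qed.

Lemma radpoly_smooth f : radpoly f -> smooth f.
Proof.
move=> rf s; have {}rf : radpoly (iter_partial s f).
  by elim: s => //= i s IH; have [] := radpoly_partial i IH.
split; first exact: radpoly_continuous.
by move=> i; have [] := radpoly_partial i rf.
Qed.

Lemma radial_test_function Phi (eta : R) : smooth_on setT Phi -> eta < 1 ->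
  (forall s, eta <= s -> Phi s = 0) ->
  test_function (fun x : 'rV[R]_N => Phi (sqn x)).
Proof.
move=> sP eta1 P0.
have sub : closure [set x : 'rV[R]_N | Phi (sqn x) != 0] `<=`
    [set x | sqn x <= eta].
  rewrite closureE => x; apply => /=; split.
    apply: (@closed_comp _ _ (@sqn R N) [set t | t <= eta]).
      by move=> ? _; exact: continuous_sqn.
    exact: closed_le.
  by move=> y /=; apply: contraNT; rewrite -ltNge => /ltW/P0 ->.
split.
- exact: radpoly_smooth (radpoly_comp sP).
- apply: bounded_closed_compact; last exact: closed_closure.
  exists 1; split; first exact: num_real.
  move=> M M1 x /sub /= xe; rewrite /Num.norm /= mx_normrE.
  apply/bigmax_leP; split; first by rewrite ltW // (lt_trans _ M1).
  move=> [i j] _ /=; rewrite (ord1 i) (le_trans (normr_coord_le_enorm x j)) //.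
  rewrite (le_trans _ (ltW M1)) // enormE -[leRHS]sqrtr1 ler_sqrt //.
  by rewrite (le_trans xe) // ltW.
- move=> x /sub /= xe; rewrite /unit_ball /= enormE -[X in _ < X]sqrtr1.
  by rewrite ltr_sqrt // (le_lt_trans xe).
Qed.

Lemma laplacian_radial Phi x : smooth_on setT Phi ->
  laplacian (fun x : 'rV[R]_N => Phi (sqn x)) x =
  2 * N%:R * Phi^`()%classic (sqn x) +
  4 * sqn x * Phi^`()%classic^`()%classic (sqn x).
Proof.
move=> sP; have sP' := smooth_on_derive sP.
rewrite /laplacian (eq_bigr (fun i => 2 * Phi^`()%classic (sqn x) +
    x ord0 i ^+ 2 * (4 * Phi^`()%classic^`()%classic (sqn x)))).
  rewrite big_split /= sumr_const card_ord -mulr_suml -/(sqn x) -mulr_natl.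
  by ring.
move=> i _.
rewrite (_ : partial i (fun x => Phi (sqn x)) =
    (fun x => Phi^`()%classic (sqn x)) * (fun x => 2 * x ord0 i)); last first.
  by apply/funext => y; have [_] := is_derive_comp_sqn i y sP.
have d1 := is_derive_comp_sqn i x sP'.
have d2 : is_derive x (e_ i) (fun x : 'rV[R]_N => 2 * x ord0 i) 2.
  have d := is_derive_coord i i x; rewrite eqxx in d.
  by apply: is_derive_eq; rewrite /GRing.scale /= mulr1.
have [_ E] := is_deriveM d1 d2; rewrite [LHS]E.
by rewrite /GRing.scale /=; ring.
Qed.

End radial_test.

(** * Monotonicity and primitives on the line *)

Section one_dim_calculus.
Context {R : realType}.
Implicit Types (f F : R -> R).

Lemma is_derive_continuous F (x df : R) : is_derive x 1 F df ->
  {for x, continuous F}.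
Proof. by move=> [d _]; apply/differentiable_continuous/derivable1_diffP. Qed.

Lemma is_derive_within F f (a b : R) :
  (forall x, a <= x <= b -> is_derive x 1 F (f x)) ->
  {within `[a, b], continuous F}.
Proof.
move=> dF; apply/continuous_in_subspaceT => x.
by rewrite inE /= in_itv /= => /dF; exact: is_derive_continuous.
Qed.

Lemma is_derive_ge0_le F f (a b : R) : a <= b ->
  (forall x, a <= x <= b -> is_derive x 1 F (f x)) ->
  (forall x, a <= x <= b -> 0 <= f x) -> F a <= F b.
Proof.
move=> ab dF f0.
have sub x : x \in `]a, b[ -> a <= x <= b.
  by rewrite in_itv /= => /andP[/ltW -> /ltW ->].
apply: (@ger0_derive1_ndecr _ _ a b) => //.
- by move=> x /sub /dF [].
- by move=> x /sub xab; rewrite derive1E; have [_ ->] := dF x xab; exact: f0.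
- exact: is_derive_within dF.
Qed.

Lemma is_derive0_eq F (a b : R) : a <= b ->
  (forall x, a <= x <= b -> is_derive x 1 F 0) -> F a = F b.
Proof.
move=> ab dF; apply/eqP; rewrite eq_le.
have dN x : a <= x <= b -> is_derive x 1 (fun x => - F x) 0.
  by move=> /dF d; move: (is_deriveN d); rewrite oppr0.
have le1 : F a <= F b by apply: (@is_derive_ge0_le F (cst 0)).
have : - F a <= - F b by apply: (@is_derive_ge0_le (fun x => - F x) (cst 0)).
by rewrite lerN2 le1 => ->.
Qed.

Lemma FTC2_is_derive F f (a b : R) : a < b ->
  (forall x, a <= x <= b -> is_derive x 1 F (f x)) ->
  {within `[a, b], continuous f} ->
  (\int[lebesgue_measure]_(x in `[a, b]) (f x)%:E = (F b - F a)%:E)%E.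
Proof.
move=> ab dF cf; rewrite (@continuous_FTC2 _ _ F) //.
- split.
  + move=> x; rewrite in_itv /= => /andP[/ltW ax /ltW xb].
    by have [|d _] := dF x; rewrite ?ax.
  + apply: cvg_at_right_filter; apply: is_derive_continuous (dF a _).
    by rewrite lexx ltW.
  + apply: cvg_at_left_filter; apply: is_derive_continuous (dF b _).
    by rewrite lexx ltW.
- move=> x; rewrite in_itv /= => /andP[/ltW ax /ltW xb].
  by rewrite derive1E; have [|_ ->] := dF x; rewrite ?ax.
Qed.

(** For s < 0 the segment is empty and the value is 0. This is nevertheless a primitive on the whole
    line for the functions considered, which vanish below some d > 0. *)
Definition prim f (s : R) : R := \int[lebesgue_measure]_(t in `[0, s]) f t.

Section prim.
Variables (f : R -> R) (d : R).
Hypotheses (d0 : 0 < d) (cf : continuous f) (f0 : forall s, s <= d -> f s = 0).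

Lemma prim_eq0 s : s <= d -> prim f s = 0.
Proof.
move=> sd; rewrite /prim /Rintegral (eq_integral (cst 0%E)).
  by rewrite integral0.
move=> t; rewrite inE /= in_itv /= => /andP[_ ts].
by rewrite f0 // (le_trans ts).
Qed.

Lemma is_derive_prim (s : R) : is_derive s 1 (prim f) (f s).
Proof.
have [sd|ds] := ltP s d.
  rewrite f0 ?ltW //; apply: (@near_eq_is_derive _ _ _ (cst 0)).
  near=> t; rewrite prim_eq0 //; apply/ltW.
  by near: t; exact: lt_nbhsl.
have i01 : lebesgue_measure.-integrable `[0, s + 1] (EFin \o f).
  apply: continuous_compact_integrable; first exact: segment_compact.
  exact: continuous_subspaceT.
have [| |h1 h2] := @continuous_FTC1_closed R f 0 s (s + 1) _ i01 _ (@cf s).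
- by rewrite ltrDl.
- exact: lt_le_trans ds.
- by split => //; rewrite -derive1E.
Unshelve. all: by end_near. Qed.

Lemma smooth_on_prim : smooth_on setT f -> smooth_on setT (prim f).
Proof.
move=> sf [//|k]; apply: (cdiffS openT (fun x _ => is_derive_prim x)).
exact: sf.
Qed.

End prim.

End one_dim_calculus.

Section smooth_power.
Context {R : realType}.

(** The singularity of the power at 0 is hidden by the zeros of [f]: the product is smooth on s > 0
    and vanishes on s < d, and these two open sets cover the line. *)
Lemma smooth_on_mul_powR (f : R -> R) (d r : R) : 0 < d ->
  (forall s, s <= d -> f s = 0) -> smooth_on setT f ->
  smooth_on setT (fun s => f s * s `^ r).
Proof.
move=> d0 f0 sf k.
have op : open [set x : R | 0 < x] by exact: open_gt.
have od : open [set x : R | x < d] by exact: open_lt.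
have <- : [set x | 0 < x] `|` [set x | x < d] = [set: R].
  rewrite -subTset => x _ /=; have [x0|x0] := ltP 0 x; [by left|right].
  exact: le_lt_trans d0.
apply: cdiffU.
  apply: cdiffM => //; last exact: cdiff_powR.
  exact: sub_cdiff (@subsetT _ _) (sf k).
apply: (@eq_cdiff _ _ _ (cst 0)) => //; last exact: cdiff_cst.
by move=> x; rewrite inE /= => /ltW/f0 ->; rewrite mul0r.
Qed.

End smooth_power.

(** * Radial potentials with a prescribed Laplacian *)

Section potential.
Context {R : realType} {N : nat}.
Hypothesis N_ge3 : (3 <= N)%N.
Local Notation q := (N%:R / 2).
Variables (d eta : R).
Hypotheses (d0 : 0 < d) (d_lt_eta : d < eta) (eta1 : eta < 1).

Let N_gt0 : (0 < N)%N. Proof. by case: N N_ge3. Qed.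

Let NR_gt0 : 0 < N%:R :> R. Proof. by rewrite ltr0n. Qed.

Let q_gt1 : 1 < q :> R.
Proof. by rewrite ltr_pdivlMr // mul1r ltr_nat. Qed.

(** Up to the factor [2 N V_N], the integral of [a (|x|^2)] over the ball of
    radius [sqrt s]. *)
Definition mass (a : R -> R) : R -> R :=
  prim (fun s => a s * s `^ (q - 1) * 4^-1).

Section mass.
Variable a : R -> R.
Hypotheses (sa : smooth_on setT a) (a_lo : forall s, s <= d -> a s = 0)
  (a_hi : forall s, eta <= s -> a s = 0).

Let c (s : R) := a s * s `^ (q - 1) * 4^-1.

Let sc : smooth_on setT c.
Proof.
move=> k; apply: cdiffM; first exact: openT.
  exact: (smooth_on_mul_powR _ d0 a_lo sa).
exact: cdiff_cst openT.
Qed.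

Let c_lo s : s <= d -> c s = 0.
Proof. by move=> sd; rewrite /c a_lo // !mul0r. Qed.

Let cc : continuous c.
Proof. by move=> x; exact: smooth_on_continuous sc I. Qed.

Lemma smooth_on_mass : smooth_on setT (mass a).
Proof. exact: smooth_on_prim d0 cc c_lo sc. Qed.

Lemma is_derive_mass (s : R) : is_derive s 1 (mass a) (a s * s `^ (q - 1) * 4^-1).
Proof. exact: is_derive_prim d0 cc c_lo s. Qed.

Lemma mass_lo s : s <= d -> mass a s = 0.
Proof. exact: prim_eq0 c_lo s. Qed.

Lemma mass_hi s : eta <= s -> mass a s = mass a eta.
Proof.
move=> es; apply/esym; apply: is_derive0_eq => // x /andP[ex _].
apply: is_derive_eq; first exact: is_derive_mass.
by rewrite a_hi // !mul0r.
Qed.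

(** In the variable y = |x|^N one has |x|^2 = y^r with r = 2/N, and the powers of y in the
    derivative of [2 * N%:R * mass a (y]^ r)[cancel, leaving exactly]a (y [^ r)]. *)
Lemma integral_mass : (forall s, 0 <= a s) ->
  (\int[lebesgue_rV N]_(x in unit_ball) (a (sqn x))%:E =
   (2 * N%:R * ball_volume N * mass a eta)%:E)%E.
Proof.
move=> a0.
pose r : R := 2 / N%:R.
have rN (x : 'rV[R]_N) : (enorm x ^+ N) `^ r = sqn x.
  rewrite -powR_mulrn ?enorm_ge0 // -powRrM /r mulrCA divff ?gt_eqF //.
  by rewrite mulr1 powR_mulrn ?enorm_ge0 // sqr_enorm.
under eq_integral do rewrite -rN.
have ca : continuous a by move=> x; exact: smooth_on_continuous sa I.
have mar : measurable_fun setT (fun y : R => (a (y `^ r))%:E).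
  apply/measurable_EFinP; apply: (@measurableT_comp _ _ _ _ _ _ a).
    exact: continuous_measurable_fun.
  exact: measurable_powR.
rewrite (@integral_radial _ _ N_gt0 (fun y => (a (y `^ r))%:E)) //; last first.
  by move=> y; rewrite lee_fin.
(* The value of y where |x|^2 = d. Below it the integrand vanishes, which keeps the fundamental
   theorem away from y = 0. *)
pose z := d `^ q.
have z0 : 0 < z by rewrite powR_gt0.
have qr : q * r = 1 by rewrite /r; field; rewrite gt_eqF.
have zr : z `^ r = d by rewrite /z -powRrM qr powRr1 // ltW.
have z1 : z < 1.
  have -> : 1 = 1 `^ q :> R by rewrite powR1.
  rewrite gt0_ltr_powR ?nnegrE ?(ltW d0) ?(lt_trans d_lt_eta) //.
  by rewrite (lt_trans _ q_gt1).
have -> : (\int[lebesgue_measure]_(y in `[0%R, 1%R[) (a (y `^ r))%:E =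
    \int[lebesgue_measure]_(y in `[z, 1%R]) (a (y `^ r))%:E)%E.
  rewrite integral_mkcond [RHS]integral_mkcond; apply: eq_integral => y _.
  rewrite !patchE !mem_setE !in_itv /=.
  have [zy|yz] := leP z y; have [y1|y1] := ltP y 1; rewrite /= ?andbT ?andbF.
  - by rewrite (le_trans (ltW z0) zy) (ltW y1).
  - rewrite le_eqVlt ltNge y1 orbF; case: eqP => // ->.
    by rewrite powR1 a_hi // ltW.
  - case: leP => // y0; rewrite a_lo //.
    rewrite -zr ge0_ler_powR ?nnegrE ?(ltW z0) ?(ltW yz) //.
    by rewrite divr_ge0 // ltW.
  - by move: (lt_le_trans z1 y1); rewrite ltNge (ltW yz).
have yrder (y : R) : z <= y ->
    is_derive y 1 (fun y => 2 * N%:R * mass a (y `^ r)) (a (y `^ r)).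
  move=> zy; have y0 : 0 < y by exact: lt_le_trans zy.
  have d1 := @is_derive1_comp _ (mass a) (fun y => y `^ r) y _ _
     (is_derive_mass _) (is_derive1_powR r y0).
  apply: is_derive_eq; rewrite /GRing.scale /=.
  have yy : (y `^ r) `^ (q - 1) * y `^ (r - 1) = 1.
    rewrite -powRrM -powRD; last by rewrite (gt_eqF y0) implybT.
    by rewrite (_ : _ + _ = 0) ?powRr0 // mulrBr mulr1 [r * q]mulrC qr; ring.
  have Nr : N%:R * r = 2 by rewrite /r mulrC divfK // gt_eqF.
  transitivity (a (y `^ r) * (N%:R * r / 2) *
    ((y `^ r) `^ (q - 1) * y `^ (r - 1))); first by field.
  by rewrite yy Nr divff ?mulr1.
have car : {within `[z, 1], continuous (fun y => a (y `^ r))}.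
  apply/continuous_in_subspaceT => y; rewrite inE /= in_itv /= => /andP[zy _].
  apply: (@continuous_comp _ _ _ (fun y => y `^ r) a y); last exact: ca.
  by apply: is_derive_continuous (is_derive1_powR r (lt_le_trans z0 zy)).
have yrder' (y : R) : z <= y <= 1 ->
    is_derive y 1 (fun y => 2 * N%:R * mass a (y `^ r)) (a (y `^ r)).
  by case/andP => /yrder.
rewrite (FTC2_is_derive z1 yrder' car) powR1 -EFinM mass_hi ?(ltW eta1) //.
by rewrite zr [mass a d]mass_lo //; congr (_%:E); ring.
Qed.

Lemma mass_ge0 s : (forall s, 0 <= a s) -> 0 <= mass a s <= mass a eta.
Proof.
move=> a0.
have mono s1 s2 : s1 <= s2 -> mass a s1 <= mass a s2.
  move=> s12; apply: (is_derive_ge0_le s12 (fun x _ => is_derive_mass x)).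
  by move=> x _; rewrite !mulr_ge0 ?powR_ge0.
apply/andP; split.
  have [sd|ds] := leP s d; first by rewrite mass_lo.
  by rewrite -(mass_lo (lexx d)) mono // ltW.
have [es|se] := leP eta s; first by rewrite mass_hi.
by rewrite mono // ltW.
Qed.

End mass.

Section phi.
Variables (kap : R -> R) (A : R).
Hypotheses (sk : smooth_on setT kap) (k_lo : forall s, s <= d -> kap s = 0)
  (k_hi : forall s, eta <= s -> kap s = 0).
Hypothesis mass0 : mass kap eta = 0.
Hypothesis massA : forall s, `|mass kap s| <= A.

Let psi (s : R) := mass kap s * s `^ (- q).

Let psi_lo s : s <= d -> psi s = 0.
Proof. by move=> sd; rewrite /psi mass_lo // mul0r. Qed.

Let spsi : smooth_on setT psi.
Proof.
apply: (smooth_on_mul_powR _ d0) => //; last exact: smooth_on_mass.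
exact: mass_lo.
Qed.

Let cpsi : continuous psi.
Proof. by move=> x; exact: smooth_on_continuous spsi I. Qed.

(** With [Phi := potential], [Phi (|x|^2)] has Laplacian [kap (|x|^2)]: the latter
    reads [4 s^(1-q) (s^q Phi')' = kap] in the variable [s = |x|^2]. *)
Definition potential (s : R) := prim psi s - prim psi eta.

Let dphi (s : R) : is_derive s 1 potential (psi s).
Proof.
have dp := is_derive_prim d0 cpsi psi_lo s.
by apply: is_derive_eq; rewrite subr0.
Qed.

Let dphiE : potential^`()%classic = psi.
Proof. by apply/funext => s; rewrite derive1E; have [_ ->] := dphi s. Qed.

Lemma smooth_on_potential : smooth_on setT potential.
Proof.
move=> [//|k]; apply: (cdiffS openT (fun x _ => dphi x)); exact: spsi.
Qed.

(** Beyond eta the mass keeps its value at eta, which is 0, so the derivative vanishes. This is what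
    gives the potential compact support in the ball. *)
Lemma potential_hi s : eta <= s -> potential s = 0.
Proof.
move=> es; rewrite /potential; apply/eqP; rewrite subr_eq0; apply/eqP/esym.
apply: is_derive0_eq => // x /andP[ex _].
apply: is_derive_eq; first exact: (is_derive_prim d0 cpsi psi_lo).
by rewrite /psi mass_hi // mass0 mul0r.
Qed.

Lemma laplacian_potential (x : 'rV[R]_N) :
  laplacian (fun x : 'rV[R]_N => potential (sqn x)) x = kap (sqn x).
Proof.
rewrite (laplacian_radial _ smooth_on_potential) dphiE.
set s := sqn x.
(* Near such s the potential is constant; this covers s = 0, where the powers below are singular. *)
have [sd|ds] := leP s (d / 2).
  have sd' : s < d by rewrite (le_lt_trans sd) // ltr_pdivrMr // ltr_pMr // ltr1n.
  rewrite psi_lo ?ltW // k_lo ?ltW // (_ : psi^`()%classic s = 0).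
    by rewrite !mulr0 addr0.
  rewrite derive1E (@near_eq_derive _ _ _ _ (cst 0)) ?derive_cst //.
  near=> t; rewrite psi_lo //; apply/ltW.
  by near: t; exact: lt_nbhsl.
have s0 : 0 < s by rewrite (lt_trans _ ds) // divr_gt0.
have d1 := is_deriveM (is_derive_mass sk k_lo s) (is_derive1_powR (- q) s0).
rewrite derive1E; have [_ E] := d1; rewrite [X in 4 * s * X]E.
rewrite /psi /GRing.scale /=.
have -> : s `^ (- q - 1) = s `^ (- q) / s.
  by rewrite powRB ?powRr1 ?ltW // (gt_eqF s0) implybT.
have -> : s `^ (q - 1) = s `^ q / s.
  by rewrite powRB ?powRr1 ?ltW // (gt_eqF s0) implybT.
rewrite powRN.
have sq0 : s `^ q != 0 by rewrite gt_eqF // powR_gt0.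
by field; rewrite sq0 gt_eqF.
Unshelve. all: by end_near. Qed.

(** The derivative is at most A s^(-q) in absolute value, which is minus the derivative of A/(q-1)
    s^(1-q). Adding or subtracting the latter gives monotone functions, compared with their values
    at eta, where the potential is 0. *)
Lemma potential_bound s :
  `|potential s| <= A / (q - 1) * (Num.max s d) `^ (1 - q).
Proof.
have q1 : 0 < q - 1 :> R by rewrite subr_gt0.
have A0 : 0 <= A by exact: le_trans (massA 0).
(* The slash is not a quotient: [s] is generalised under the hypothesis [d <= s]. Below d the
   potential is constant. *)
wlog sd : s / d <= s.
  move=> H; have [|] := boolP (d <= s); first exact: H.
  rewrite -ltNge => sd.
  have -> : potential s = potential d.
    apply: is_derive0_eq; first exact: ltW.
    move=> x /andP[_ xd]; apply: is_derive_eq; first exact: dphi.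
    by rewrite psi_lo.
  by have := H d (lexx d); rewrite max_l // max_r // ltW.
rewrite max_l //.
have [es|se] := leP eta s.
  by rewrite potential_hi // normr0 mulr_ge0 ?powR_ge0 // divr_ge0 // ltW.
have s0 : 0 < s by exact: lt_le_trans sd.
(* The values 1 and -1 of [e] serve for the lower and the upper bound. *)
have dpow (x e : R) : s <= x -> is_derive x 1
    (fun x => potential x + e * (A / (q - 1) * x `^ (1 - q)))
    (psi x - e * (A * x `^ (- q))).
  move=> sx; have x0 : 0 < x by exact: lt_le_trans sx.
  have d1 := is_derive1_powR (1 - q) x0.
  have d2 := dphi x.
  apply: is_derive_eq; rewrite /GRing.scale /=.
  rewrite (_ : 1 - q - 1 = - q); last by ring.
  rewrite -(opprB q 1); move: (q - 1) q1 => w w0.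
  by field; rewrite gt_eqF.
have psib (x : R) : s <= x -> `|psi x| <= A * x `^ (- q).
  by move=> sx; rewrite /psi normrM (ger0_norm (powR_ge0 _ _)) ler_wpM2r ?powR_ge0.
have pe : 0 <= A / (q - 1) * eta `^ (1 - q).
  by rewrite mulr_ge0 ?powR_ge0 // divr_ge0 // ltW.
rewrite ler_norml; apply/andP; split.
  have := @is_derive_ge0_le _ (fun x => - (potential x + 1 * (A / (q - 1) * x `^ (1 - q))))
    (fun x => - (psi x - 1 * (A * x `^ (- q)))) s eta (ltW se).
  rewrite (potential_hi (lexx eta)) => H.
  have {}H := H (fun x sx => is_deriveN (dpow x 1 (andP sx).1)).
  rewrite -subr_ge0 opprK; move: H; rewrite !mul1r add0r lerN2 => H.
  apply: (le_trans pe); apply: H => x /andP[sx _].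
  by rewrite mul1r opprB subr_ge0 (le_trans (ler_norm _)) // psib.
have := @is_derive_ge0_le _ (fun x => potential x + -1 * (A / (q - 1) * x `^ (1 - q)))
    (fun x => psi x - -1 * (A * x `^ (- q))) s eta (ltW se).
rewrite (potential_hi (lexx eta)) => H.
have {}H := H (fun x sx => dpow x (-1) (andP sx).1).
rewrite -subr_le0; move: H; rewrite !mulN1r add0r => H.
apply: (@le_trans _ _ (- (A / (q - 1) * eta `^ (1 - q)))).
  apply: H => x /andP[sx _]; rewrite mulN1r opprK addrC -lerBlDr sub0r.
  by rewrite (le_trans (ler_norm _)) // normrN psib.
by rewrite oppr_le0.
Qed.

End phi.

End potential.

(** * Radial functions with a weak Laplacian *)

Section weak_radial.
Context {R : realType} {N : nat}.
Hypothesis N_ge3 : (3 <= N)%N.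
Local Notation mu := (@lebesgue_rV R N).
Local Notation B := (@unit_ball R N).
Local Notation q := (N%:R / 2).

Let mB : measurable B. Proof. exact: measurable_unit_ball. Qed.

Lemma measurable_comp_sqn d (T : measurableType d) (h : R -> T) D :
  measurable_fun setT h -> measurable_fun D (fun x : 'rV[R]_N => h (sqn x)).
Proof.
move=> mh; apply: measurable_funTS.
exact: (measurableT_comp mh measurable_sqn).
Qed.

(** The closed ball of radius sqrt eta: radii are measured by |x|^2, in accordance with the
    potentials. *)
Definition sublevel (eta : R) : set 'rV[R]_N := [set x | sqn x <= eta].

Lemma compact_sqn_le (eta : R) : compact (sublevel eta).
Proof.
apply: bounded_closed_compact.
  exists (Num.sqrt eta); split; first exact: num_real.
  move=> M M1 x /= xe; rewrite /Num.norm /= mx_normrE.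
  apply/bigmax_leP; split.
    by rewrite ltW // (le_lt_trans _ M1) // sqrtr_ge0.
  move=> [i j] _ /=; rewrite (ord1 i) (le_trans (normr_coord_le_enorm x j)) //.
  rewrite (le_trans _ (ltW M1)) // enormE ler_wsqrtr //.
apply: (@closed_comp _ _ (@sqn R N) [set t | t <= eta]); last exact: closed_le.
by move=> ? _; exact: continuous_sqn.
Qed.

Lemma sqn_le_sub_ball (eta : R) : eta < 1 ->
  sublevel eta `<=` B.
Proof.
move=> eta1 x /= xe; rewrite /unit_ball /= enormE -[X in _ < X]sqrtr1.
by rewrite ltr_sqrt // (le_lt_trans xe).
Qed.

Lemma measurable_sqn_le (eta : R) :
  measurable (sublevel eta).
Proof.
apply: closed_measurable_rV; apply: compact_closed; last exact: compact_sqn_le.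
exact: norm_hausdorff.
Qed.

Lemma integrable_radial_mul (u : 'rV[R]_N -> R) (h : R -> R) (eta : R) :
  loc_integrable u -> continuous h -> eta < 1 ->
  (forall s, eta <= s -> h s = 0) ->
  mu.-integrable B (fun x => (u x * h (sqn x))%:E).
Proof.
move=> [mu_ lu] ch eta1 h0.
pose K : set 'rV[R]_N := sublevel eta.
have KB := sqn_le_sub_ball eta1; have mK := measurable_sqn_le eta.
have iK : mu.-integrable K (fun x => (u x * h (sqn x))%:E).
  have bh : [bounded h (sqn x) | x in K].
    have /compact_bounded[M [Mr Mb]] : compact ((fun x : 'rV[R]_N => h (sqn x)) @` K).
      apply: (@continuous_compact _ _ (fun x : 'rV[R]_N => h (sqn x)));
        last exact: compact_sqn_le.
      apply: continuous_subspaceT => x.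
      by apply: (@continuous_comp _ _ _ (@sqn R N) h x);
        [exact: continuous_sqn|exact: ch].
    by exists M; split => // y yM x Kx; apply: (Mb y yM); exists x.
  apply: (@eq_integrable _ _ _ _ _ mK ((EFin \o u) \*
      (EFin \o (fun x => h (sqn x))))%E) => //.
  have iu : mu.-integrable K (EFin \o u).
    exact: (lu K (@compact_sqn_le eta) KB).
  have mh : measurable_fun K (fun x => h (sqn x)).
    by apply: measurable_comp_sqn; exact: continuous_measurable_fun.
  by have := integrableMl mK iu mh bh.
apply/(integrable_mkcond _ mB).
move/(integrable_mkcond _ mK) : iK; congr (mu.-integrable _ _).
apply/funext => x; rewrite !patchE.
case: ifPn => [xK|xK]; first by rewrite mem_set //; apply: KB; rewrite inE in xK.
case: ifPn => // _; rewrite h0 ?mulr0 //.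
by move/negP : xK; rewrite inE /K /= => /negP; rewrite -ltNge => /ltW.
Qed.

Section estimate.
Variables (u g : 'rV[R]_N -> R) (d eta : R).
Hypotheses (lu : loc_integrable u) (ug : is_weak_laplacian u g).
Hypotheses (d0 : 0 < d) (d_lt_eta : d < eta) (eta1 : eta < 1).

Lemma weak_laplacian_potential (kap : R -> R) :
  smooth_on setT kap -> (forall s, s <= d -> kap s = 0) ->
  (forall s, eta <= s -> kap s = 0) -> @mass R N kap eta = 0 ->
  \int[mu]_(x in B) (u x * kap (sqn x)) =
  \int[mu]_(x in B) (g x * @potential R N eta kap (sqn x)).
Proof.
move=> sk klo khi m0; have [_ w] := ug.
have sp := smooth_on_potential (N := N) eta d0 sk klo.
have := w _ (radial_test_function sp eta1
  (potential_hi d0 sk klo khi m0)).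
by under [in X in X = _ -> _]eq_Rintegral do
  rewrite (laplacian_potential (N := N) eta d0 sk klo).
Qed.

Variables (b : R -> R).
Hypotheses (sb : smooth_on setT b) (b_lo : forall s, s <= d -> b s = 0)
  (b_hi : forall s, eta <= s -> b s = 0) (b01 : forall s, 0 <= b s <= 1).
Hypothesis mass_b : 0 < @mass R N b eta.
Variables (U K : R).
Hypothesis u_le : (\int[mu]_(x in B) `|u x|%:E <= U%:E)%E.
Hypothesis g_le : (\int[mu]_(x in sublevel eta)
  (`|g x| * (Num.max (sqn x) d) `^ (1 - q))%:E <= K%:E)%E.

(** Obtained by testing with the potential of [a - lam * b], where
    [lam := mass a eta / mass b eta] makes this potential vanish beyond [eta]. *)
Definition radial_const : R :=
  (U / @mass R N b eta + K / (q - 1)) / (2 * N%:R * ball_volume N).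

Lemma radial_average_le (a : R -> R) : smooth_on setT a ->
  (forall s, s <= d -> a s = 0) -> (forall s, eta <= s -> a s = 0) ->
  (forall s, 0 <= a s) ->
  `|\int[mu]_(x in B) (u x * a (sqn x))| <=
  radial_const * \int[mu]_(x in B) a (sqn x).
Proof.
move=> sa a_lo a_hi a0.
have N0 : (0 : R) < N%:R by rewrite ltr0n; case: (N) N_ge3.
have q1 : 0 < q - 1 :> R.
  by rewrite subr_gt0 ltr_pdivlMr // mul1r ltr_nat.
have -> : \int[mu]_(x in B) a (sqn x) = 2 * N%:R * ball_volume N * @mass R N a eta.
  by rewrite /Rintegral (integral_mass N_ge3 d0 d_lt_eta eta1).
set A := @mass R N a eta; have mb0 := mass_b; set mb := @mass R N b eta in mb0 *.
have A0 : 0 <= A by have /andP[] := mass_ge0 (N := N) d0 sa a_lo a_hi eta a0.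
pose lam := A / mb.
have lam0 : 0 <= lam by rewrite divr_ge0 // ltW.
pose kap s := a s + (- lam) * b s.
have sk : smooth_on setT kap.
  move=> k; apply: cdiffD; [exact: openT|exact: sa|].
  by apply: cdiffM; [exact: openT|exact: (cdiff_cst _ _ openT)|exact: sb].
have k_lo s : s <= d -> kap s = 0.
  by move=> sd; rewrite /kap a_lo // b_lo // mulr0 addr0.
have k_hi s : eta <= s -> kap s = 0.
  by move=> sd; rewrite /kap a_hi // b_hi // mulr0 addr0.
(* Linearity of the mass: the difference of the two sides has derivative 0 and vanishes below d. *)
have massE s : @mass R N kap s = @mass R N a s - lam * @mass R N b s.
  have e : @mass R N kap s - (@mass R N a s - lam * @mass R N b s) =
    @mass R N kap (Num.min s d) -
    (@mass R N a (Num.min s d) - lam * @mass R N b (Num.min s d)).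
    apply/esym.
    apply: (@is_derive0_eq _ (fun s => @mass R N kap s -
      (@mass R N a s - lam * @mass R N b s))); first by rewrite ge_min lexx.
    move=> x _.
    have dk := is_derive_mass (N := N) d0 sk k_lo x.
    have da := is_derive_mass (N := N) d0 sa a_lo x.
    have db := is_derive_mass (N := N) d0 sb b_lo x.
    apply: is_derive_eq; rewrite /GRing.scale /= /kap; ring.
  have dm : Num.min s d <= d by rewrite ge_min lexx orbT.
  apply/eqP; rewrite -subr_eq0 e (mass_lo k_lo dm) // (mass_lo a_lo dm) //.
  by rewrite (mass_lo b_lo dm) // mulr0 !subr0.
have mass0 : @mass R N kap eta = 0.
  by rewrite massE -/A -/mb /lam divfK ?subrr // gt_eqF.
(* Both [mass a] and [lam * mass b] take values in [0, A], as lam times the total mass of [b] is A;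
   hence their difference lies in [-A, A]. *)
have massA s : `|@mass R N kap s| <= A.
  rewrite massE.
  have /andP[a1 a2] := mass_ge0 (N := N) d0 sa a_lo a_hi s a0.
  have /andP[b1 b2] := mass_ge0 (N := N) d0 sb b_lo b_hi s
    (fun s => (andP (b01 s)).1).
  have lb : lam * @mass R N b s <= A.
    by rewrite -(divfK (lt0r_neq0 mb0) A) ler_wpM2l.
  have lb0 : 0 <= lam * @mass R N b s by rewrite mulr_ge0.
  by rewrite ler_norml; apply/andP; split; rewrite -/A in a2 *; lra.
have W := weak_laplacian_potential sk k_lo k_hi mass0.
have cont (f : R -> R) : smooth_on setT f -> continuous f.
  by move=> sf x; exact: smooth_on_continuous sf I.
have iua := integrable_radial_mul lu (cont _ sa) eta1 a_hi.
have iub := integrable_radial_mul lu (cont _ sb) eta1 b_hi.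
have sp := smooth_on_potential (N := N) eta d0 sk k_lo.
have p_hi := potential_hi d0 sk k_lo k_hi mass0.
have igp := integrable_radial_mul ug.1 (cont _ sp) eta1 p_hi.
have E : \int[mu]_(x in B) (u x * a (sqn x)) =
    lam * \int[mu]_(x in B) (u x * b (sqn x)) +
    \int[mu]_(x in B) (g x * @potential R N eta kap (sqn x)).
  rewrite -W -RintegralZl // -RintegralD //.
  - apply: eq_Rintegral => x _; rewrite /kap; ring.
  - by have := integrableZl mB lam iub; apply: eq_integrable.
  - apply: integrable_radial_mul lu (cont _ sk) eta1 k_hi.
have ub : `|\int[mu]_(x in B) (u x * b (sqn x))| <= U.
  rewrite -lee_fin EFin_normr_Rintegral //.
  apply: (le_trans (le_abse_integral _ mB _)).
    by case/integrableP : iub.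
  apply: le_trans u_le; apply: ge0_le_integral => //.
  - by apply: measurableT_comp => //; case/integrableP : iub.
  - by apply/measurable_EFinP; apply: measurableT_comp => //; case: lu.
  - move=> x _; rewrite /= lee_fin normrM ler_piMr //.
    by have /andP[b0 b1] := b01 (sqn x); rewrite ger0_norm.
have gp : `|\int[mu]_(x in B) (g x * @potential R N eta kap (sqn x))| <=
    A / (q - 1) * K.
  rewrite -lee_fin EFin_normr_Rintegral //.
  apply: (le_trans (le_abse_integral _ mB _)).
    by case/integrableP : igp.
  have mK := measurable_sqn_le eta.
  have KB := sqn_le_sub_ball eta1.
  rewrite (_ : \int[mu]_(x in B) _ =
     \int[mu]_(x in sublevel eta)
       `|(g x * @potential R N eta kap (sqn x))%:E|)%E; last first.
    rewrite integral_mkcond [RHS]integral_mkcond; apply: eq_integral => x _.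
    rewrite !patchE.
    case: ifPn => [xB|xB].
      case: ifPn => // /negP; rewrite inE /= => /negP; rewrite -ltNge => /ltW xe.
      by rewrite p_hi // mulr0 normr0.
    case: ifPn => // xK; move: xB => /negP; case; rewrite inE.
    by apply: KB; rewrite inE in xK.
  have mg : measurable_fun (sublevel eta) g.
    by apply: measurable_funS KB _ => //; case: ug => -[].
  have mmax : measurable_fun setT
      (fun s : R => Num.max s d `^ (1 - q)).
    apply: (@measurableT_comp _ _ _ _ _ _ (fun t : R => t `^ (1 - q))).
      exact: measurable_powR.
    exact: measurable_maxr.
  have m1 : measurable_fun (sublevel eta)
      (fun x => (`|g x| * (Num.max (sqn x) d) `^ (1 - q))%:E).
    apply/measurable_EFinP; apply: measurable_funM; first exact: measurableT_comp.
    exact: (measurable_comp_sqn mmax).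
  apply: (@le_trans _ _ (\int[mu]_(x in sublevel eta)
     ((A / (q - 1))%:E * (`|g x| * (Num.max (sqn x) d) `^ (1 - q))%:E))%E).
    apply: ge0_le_integral => //.
    - apply: measurableT_comp => //; apply: measurable_funS KB _ => //.
      by case/integrableP : igp.
    - exact: measurable_funeM m1.
    - move=> x _; rewrite /= -EFinM lee_fin normrM mulrCA ler_wpM2l //.
      exact: (potential_bound N_ge3 d0 sk k_lo k_hi mass0 massA).
  rewrite ge0_integralZl //.
  - by rewrite [leRHS]EFinM lee_wpmul2l // lee_fin divr_ge0 // ltW.
  - by move=> x _; rewrite lee_fin mulr_ge0 ?powR_ge0.
  - by rewrite lee_fin divr_ge0 // ltW.
rewrite E /radial_const -/mb.
have -> : (U / mb + K / (q - 1)) / (2 * N%:R * ball_volume N) *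
    (2 * N%:R * ball_volume N * A) = lam * U + A / (q - 1) * K.
  rewrite /lam mulrA divfK; first by move: (q - 1) => w; ring.
  by rewrite !mulf_neq0 // gt_eqF // ball_volume_gt0.
apply: (le_trans (ler_normD _ _)); apply: lerD => //.
by rewrite normrM ger0_norm // ler_wpM2l.
Qed.

End estimate.

End weak_radial.

(** * Smooth approximation of indicators of open and closed sets *)

Section smooth_indicator.
Context {R : realType}.

Lemma smooth_on_prod n (f : nat -> R -> R) : (forall i, smooth_on setT (f i)) ->
  smooth_on setT (fun s => \prod_(i < n) f i s).
Proof.
move=> sf k; elim: n => [|n IH].
  under eq_fun do rewrite big_ord0.
  exact: cdiff_cst openT.
under eq_fun do rewrite big_ord_recr /=.
by apply: cdiffM; [exact: openT|exact: IH|exact: sf].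
Qed.

(** [1 - prod_(i < n) (1 - k_i)^n], where [k_i] is a bump function whose support
    is the i-th rational interval included in [U]. *)
Lemma smooth_indicator (U : set R) : open U ->
  exists a : nat -> R -> R, [/\ forall n, smooth_on setT (a n),
    forall n s, 0 <= a n s <= 1,
    forall n s, ~ U s -> a n s = 0 &
    forall s, a n s @[n --> \oo] --> (\1_U s : R)].
Proof.
move=> oU.
have /choice[k kP] : forall i : nat, exists k : R -> R,
    [/\ smooth_on setT k, forall s, 0 <= k s <= 1,
    forall s, 0 < k s -> U s & forall p q : rat, unpickle i = Some (p, q) ->
      `]ratr p, ratr q[%classic `<=` U -> forall s : R, ratr p < s < ratr q ->
      0 < k s].
  move=> i; case pq : (unpickle i) => [[p q]|]; last first.
    exists (cst 0); split => //; first exact: smooth_on_cst.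
      by move=> s /=; rewrite lexx ler01.
    by move=> s; rewrite ltxx.
  have [sub|nsub] := pselect ((`]ratr p, ratr q[%classic : set R) `<=` U).
    have [f [sf f01 fpos]] := @smooth_bump R (ratr p) (ratr q).
    exists f; split => //.
      by move=> s; rewrite fpos => h; apply: sub; rewrite /= in_itv.
    by move=> p' q' [<- <-] _ s; rewrite fpos.
  exists (cst 0); split => //; first exact: smooth_on_cst.
  - by move=> s /=; rewrite lexx ler01.
  - by move=> s; rewrite ltxx.
  - by move=> p' q' [<- <-].
(* The exponent n makes the i-th factor tend to 0 wherever k_i > 0, however small k_i is.
   Differences are written as sums with a factor -1 to suit [cdiffD] and [cdiffM]. *)
pose F n i s := \prod_(j < n) (1 + (- 1) * k i s).
pose a n s := 1 + (- 1) * \prod_(i < n) F n i s.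
have k1 i s : 0 <= 1 + -1 * k i s <= 1.
  by have [_ /(_ s)/andP[k0 k1] _ _] := kP i; apply/andP; split; lra.
have F1 n i s : 0 <= F n i s <= 1.
  apply/andP; split.
    by apply: prodr_ge0 => j _; have /andP[] := k1 i s.
  by apply: prodr_ile1 => j _; exact: k1.
have P1 n s : 0 <= \prod_(i < n) F n i s <= 1.
  apply/andP; split.
    by apply: prodr_ge0 => j _; have /andP[] := F1 n j s.
  by apply: prodr_ile1 => j _; exact: F1.
have k0 i s : ~ U s -> k i s = 0.
  move=> nU; have [_ /(_ s)/andP[k0 _] kU _] := kP i.
  apply/eqP; rewrite eq_le k0 andbT leNgt; apply/negP => /kU.
  exact: nU.
have a0 n s : ~ U s -> a n s = 0.
  move=> nU; rewrite /a /F big1; first by rewrite mulr1 subrr.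
  by move=> i _; rewrite big1 // => j _; rewrite k0 // mulr0 addr0.
exists a; split => //.
- move=> n m; have c k' (x : R) := cdiff_cst k' x openT.
  apply: cdiffD; [exact: openT|exact: c|].
  apply: cdiffM; [exact: openT|exact: c|].
  apply: smooth_on_prod => i k'.
  apply: (@smooth_on_prod n (fun _ s => 1 + (- 1) * k i s)) => _ k''.
  apply: cdiffD; [exact: openT|exact: c|].
  by apply: cdiffM; [exact: openT|exact: c|have [+ _ _ _] := kP i; exact].
- by move=> n s; rewrite /a; have /andP[p0 p1] := P1 n s; apply/andP; split; lra.
- move=> s; rewrite indicE; have [Us|nUs] := pselect (U s); last first.
    rewrite memNset //; apply: cvg_near_cst; apply: nearW => n.
    exact: a0.
  rewrite mem_set //=.
  have [e /= e0 eU] : nbhs_ball s U by apply/nbhs_ballP; exact: open_nbhs_nbhs.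
  have /rat_in_itvoo[p] : s - e < s by rewrite ltrBlDr ltrDl.
  rewrite in_itv /= => /andP[p1 p2].
  have /rat_in_itvoo[q] : s < s + e by rewrite ltrDl.
  rewrite in_itv /= => /andP[q1 q2].
  have sub : (`]ratr p, ratr q[%classic : set R) `<=` U.
    move=> t /=; rewrite in_itv /= => /andP[t1 t2]; apply: eU.
    by rewrite /ball /= ltr_distlC (lt_trans p1) // (lt_trans t2).
  pose i0 := pickle (p, q).
  have ki : 0 < k i0 s.
    have [_ _ _ kpq] := kP i0; apply: (kpq p q) => //; last by rewrite p2 q1.
    by rewrite /i0 pickleK.
  have cz : (fun n : nat => (1 + -1 * k i0 s) ^+ n) @ \oo --> (0 : R).
    apply: cvg_expr; have /andP[h1 h2] := k1 i0 s.
    by rewrite ger0_norm //; lra.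
  (* For n > i0 the product contains the n-th power of 1 - k_i0, and its other factors are at most
     1. *)
  have cp : (fun n : nat => \prod_(i < n) F n i s) @ \oo --> (0 : R).
    apply: (@squeeze_cvgr _ _ _ _ (cst 0) (fun n => (1 + -1 * k i0 s) ^+ n)).
    + exists i0.+1 => // n /= i0n; have /andP[-> _] /= := P1 n s.
      rewrite (bigD1 (Ordinal i0n)) //= {1}/F prodr_const card_ord.
      rewrite ler_piMr //.
        by rewrite exprn_ge0 //; have /andP[] := k1 i0 s.
      by apply: prodr_ile1 => j _; exact: F1.
    + exact: cvg_cst.
    + exact: cz.
  have -> : a^~ s = (fun n => 1 - \prod_(i < n) F n i s).
    by apply/funext => n; rewrite /a mulN1r.
  rewrite -[X in _ --> X]subr0; apply: cvgB => //; exact: cvg_cst.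
Qed.

(** The distance neighbourhoods of a closed set shrink to it. *)
Lemma closed_indicator_cvg (S W : set R) : closed S -> open W -> S `<=` W ->
  exists U : nat -> set R, [/\ forall n, open (U n), forall n, U n `<=` W &
    forall s, (\1_(U n) s : R) @[n --> \oo] --> (\1_S s : R)].
Proof.
move=> cS oW SW.
exists (fun n => (\bigcup_(t in S) ball t n.+1%:R^-1) `&` W); split => //.
- move=> n; apply: openI => //; apply: bigcup_open => t _.
  by apply: ball_open; rewrite invr_gt0.
- move=> s; rewrite [in X in _ --> X]indicE; have [Ss|nSs] := pselect (S s).
    rewrite mem_set //; apply: cvg_near_cst; apply: nearW => n.
    rewrite indicE mem_set //; split; last exact: SW.
    by exists s => //; apply: ballxx; rewrite invr_gt0.
  rewrite memNset //.
  have [e /= e0 eS] : nbhs_ball s (~` S).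
    by apply/nbhs_ballP; apply: open_nbhs_nbhs; split => //; exact: closed_openC.
  apply: cvg_near_cst.
  have := @near_infty_natSinv_lt R (PosNum e0); apply: filterS => n /= ne.
  rewrite indicE memNset // => -[[t St ts] _].
  by apply: (eS t) => //; apply: ball_sym; apply: le_ball ts; exact: ltW.
Qed.

End smooth_indicator.

(** * From averages to almost everywhere bounds *)

Section essential_bound.
Context {R : realType} {N : nat}.
Local Notation mu := (@lebesgue_rV R N).
Local Notation B := (@unit_ball R N).

Let mB : measurable B. Proof. exact: measurable_unit_ball. Qed.

Definition shell (d eta : R) : set 'rV[R]_N := [set x | d < sqn x < eta].

Lemma measurable_shell (d eta : R) : measurable (shell d eta).
Proof.
rewrite (_ : shell d eta = @sqn R N @^-1` `]d, eta[%classic).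
  by rewrite -[X in measurable X]setTI; apply: measurable_sqn.
by apply/seteqP; split => x; rewrite /shell /= in_itv.
Qed.

Lemma unit_ball_lty : (mu B < +oo)%E.
Proof. exact: (lebesgue_rV_ball_lty 1). Qed.

(** By dominated convergence, nonpositivity of the integral of (u - F) a(|x|^2) extends from smooth
    a to indicators of open sets, then of closed sets S. If u > F on a set of positive measure, a
    closed C inside it of positive measure is chosen and S is the image of C under |x|^2. As u is
    radial, u > F at almost every x with |x|^2 in S, a contradiction. *)
Lemma ae_radial_le (u : 'rV[R]_N -> R) (d eta F : R) :
  loc_integrable u -> radial u -> 0 < d -> d < eta -> eta < 1 ->
  (forall a : R -> R, smooth_on setT a -> (forall s, s <= d -> a s = 0) ->
    (forall s, eta <= s -> a s = 0) -> (forall s, 0 <= a s) ->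
    \int[mu]_(x in B) (u x * a (sqn x)) <= F * \int[mu]_(x in B) a (sqn x)) ->
  {ae mu, forall x, shell d eta x -> u x <= F}.
Proof.
move=> lu [f [Z [mZ Z0 Zsub]]] d0 de eta1 H.
pose D := shell d eta; pose w x := u x - F.
have mD : measurable D := measurable_shell d eta.
have DK : D `<=` sublevel eta by move=> x /andP[_ /ltW].
have KB := @sqn_le_sub_ball R N eta eta1.
have DB := subset_trans DK KB.
have mK := @measurable_sqn_le R N eta.
have iuD : mu.-integrable D (EFin \o u).
  apply: (integrableS mK mD DK).
  by case: lu => _ lu; apply: lu KB; exact: compact_sqn_le.
have icD (c : R) : mu.-integrable D (EFin \o cst c).
  apply: measurable_bounded_integrable => //.
  - apply: le_lt_trans unit_ball_lty.
    by rewrite le_measure ?inE.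
  - exists `|c|; split; first exact: num_real.
    by move=> M /ltW cM x _.
have iwD : mu.-integrable D (EFin \o w) by exact: integrableB (iuD) (icD F).
have mwD : measurable_fun D w.
  by apply/measurable_EFinP; case/integrableP : iwD.
have lim_closed (h_ : nat -> R -> R) (h : R -> R) :
    (forall n, measurable_fun setT (h_ n)) -> measurable_fun setT h ->
    (forall n s, 0 <= h_ n s <= 1) ->
    (forall s, h_ n s @[n --> \oo] --> h s) ->
    (forall n, (\int[mu]_(x in D) (w x * h_ n (sqn x))%:E <= 0)%E) ->
    (\int[mu]_(x in D) (w x * h (sqn x))%:E <= 0)%E.
  move=> mh_ mh h01 hcvg hle.
  have [| | | | |_ _ c] := @dominated_convergence _ _ _ mu D mD
    (fun n x => (w x * h_ n (sqn x))%:E) (fun x => (w x * h (sqn x))%:E)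
    (fun x => `|w x|%:E).
  - move=> n; apply/measurable_EFinP; apply: measurable_funM => //.
    exact: (measurable_comp_sqn (mh_ n)).
  - apply/measurable_EFinP; apply: measurable_funM => //.
    exact: (measurable_comp_sqn mh).
  - apply: aeW => x _; apply: cvg_EFin; first exact: nearW.
    by apply: cvgMr; exact: hcvg.
  - by have := integrable_abse iwD; apply: eq_integrable.
  - apply: aeW => x n _; rewrite lee_fin normrM ler_piMr //.
    by have /andP[? ?] := h01 n (sqn x); rewrite ger0_norm.
  rewrite -(cvg_lim _ c) //; apply: lime_le; first by apply/cvg_ex; eexists; exact: c.
  by apply: nearW => n; exact: hle.
have H_smooth (a : R -> R) : smooth_on setT a ->
    (forall s, ~ (d < s < eta) -> a s = 0) -> (forall s, 0 <= a s) ->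
    (\int[mu]_(x in D) (w x * a (sqn x))%:E <= 0)%E.
  move=> sa aout a0.
  have a_lo s : s <= d -> a s = 0.
    by move=> sd; apply: aout; rewrite ltNge sd.
  have a_hi s : eta <= s -> a s = 0.
    by move=> sd; apply: aout; rewrite andbC ltNge sd.
  have ca : continuous a by move=> x; exact: smooth_on_continuous sa I.
  have iua := integrable_radial_mul lu ca eta1 a_hi.
  have ia : mu.-integrable B (fun x => (a (sqn x))%:E).
    have l1 : loc_integrable (cst (1 : R) : 'rV[R]_N -> R).
      split; first exact: measurable_cst.
      move=> L cL LB; apply: measurable_bounded_integrable => //.
      - apply: closed_measurable_rV; apply: compact_closed cL.
        exact: norm_hausdorff.
      - apply: le_lt_trans unit_ball_lty; rewrite le_measure ?inE //.
        apply: closed_measurable_rV; apply: compact_closed cL.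
        exact: norm_hausdorff.
      - exists 1; split; first exact: num_real.
        by move=> M /ltW cM x _ /=; rewrite normr1.
    have := integrable_radial_mul l1 ca eta1 a_hi.
    by apply: eq_integrable => // x _; rewrite mul1r.
  have -> : (\int[mu]_(x in D) (w x * a (sqn x))%:E =
      \int[mu]_(x in B) (u x * a (sqn x) - F * a (sqn x))%:E)%E.
    rewrite integral_mkcond [RHS]integral_mkcond; apply: eq_integral => x _.
    rewrite !patchE -mulrBl -/(w x).
    case: ifPn => [xD|xD]; first by rewrite mem_set //; apply: DB; rewrite inE in xD.
    case: ifPn => // _; rewrite aout ?mulr0 // => xd.
    by move/negP : xD; apply; rewrite inE.
  have iFa : mu.-integrable B (fun x => (F * a (sqn x))%:E).
    by have := integrableZl mB F ia; apply: eq_integrable.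
  have -> : (\int[mu]_(x in B) (u x * a (sqn x) - F * a (sqn x))%:E =
      (\int[mu]_(x in B) (u x * a (sqn x)) -
       F * \int[mu]_(x in B) a (sqn x))%R%:E)%E.
    rewrite -RintegralZl // -RintegralB //.
    rewrite /Rintegral fineK //.
    by have := integrable_fin_num mB (integrableB mB iua iFa).
  by rewrite lee_fin subr_le0; exact: H.
have H_open (U : set R) : open U -> U `<=` `]d, eta[%classic ->
    (\int[mu]_(x in D) (w x * \1_U (sqn x))%:E <= 0)%E.
  move=> oU Ude; have [a [sa a01 aout acvg]] := smooth_indicator oU.
  apply: (lim_closed a) => //.
  - move=> n; apply: continuous_measurable_fun => x.
    exact: smooth_on_continuous (sa n) I.
  - by apply: measurable_indic; exact: open_measurable.
  - move=> n; apply: H_smooth => //.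
      move=> s ns; apply: aout => /Ude; rewrite /= in_itv /=; exact: ns.
    by move=> s; have /andP[] := a01 n s.
have H_closed (S : set R) : closed S -> S `<=` `]d, eta[%classic ->
    (\int[mu]_(x in D) (w x * \1_S (sqn x))%:E <= 0)%E.
  move=> cS Sde.
  have oW : open (`]d, eta[%classic : set R) by exact: interval_open.
  have [U [oU UW Ucvg]] := closed_indicator_cvg cS oW Sde.
  apply: (lim_closed (fun n => \1_(U n))) => //.
  - by move=> n; apply: measurable_indic; exact: open_measurable.
  - by apply: measurable_indic; exact: closed_measurable.
  - by move=> n s; rewrite indicE; case: (_ \in _); rewrite /= ?lexx ?ler01.
  - by move=> n; exact: H_open.
pose A := D `&` [set x | F < u x].
have mA : measurable A.
  rewrite (_ : A = D `&` w @^-1` `]0, +oo[%classic); first exact: mwD.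
  apply/seteqP; split => x [Dx]; rewrite /= in_itv /= andbT subr_gt0 => ?;
  by split.
have A_B : A `<=` B by move=> x [/DB].
have mu_lty E : measurable E -> E `<=` B -> (mu E < +oo)%E.
  move=> mE EB; apply: le_lt_trans unit_ball_lty.
  by rewrite le_measure ?inE.
suff A0 : mu A = 0%E.
  exists A; split => // x /= /not_implyP[Dx /negP]; rewrite -ltNge => ?.
  by split.
apply/eqP; apply: contraT => A_neq0.
(* Outside the null set [Z], [u] is a genuine function of the norm; removing [Z] gives every point
   of [C] this property. *)
pose A' := A `\` Z.
have mA' : measurable A' by exact: measurableD.
have A'B : A' `<=` B by move=> x [/A_B].
have muA' : mu A' = mu A.
  apply/eqP; rewrite eq_le le_measure ?inE //=; last by move=> x [].
  have : (mu A <= mu (A' `|` Z))%E.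
    rewrite le_measure ?inE //; first exact: measurableU.
    by move=> x Ax; have [Zx|nZx] := pselect (Z x); [right|left].
  move/le_trans; apply; apply: (le_trans (measureU2 _ _ _)) => //.
  by rewrite [X in (_ + X)%E]Z0 adde0.
have A'gt0 : (0 < mu A')%E by rewrite muA' lt0e A_neq0 measure_ge0.
have A'fin : mu A' \is a fin_num by rewrite ge0_fin_numE // mu_lty.
have mfin : (mrestr mu mB setT < +oo)%E by rewrite /mrestr setTI unit_ball_lty.
have A'pos : 0 < fine (mu A') by rewrite fine_gt0 // A'gt0 mu_lty.
have [C cC [CA' mC]] := closed_inner_regular mfin mA' A'pos.
have mCm : measurable C := closed_measurable_rV cC.
have CD : C `<=` D by move=> x /CA' [[]].
have C_neq0 : mu C <> 0%E.
  move=> C0; have : (mu (A' `\` C) < mu A')%E.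
    move: mC; rewrite fineK //; congr (_ < _)%E.
    by rewrite -[LHS]/(mu ((A' `\` C) `&` B)) setIidl // => x [/A'B].
  apply/negP; rewrite -leNgt.
  have : (mu A' <= mu (C `|` (A' `\` C)))%E.
    rewrite le_measure ?inE //.
      by apply: measurableU => //; exact: measurableD.
    by move=> x Ax; have [Cx|nCx] := pselect (C x); [left|right].
  move/le_trans; apply; apply: (le_trans (measureU2 _ _ _)) => //.
    exact: measurableD.
  by rewrite [X in (X + _)%E]C0 add0e.
pose S := @sqn R N @` C.
have cS : closed S.
  apply: compact_closed; first exact: norm_hausdorff.
  apply: continuous_compact.
    by apply: continuous_subspaceT; exact: continuous_sqn.
  apply: (subclosed_compact cC (@compact_sqn_le R N eta)).
  exact: subset_trans CD DK.
have Sde : S `<=` `]d, eta[%classic.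
  by move=> _ [y /CD Dy <-]; rewrite /= in_itv.
have mS : measurable S by exact: closed_measurable.
(* Off [Z], [u x] equals its value at a point of [C] with the same norm, where it exceeds [F]. *)
have wS (x : 'rV[R]_N) : D x -> ~ Z x -> 0 <= w x * \1_S (sqn x).
  move=> Dx nZx; rewrite indicE; have [[y Cy yx]|nS] := pselect (S (sqn x));
    last by rewrite memNset // mulr0.
  rewrite mem_set ?mulr1; last by exists y.
  have uf z : B z -> ~ Z z -> u z = f (enorm z).
    by move=> Bz nZz; apply: contrapT => nu; apply: nZz; apply: Zsub => /(_ Bz).
  have [[Dy /= Fy] nZy] := CA' y Cy.
  rewrite /w subr_ge0 (uf x (DB _ Dx) nZx) enormE -yx -enormE.
  by rewrite -(uf y (DB _ Dy) nZy) ltW.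
have mwS : measurable_fun D (fun x => (w x * \1_S (sqn x))%:E).
  apply/measurable_EFinP; apply: measurable_funM => //.
  by apply: measurable_comp_sqn; exact: measurable_indic.
(* A function that is nonnegative off [Z] and has a nonpositive integral vanishes almost everywhere;
   but this one is positive on [C]. *)
have ae0 : ae_eq mu D (fun x => (w x * \1_S (sqn x))%:E) (cst 0%E).
  apply/(ae_eq_integral_abs mu mD mwS)/eqP; rewrite eq_le; apply/andP; split.
    apply: le_trans (H_closed S cS Sde).
    rewrite le_eqVlt; apply/orP; left; apply/eqP.
    apply: ae_eq_integral => //; first exact: measurableT_comp.
    exists Z; split => // x /= /not_implyP[Dx ne]; apply: contrapT => nZx.
    by apply: ne; rewrite ger0_norm // wS.
  by apply: integral_ge0.
apply/negP => _; apply: C_neq0.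
case: ae0 => E [mE E0 Esub].
apply/eqP; rewrite eq_le measure_ge0 andbT -E0 le_measure ?inE //.
move=> x Cx; apply: Esub => /= /(_ (CD x Cx)) [].
rewrite indicE mem_set; last by exists x.
rewrite mulr1 => /eqP; rewrite gt_eqF // subr_gt0.
by have [[]] := CA' x Cx.
Qed.

End essential_bound.

(** * The pointwise logarithmic bound *)

Section log_kernel.
Context {R : realType} {N : nat}.
Hypothesis N_ge3 : (3 <= N)%N.
Local Notation q := (N%:R / 2).
Variables (beta d : R).
Hypotheses (beta01 : 0 < beta < 1) (d0 : 0 < d) (d1 : d < 1).

Let N_gt0 : (0 < N)%N. Proof. by case: N N_ge3. Qed.

Let NR_gt0 : 0 < N%:R :> R. Proof. by rewrite ltr0n. Qed.

Let q_gt0 : 0 < q :> R. Proof. by rewrite divr_gt0. Qed.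

(** The kernel is computed in y = |x|^N: there [y1] stands for |x|^2 = d, [L y] below for 1 - log
    |x|, and [Num.max y y1] for max(|x|^2, d)^q. *)
Let y1 := d `^ q.

Let y1_gt0 : 0 < y1. Proof. by rewrite powR_gt0. Qed.

Let y1_lt1 : y1 < 1.
Proof.
have -> : 1 = 1 `^ q :> R by rewrite powR1.
by rewrite /y1 gt0_ltr_powR ?nnegrE ?ltW.
Qed.

Let L (y : R) := 1 - ln y / N%:R.

Let L_ge1 y : y <= 1 -> 1 <= L y.
Proof.
move=> yle; rewrite /L lerDl oppr_ge0 pmulr_lle0 ?invr_gt0 //.
exact: ln_le0.
Qed.

Let h (y : R) := L y `^ (- beta) * (Num.max y y1)^-1.

Let mh : measurable_fun setT h.
Proof.
apply: measurable_funM.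
  apply: (@measurableT_comp _ _ _ _ _ _ (fun t : R => t `^ (- beta))).
    exact: measurable_powR.
  apply: measurable_funB; first exact: measurable_cst.
  by apply: measurable_funM; [exact: measurable_ln|exact: measurable_cst].
rewrite (_ : (fun x => _) = (fun t : R => t `^ (-1)) \o (fun x => Num.max x y1)).
  apply: (@measurableT_comp _ _ _ _ _ _ (fun t : R => t `^ (-1))).
    exact: measurable_powR.
  exact: measurable_maxr.
apply/funext => x /=; rewrite powR_inv1 // le_max (ltW y1_gt0) orbT //.
Qed.

Let max_gt0 y : 0 < Num.max y y1. Proof. by rewrite lt_max y1_gt0 orbT. Qed.

Let h_ge0 y : 0 <= h y.
Proof. by rewrite mulr_ge0 ?powR_ge0 // invr_ge0 ltW. Qed.

Let h_lo : (\int[lebesgue_measure]_(y in `[0%R, y1[) (h y)%:E <= 1)%E.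
Proof.
apply: (@le_trans _ _
    (\int[lebesgue_measure]_(y in `[0%R, y1[) (cst y1^-1%:E y))%E).
  apply: ge0_le_integral => //.
  - by move=> y _; rewrite lee_fin.
  - by apply/measurable_EFinP; exact: measurable_funTS.
  - move=> y /=; rewrite in_itv /= => /andP[y0 yy]; rewrite lee_fin /h.
    rewrite max_r ?(ltW yy) // ler_piMl ?invr_ge0 ?(ltW y1_gt0) //.
    have L1 := L_ge1 (ltW (lt_trans yy y1_lt1)).
    rewrite powRN invf_le1; last by rewrite powR_gt0 // (lt_le_trans ltr01).
    have -> : 1 = 1 `^ beta :> R by rewrite powR1.
    have /andP[/ltW b0 _] := beta01.
    by rewrite ge0_ler_powR // nnegrE // (le_trans ler01).
rewrite integral_cst //= lebesgue_measure_itv /= lte_fin y1_gt0 sube0.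
by rewrite -EFinM mulVf // gt_eqF.
Qed.

Let is_derive_prim_h (y : R) : 0 < y -> y <= 1 ->
  is_derive y 1 (fun y => - (N%:R / (1 - beta) * L y `^ (1 - beta)))
    (L y `^ (- beta) * y^-1).
Proof.
move=> y0 yle; have Ly : 0 < L y by exact: lt_le_trans ltr01 (L_ge1 yle).
have dL : is_derive y 1 L (- (y^-1 / N%:R)).
  have dl := is_derive1_ln y0.
  have := is_deriveB (is_derive_cst (1 : R) y 1)
    (is_deriveM dl (is_derive_cst (N%:R^-1 : R) y 1)).
  congr (is_derive _ _ _ _).
  by rewrite /GRing.scale /=; ring.
have dp := @is_derive1_comp _ (fun t => t `^ (1 - beta)) L y _ _
  (is_derive1_powR (1 - beta) Ly) dL.
have := is_deriveN (is_deriveM (is_derive_cst (N%:R / (1 - beta) : R) y 1) dp).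
congr (is_derive _ _ _ _).
rewrite /GRing.scale /= (_ : 1 - beta - 1 = - beta); last by ring.
rewrite mulr0 addr0.
have /andP[_ b1] := beta01.
by field; rewrite (gt_eqF y0) (gt_eqF NR_gt0) subr_eq0 eq_sym lt_eqF.
Qed.

Let h_hi : (\int[lebesgue_measure]_(y in `[y1, 1%R]) (h y)%:E <=
  (N%:R / (1 - beta) * (L y1 `^ (1 - beta) - 1))%:E)%E.
Proof.
have -> : (\int[lebesgue_measure]_(y in `[y1, 1%R]) (h y)%:E =
    \int[lebesgue_measure]_(y in `[y1, 1%R]) (L y `^ (- beta) * y^-1)%:E)%E.
  apply: eq_integral => y; rewrite inE /= in_itv /= => /andP[y1y _].
  by rewrite /h max_l.
have dF (y : R) : y1 <= y <= 1 ->
    is_derive y 1 (fun y => - (N%:R / (1 - beta) * L y `^ (1 - beta)))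
    (L y `^ (- beta) * y^-1).
  by move=> /andP[yy yle]; apply: is_derive_prim_h => //; exact: lt_le_trans yy.
rewrite (FTC2_is_derive y1_lt1 dF).
  rewrite lee_fin {1}/L ln1 mul0r subr0 powR1 mulr1 opprK mulrBr mulr1.
  by rewrite addrC.
apply/continuous_in_subspaceT => y; rewrite inE /= in_itv /= => /andP[yy yle].
have y0 : 0 < y by exact: lt_le_trans yy.
have Ly : 0 < L y by exact: lt_le_trans ltr01 (L_ge1 yle).
apply: cvgM; last by apply: cvgV; [rewrite gt_eqF|exact: cvg_id].
apply: (@continuous_comp _ _ _ L (fun t => t `^ (- beta)) y).
  apply: cvgB; first exact: cvg_cst.
  by apply: cvgMl; exact: continuous_ln.
exact: is_derive_continuous (is_derive1_powR (- beta) Ly).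
Qed.

(** The part |x|^2 < d contributes at most a constant multiple 1 of V_N. It is absorbed by the term
    -N/(1-beta) coming from the end y = 1 of the outer integral, because N/(1-beta) >= 1; so no
    additive constant is left. *)
Lemma log_kernel_integral :
  (\int[lebesgue_rV N]_(x in unit_ball)
    ((1 - ln (enorm x)) `^ (- beta) * (Num.max (sqn x) d) `^ (- q))%:E <=
   (N%:R * ball_volume N / (1 - beta) * (1 - ln d / 2) `^ (1 - beta))%:E)%E.
Proof.
have V0 := @ball_volume_gt0 R N.
have /andP[b0 b1] := beta01.
have -> : (\int[lebesgue_rV N]_(x in unit_ball)
    ((1 - ln (enorm x)) `^ (- beta) * (Num.max (sqn x) d) `^ (- q))%:E =
    \int[lebesgue_rV N]_(x in unit_ball) (h (enorm x ^+ N)%R)%:E)%E.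
  apply: eq_integral => x _; congr (_%:E); rewrite /h /L.
  have sq : sqn x `^ q = enorm x ^+ N.
    rewrite -sqr_enorm -powR_mulrn ?enorm_ge0 // -powRrM.
    by rewrite mulrCA divff ?mulr1 ?powR_mulrn ?enorm_ge0.
  congr (_ * _).
    have := enorm_ge0 x; rewrite le_eqVlt => /predU1P[<-|x0].
      by rewrite expr0n gtn_eqF //= ln0 // mul0r.
    by rewrite lnXn // -[ln _ *+ _]mulr_natr mulfK // gt_eqF.
  rewrite powRN -sq; congr (_^-1).
  have [dT|Td] := leP d (sqn x).
    suff : y1 <= sqn x `^ q by move/max_l.
    by rewrite ge0_ler_powR ?nnegrE ?sqn_ge0 ?(ltW d0) ?(ltW q_gt0).
  suff : sqn x `^ q <= y1 by move/max_r.
  by rewrite ge0_ler_powR ?nnegrE ?sqn_ge0 ?(ltW d0) ?(ltW q_gt0) ?(ltW Td).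
have mhE : measurable_fun setT (fun y => (h y)%:E) by exact/measurable_EFinP.
have hE_ge0 y : (0 <= (h y)%:E)%E by rewrite lee_fin.
rewrite (@integral_radial _ _ N_gt0 _ mhE hE_ge0).
rewrite (mulrC N%:R) -!mulrA EFinM.
apply: lee_wpmul2l; first by rewrite lee_fin ltW.
rewrite mulrA.
have sub : (`[0, 1[%classic : set R) `<=` `[0, y1[%classic `|` `[y1, 1]%classic.
  move=> y; rewrite /= !in_itv /= => /andP[y0 /ltW yle].
  by have [?|?] := ltP y y1; [left; rewrite y0|right; rewrite yle].
have mhD D : measurable_fun D (fun y => (h y)%:E) by exact: measurable_funTS.
apply: (@le_trans _ _ (\int[lebesgue_measure]_(y in
    `[0%R, y1[ `|` `[y1, 1%R]) (h y)%:E)%E).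
  apply: ge0_subset_integral => //; first exact: measurableU.
  exact: mhD.
rewrite ge0_integral_setU //; last 2 first.
- exact: mhD.
- apply/disj_setPS => y [] /=; rewrite !in_itv /= => /andP[_ yy] /andP[+ _].
  by rewrite leNgt yy.
apply: le_trans (leeD h_lo h_hi) _.
have -> : L y1 = 1 - ln d / 2.
  rewrite /L /y1 ln_powR; congr (1 - _).
  by field; rewrite gt_eqF.
rewrite -EFinD lee_fin mulrBr mulr1 addrCA gerDl subr_le0.
rewrite ler_pdivlMr ?subr_gt0 // mul1r.
have : 1 <= N%:R :> R by rewrite ler1n.
by lra.
Qed.

End log_kernel.

(** * Hoelder's inequality against the logarithmic weight *)

Section weighted_hoelder.
Context {R : realType} {N : nat}.
Hypothesis N_ge3 : (3 <= N)%N.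
Local Notation q := (N%:R / 2).
Local Notation mu := (@lebesgue_rV R N).
Local Notation B := (@unit_ball R N).
Variable beta : R.
Hypothesis beta01 : 0 < beta < 1.

Let N_gt0 : (0 < N)%N. Proof. by case: N N_ge3. Qed.

Let NR_gt0 : 0 < N%:R :> R. Proof. by rewrite ltr0n. Qed.

Let q_gt1 : 1 < q :> R.
Proof. by rewrite ltr_pdivlMr // mul1r ltr_nat. Qed.

(** The origin has to be discarded: [expR 1 / 0] is 0, so [weight] does not follow [weightE] there.
    The null measure comes from [integral_radial] applied to the indicator of 0. *)
Lemma enorm_eq0_null : mu [set x : 'rV[R]_N | enorm x = 0] = 0%E.
Proof.
have mZ : measurable [set x : 'rV[R]_N | enorm x = 0].
  rewrite (_ : mkset _ = @enorm R N @^-1` [set 0]) //.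
  by rewrite -[X in measurable X]setTI; apply: measurable_enorm.
have ZB : [set x : 'rV[R]_N | enorm x = 0] `<=` B.
  by move=> x /= x0; rewrite /unit_ball /= x0.
have mh : measurable_fun setT (fun y : R => (\1_[set (0 : R)] y)%:E : \bar R).
  by apply/measurable_EFinP; exact: measurable_indic.
have := integral_radial N_gt0 mh _.
rewrite (_ : (\int[lebesgue_measure]_(y in `[0%R, 1%R[) _)%E = 0%E); last first.
  rewrite integral_indic //.
  apply/eqP; rewrite eq_le measure_ge0 andbT.
  rewrite -(lebesgue_measure_set1 (0 : R)) le_measure ?inE //.
  by apply: measurableI.
rewrite mule0 => <-; last by move=> y; rewrite lee_fin.
have -> : (\int[mu]_(x in B) (\1_[set (0 : R)] (enorm x ^+ N)%R)%:E =
    \int[mu]_(x in B) (\1_[set x : 'rV[R]_N | enorm x = 0%R] x)%:E)%E.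
  apply: eq_integral => x _; congr (_%:E); rewrite !indicE; congr (_%:R).
  congr nat_of_bool; apply/idP/idP; rewrite !inE /=.
    by move/eqP; rewrite expf_eq0 => /andP[_ /eqP].
  by move=> ->; rewrite expr0n gtn_eqF.
rewrite integral_indic //; last exact: measurable_unit_ball.
by congr (mu _); apply/esym/setIidl.
Qed.

Lemma weightE (x : 'rV[R]_N) : enorm x != 0 ->
  weight beta x = (1 - ln (enorm x)) `^ (beta * (q - 1)).
Proof.
move=> x0; rewrite /weight ln_div ?posrE ?expR_gt0 //; last first.
  by rewrite lt_neqAle eq_sym x0 enorm_ge0.
by rewrite expRK.
Qed.

Lemma measurable_weight : measurable_fun setT (@weight R N beta).
Proof.
rewrite /weight.
apply: (@measurableT_comp _ _ _ _ _ _ (fun t : R => t `^ (beta * (q - 1)))).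
  exact: measurable_powR.
apply: (@measurableT_comp _ _ _ _ _ _ (@ln R)); first exact: measurable_ln.
apply: measurable_funM; first exact: measurable_cst.
rewrite (_ : (fun x => _) = (fun t : R => t `^ (-1)) \o @enorm R N).
  apply: (@measurableT_comp _ _ _ _ _ _ (fun t : R => t `^ (-1))).
    exact: measurable_powR.
  exact: measurable_enorm.
by apply/funext => x /=; rewrite powR_inv1 // enorm_ge0.
Qed.

Lemma log_ge1 (x : 'rV[R]_N) : B x -> 1 <= 1 - ln (enorm x).
Proof. by move=> /ltW x1; rewrite lerDl oppr_ge0 ln_le0. Qed.

Lemma measurable_log_powR (c : R) :
  measurable_fun setT (fun x : 'rV[R]_N => (1 - ln (enorm x)) `^ c).
Proof.
apply: (@measurableT_comp _ _ _ _ _ _ (fun t : R => t `^ c)).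
  exact: measurable_powR.
apply: measurable_funB; first exact: measurable_cst.
apply: (@measurableT_comp _ _ _ _ _ _ (@ln R)); first exact: measurable_ln.
exact: measurable_enorm.
Qed.

Lemma measurable_max_powR (d c : R) :
  measurable_fun setT (fun x : 'rV[R]_N => (Num.max (sqn x) d) `^ c).
Proof.
apply: (@measurableT_comp _ _ _ _ _ _ (fun t : R => t `^ c)).
  exact: measurable_powR.
apply: measurable_maxr => //; exact: measurable_sqn.
Qed.

(** The integrand is split as (w^(1/q) |g|) times (w^(-1/q) max(|x|^2, d)^(1-q)). With the conjugate
    exponent q/(q-1), the power of the second factor is the kernel of [log_kernel_integral]; it is
    integrated over the whole ball, so the bound does not depend on eta. *)
Lemma weighted_hoelder (g : 'rV[R]_N -> R) (d eta M : R) :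
  measurable_fun B g -> 0 < d -> d < 1 -> eta < 1 -> 0 <= M ->
  (\int[mu]_(x in sublevel eta) (weight beta x * `|g x| `^ q)%:E <= M%:E)%E ->
  (\int[mu]_(x in sublevel eta)
     (`|g x| * (Num.max (sqn x) d) `^ (1 - q))%:E <=
   (M `^ q^-1 * (N%:R * ball_volume N / (1 - beta) *
     (1 - ln d / 2) `^ (1 - beta)) `^ (1 - q^-1))%:E)%E.
Proof.
move=> mg d0 d1 eta1 M0 gM.
have q0 : 0 < q :> R by rewrite divr_gt0.
have qn0 : q != 0 :> R by rewrite gt_eqF.
have q1n0 : q - 1 != 0 :> R by rewrite subr_eq0 gt_eqF.
set D := sublevel eta; have DB : D `<=` B := sqn_le_sub_ball eta1.
have mD : measurable D := measurable_sqn_le eta.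
have mB : measurable B := measurable_unit_ball.
pose p : R := q / (q - 1).
have p0 : 0 < p by rewrite divr_gt0 // subr_gt0.
have pq : q^-1 + p^-1 = 1.
  by rewrite /p; move: (q) qn0 q1n0 => r r0 r1; field; rewrite ?r0 ?r1.
pose f := (fun x => weight beta x `^ q^-1 * `|g x|) \_ D.
pose k := (fun x : 'rV[R]_N => (1 - ln (enorm x)) `^ (- (beta * (q - 1) / q)) *
  (Num.max (sqn x) d) `^ (1 - q)) \_ B.
have mf : measurable_fun setT f.
  apply/(measurable_restrictT _ mD); apply: measurable_funM.
    apply: measurable_funTS.
    apply: (@measurableT_comp _ _ _ _ _ _ (fun t : R => t `^ q^-1)).
      exact: measurable_powR.
    exact: measurable_weight.
  by apply: measurableT_comp => //; exact: measurable_funS DB mg.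
have mk : measurable_fun setT k.
  apply/(measurable_restrictT _ mB); apply: measurable_funTS.
  by apply: measurable_funM; [exact: measurable_log_powR|
    exact: measurable_max_powR].
have := hoelder mu mf mk q0 p0 pq.
rewrite Lnorm1 => H.
have LHS : (\int[mu]_x `|(EFin \o (f \* k)%R) x| =
    \int[mu]_(x in D) (`|g x| * (Num.max (sqn x) d) `^ (1 - q))%:E)%E.
  rewrite [RHS]integral_mkcond.
  have mZ : measurable [set x : 'rV[R]_N | enorm x = 0].
    rewrite (_ : mkset _ = @enorm R N @^-1` [set 0]) //.
    by rewrite -[X in measurable X]setTI; apply: measurable_enorm.
  apply: ae_eq_integral => //.
  - by do 2 apply: measurableT_comp => //; exact: measurable_funM.
  - apply/(measurable_restrictT _ mD)/measurable_EFinP/measurable_funM.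
      by apply: measurableT_comp => //; exact: measurable_funS DB mg.
    by apply: measurable_funTS; exact: measurable_max_powR.
  exists [set x : 'rV[R]_N | enorm x = 0]; split => //.
    exact: enorm_eq0_null.
  move=> x /= H'; apply: contrapT => /eqP x0; apply: H' => _.
  rewrite /= /f /k !patchE.
  case: ifPn => [xD|_]; last by rewrite mul0r normr0.
  have xB : B x by apply: DB; rewrite inE in xD.
  rewrite mem_set // weightE //.
  have L0 : 0 < 1 - ln (enorm x) by rewrite (lt_le_trans ltr01) // log_ge1.
  congr (_%:E); rewrite -powRrM mulrACA powRN divff ?mul1r; last first.
    by rewrite gt_eqF // powR_gt0.
  by rewrite ger0_norm // mulr_ge0 ?powR_ge0.
rewrite LHS in H; apply: (le_trans H).
have lnf : ('N[mu]_q%:E [EFin \o f] <= (M `^ q^-1)%:E)%E.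
  rewrite unlock /=.
  have e : (\int[mu]_x (`|(f x)%:E| `^ q) =
      \int[mu]_(x in D) (weight beta x * `|g x| `^ q)%:E)%E.
    rewrite [RHS]integral_mkcond; apply: eq_integral => x _.
    rewrite /f !patchE; case: ifPn => _; last first.
      by rewrite /= normr0 ?poweR_EFin powR0.
    rewrite /= ?poweR_EFin ger0_norm ?mulr_ge0 ?powR_ge0 //.
    rewrite powRM ?powR_ge0 // -powRrM mulVf // powRr1 //.
    exact: powR_ge0.
  rewrite e -poweR_EFin; apply: gt0_ler_poweR => //.
  - rewrite in_itv /= leey andbT; apply: integral_ge0 => x _.
    by rewrite lee_fin mulr_ge0 // powR_ge0.
  - by rewrite in_itv /= leey andbT lee_fin.
have lnk : ('N[mu]_p%:E [EFin \o k] <= ((N%:R * ball_volume N / (1 - beta) *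
     (1 - ln d / 2) `^ (1 - beta)) `^ (1 - q^-1))%:E)%E.
  rewrite unlock /=.
  have pE : 1 - q^-1 = p^-1 by apply/eqP; rewrite subr_eq addrC pq.
  have e : (\int[mu]_x (`|(k x)%:E| `^ p) =
    \int[mu]_(x in B) ((1 - ln (enorm x)) `^ (- beta) *
       (Num.max (sqn x) d) `^ (- q))%:E)%E.
    rewrite [RHS]integral_mkcond; apply: eq_integral => x _.
    rewrite /k !patchE; case: ifPn => [xB|_]; last first.
      by rewrite /= normr0 ?poweR_EFin powR0 // gt_eqF.
    rewrite /= ?poweR_EFin ger0_norm ?mulr_ge0 ?powR_ge0 //.
    rewrite powRM ?powR_ge0 // -!powRrM.
    by congr ((_ `^ _ * _ `^ _)%:E); rewrite /p;
      move: (q) qn0 q1n0 => r r0 r1; field; rewrite ?r0 ?r1.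
  rewrite e pE -poweR_EFin; apply: gt0_ler_poweR => //.
  - by rewrite invr_ge0 ltW.
  - rewrite in_itv /= leey andbT; apply: integral_ge0 => x _.
    by rewrite lee_fin mulr_ge0 // powR_ge0.
  - rewrite in_itv /= leey andbT lee_fin.
    have V0 := @ball_volume_gt0 R N; have /andP[_ b1] := beta01.
    rewrite mulr_ge0 ?powR_ge0 // divr_ge0 ?subr_ge0 ?ltW //.
    by rewrite mulr_gt0.
  - exact: log_kernel_integral.
by rewrite [leRHS]EFinM; apply: lee_pmul => //; exact: Lnorm_ge0.
Qed.

End weighted_hoelder.

(** * From shells to the whole ball *)

Section pointwise_bound.
Context {R : realType} {N : nat}.
Hypothesis N_ge3 : (3 <= N)%N.
Local Notation q := (N%:R / 2).
Local Notation mu := (@lebesgue_rV R N).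
Local Notation B := (@unit_ball R N).

Let N_gt0 : (0 < N)%N. Proof. by case: N N_ge3. Qed.

Let NR_gt0 : 0 < N%:R :> R. Proof. by rewrite ltr0n. Qed.

Let q_gt1 : 1 < q :> R.
Proof. by rewrite ltr_pdivlMr // mul1r ltr_nat. Qed.

Let V_gt0 : 0 < ball_volume N :> R. Proof. exact: ball_volume_gt0. Qed.

Lemma ae_radial_norm_le (u : 'rV[R]_N -> R) (d eta F : R) :
  loc_integrable u -> radial u -> 0 < d -> d < eta -> eta < 1 ->
  (forall a : R -> R, smooth_on setT a -> (forall s, s <= d -> a s = 0) ->
    (forall s, eta <= s -> a s = 0) -> (forall s, 0 <= a s) ->
    `|\int[mu]_(x in B) (u x * a (sqn x))| <=
    F * \int[mu]_(x in B) a (sqn x)) ->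
  {ae mu, forall x, shell d eta x -> `|u x| <= F}.
Proof.
move=> lu ru d0 de eta1 H.
have ae1 : {ae mu, forall x, shell d eta x -> u x <= F}.
  apply: ae_radial_le => // a sa alo ahi a0.
  exact: le_trans (ler_norm _) (H a sa alo ahi a0).
have ae2 : {ae mu, forall x, shell d eta x -> - u x <= F}.
  apply: (@ae_radial_le _ _ (fun x => - u x)) => //.
  - case: lu => mu_ lu; split; first exact: measurableT_comp.
    by move=> K cK KB; have := integrableN (lu K cK KB); apply: eq_integrable;
      first by apply: closed_measurable_rV; apply: compact_closed cK;
      exact: norm_hausdorff.
  - case: ru => f fE; exists (fun r => - f r).
    by apply: filterS fE => x fx Bx; rewrite fx.
  - move=> a sa alo ahi a0.
    apply: le_trans (H a sa alo ahi a0).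
    have ca : continuous a by move=> x; exact: smooth_on_continuous sa I.
    have iua := integrable_radial_mul lu ca eta1 ahi.
    have -> : \int[mu]_(x in B) (- u x * a (sqn x)) =
        (-1) * \int[mu]_(x in B) (u x * a (sqn x)).
      rewrite -RintegralZl //; last exact: measurable_unit_ball.
      by apply: eq_Rintegral => x _; rewrite mulN1r mulNr.
    by rewrite mulN1r (le_trans (ler_norm _)) // normrN.
apply: filterS2 ae1 ae2 => x h1 h2 Dx.
by rewrite ler_norml -lerNl h2 // h1.
Qed.

(** If the total mass were 0, the mass, which lies between 0 and its total, would vanish
    identically, while its derivative is positive at the midpoint of the support. *)
Lemma mass_bump (e1 e0 : R) : 0 < e1 -> e1 < e0 -> exists b : R -> R,
  [/\ smooth_on setT b, forall s, s <= e1 -> b s = 0,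
  forall s, e0 <= s -> b s = 0, forall s, 0 <= b s <= 1 &
  0 < @mass R N b e0].
Proof.
move=> e10 e10'; have [b [sb b01 bpos]] := @smooth_bump R e1 e0.
have b_eq0 s : ~~ (e1 < s < e0) -> b s = 0.
  move=> ns; have /andP[b0 _] := b01 s; apply/eqP.
  by rewrite eq_le b0 andbT leNgt bpos.
have b_lo s : s <= e1 -> b s = 0.
  by move=> se; apply: b_eq0; rewrite ltNge se.
have b_hi s : e0 <= s -> b s = 0.
  by move=> se; apply: b_eq0; rewrite andbC ltNge se.
exists b; split => //.
have b_ge0 s : 0 <= b s by have /andP[] := b01 s.
have m01 s := mass_ge0 (N := N) e10 sb b_lo b_hi s b_ge0.
rewrite lt_neqAle; apply/andP; split; last by have /andP[] := m01 e0.
apply/eqP => m0.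
pose t := (e1 + e0) / 2.
have et : e1 < t < e0 by rewrite /t; apply/andP; split; lra.
have dm := is_derive_mass (N := N) e10 sb b_lo t.
have m_cst : @mass R N b = cst 0.
  apply/funext => s; apply/eqP; rewrite eq_le.
  by have := m01 s; rewrite -m0 andbC.
rewrite m_cst in dm; have [_] := dm; rewrite derive_cst => /esym/eqP.
apply/negP; rewrite gt_eqF // !mulr_gt0 ?bpos // powR_gt0 //.
by case/andP : et => et _; exact: lt_trans et.
Qed.

Variable beta : R.
Hypothesis beta01 : 0 < beta < 1.

(** The constant kappa. The denominator is that of the fundamental solution, from 2 (q - 1) = N - 2;
    the numerator is the dual norm of the kernel without its logarithm. *)
Definition log_const : R :=
  (N%:R * ball_volume N / (1 - beta)) `^ (1 - q^-1) /
  ((N%:R - 2) * N%:R * ball_volume N).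

(** The constant [C] is fixed before [u], [g] and [M]. Near 0, shells with inner level d shrinking
    to 0 use [weighted_hoelder]; for |x|^2 > e1 the kernel is at most e1^(1-q), and the L^1 bound
    [G] replaces [M]. The same bump, supported between e1 and e0, serves in both ranges. *)
Lemma radial_pointwise_bound (e0 U G : R) : 0 < e0 -> e0 < 1 ->
  0 <= U -> 0 <= G ->
  exists2 C : R, 0 <= C &
  forall (u g : 'rV[R]_N -> R) (M : R), loc_integrable u ->
    is_weak_laplacian u g -> radial u -> 0 <= M ->
    (\int[mu]_(x in B) `|u x|%:E <= U%:E)%E ->
    (\int[mu]_(x in B) `|g x|%:E <= G%:E)%E ->
    (\int[mu]_(x in sublevel e0) (weight beta x * `|g x| `^ q)%:E <= M%:E)%E ->
  {ae mu, forall x, B x -> `|u x| <= C + log_const * M `^ q^-1 *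
     (2 - ln (enorm x)) `^ ((1 - beta) * (1 - q^-1))}.
Proof.
move=> e00 e01 U0 G0.
have q0 : 0 < q :> R by rewrite divr_gt0.
have q1 : 0 < q - 1 :> R by rewrite subr_gt0.
pose e1 := e0 / 2.
have e10 : 0 < e1 by rewrite divr_gt0.
have e1e0 : e1 < e0 by rewrite ltr_pdivrMr // ltr_pMr // ltr1n.
have [b [sb b_lo b_hi b01 mb0]] := mass_bump e10 e1e0.
set mb := mass b e0 in mb0.
pose C := (U / mb + e1 `^ (1 - q) * G / (q - 1)) / (2 * N%:R * ball_volume N).
have NV0 : 0 < 2 * N%:R * ball_volume N :> R by rewrite !mulr_gt0.
have Umb : 0 <= U / mb by rewrite divr_ge0 // ltW.
have C0 : 0 <= C.
  rewrite divr_ge0 ?(ltW NV0) // addr_ge0 // divr_ge0 ?(ltW q1) //.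
  by rewrite mulr_ge0 ?powR_ge0.
exists C => // u g M lu ug ru M0 uU gG gM.
have mg : measurable_fun B g by case: ug => -[].
have mB : measurable B := measurable_unit_ball.
have /andP[b0 b1] := beta01.
have lc0 : 0 <= log_const.
  rewrite divr_ge0 ?powR_ge0 // !mulr_ge0 ?(ltW V_gt0) // subr_ge0 ler_nat.
  exact: ltnW.
have near0 (d : R) : 0 < d -> d <= e1 -> {ae mu, forall x, shell d e0 x ->
    `|u x| <= C + log_const * M `^ q^-1 *
      (1 - ln d / 2) `^ ((1 - beta) * (1 - q^-1))}.
  move=> d0 de1; have de0 : d < e0 by exact: le_lt_trans e1e0.
  have d1 : d < 1 by exact: lt_trans e01.
  have K := weighted_hoelder N_ge3 beta01 mg d0 d1 e01 M0 gM.
  have b_lo' s : s <= d -> b s = 0 by move=> sd; rewrite b_lo // (le_trans sd).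
  have A := radial_average_le N_ge3 lu ug d0 de0 e01 sb b_lo' b_hi b01 mb0 uU K.
  have := ae_radial_norm_le lu ru d0 de0 e01 A.
  apply: filterS => x h Dx; apply: (le_trans (h Dx)).
  rewrite /radial_const -/mb mulrDl; apply: lerD.
    by rewrite /C ler_wpM2r ?invr_ge0 ?(ltW NV0) // lerDl divr_ge0 ?(ltW q1) //
      mulr_ge0 ?powR_ge0.
  have l1 : 0 <= 1 - ln d / 2.
    by rewrite subr_ge0 (@le_trans _ _ 0) // pmulr_lle0 ?invr_gt0 // ln_le0 // ltW.
  rewrite [X in M `^ _ * X]powRM; last 2 first.
  - by rewrite divr_ge0 ?subr_ge0 ?(ltW b1) // mulr_ge0 // ltW.
  - exact: powR_ge0.
  rewrite -powRrM /log_const le_eqVlt; apply/orP; left; apply/eqP.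
  have -> : (N%:R - 2 : R) = 2 * (q - 1) by field.
  move: (_ `^ _) (_ `^ _) (_ `^ _) => p1 p2 p3.
  move: (q - 1) q1 => w w0; move: NR_gt0 V_gt0 => n0 v0.
  by field; rewrite !(gt_eqF w0, gt_eqF n0, gt_eqF v0).
have far0 (n : nat) : {ae mu, forall x, shell e1 (1 - (1 - e0) / n.+2%:R) x ->
    `|u x| <= C}.
  (* The denominator n+2 keeps these levels strictly above e0, hence above the support of the bump,
     while they tend to 1. *)
  set eta := 1 - _.
  have n2 : 0 < (1 - e0) / n.+2%:R by rewrite divr_gt0 // subr_gt0.
  have n3 : (1 - e0) / n.+2%:R < 1 - e0.
    by rewrite ltr_pdivrMr // ltr_pMr ?subr_gt0 // ltr1n.
  have eta1 : eta < 1 by rewrite /eta ltrBlDr ltrDl.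
  have e0eta : e0 < eta by rewrite /eta ltrBrDr -ltrBrDl.
  have e1eta : e1 < eta by exact: lt_trans e0eta.
  have b_hi' s : eta <= s -> b s = 0.
    by move=> es; rewrite b_hi // (le_trans (ltW e0eta)).
  have mE : @mass R N b eta = mb := mass_hi e10 sb b_lo b_hi (ltW e0eta).
  have mb0' : 0 < @mass R N b eta by rewrite mE.
  have K : (\int[mu]_(x in sublevel eta)
      (`|g x| * (Num.max (sqn x) e1) `^ (1 - q))%:E <= (e1 `^ (1 - q) * G)%:E)%E.
    have mD : measurable (sublevel eta) := @measurable_sqn_le R N eta.
    have DB : sublevel eta `<=` B := sqn_le_sub_ball eta1.
    have mgD : measurable_fun (sublevel eta) (fun x => `|g x|%:E).
      apply/measurable_EFinP; apply: measurableT_comp => //.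
      exact: measurable_funS DB mg.
    apply: (@le_trans _ _ (\int[mu]_(x in sublevel eta)
       ((e1 `^ (1 - q))%:E * `|g x|%:E))%E).
      apply: ge0_le_integral => //.
      - by move=> x _; rewrite lee_fin mulr_ge0 // powR_ge0.
      - apply/measurable_EFinP; apply: measurable_funM.
          exact/measurable_EFinP.
        by apply: measurable_funTS; exact: measurable_max_powR.
      - exact: measurable_funeM.
      - move=> x _; rewrite -EFinM lee_fin mulrC ler_wpM2r //.
        rewrite -(opprB q 1) !powRN lef_pV2 ?posrE ?powR_gt0 ?lt_max ?e10 ?orbT //.
        rewrite ge0_ler_powR ?nnegrE ?(ltW q1) ?(ltW e10) ?le_max ?lexx ?orbT //.
        by rewrite (ltW e10) orbT.
    rewrite ge0_integralZl //; last by rewrite lee_fin powR_ge0.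
    rewrite [leRHS]EFinM lee_wpmul2l ?lee_fin ?powR_ge0 //.
    apply: le_trans gG; apply: ge0_subset_integral => //.
    by apply/measurable_EFinP; exact: measurableT_comp.
  have A := radial_average_le N_ge3 lu ug e10 e1eta eta1 sb b_lo b_hi' b01 mb0'
    uU K.
  have := ae_radial_norm_le lu ru e10 e1eta eta1 A.
  by rewrite /radial_const mE.
(* Countably many levels, so that the exceptional null sets can be united. *)
pose dn n : R := e1 / 2 ^+ n.
have dn0 n : 0 < dn n by rewrite divr_gt0 // exprn_gt0.
have dn1 n : dn n <= e1.
  by rewrite ler_pdivrMr ?exprn_gt0 // ler_peMr ?(ltW e10) // exprn_ege1 // ler1n.
have H1 := ae_foralln (fun n => near0 (dn n) (dn0 n) (dn1 n)).
have H2 := ae_foralln far0.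
have H3 : {ae mu, forall x : 'rV[R]_N, enorm x <> 0}.
  exists [set x : 'rV[R]_N | enorm x = 0]; split => //.
  - rewrite (_ : mkset _ = @enorm R N @^-1` [set 0]) //.
    by rewrite -[X in measurable X]setTI; apply: measurable_enorm.
  - exact: enorm_eq0_null.
  - by move=> x /= /contrapT.
apply: filterS3 H1 H2 H3 => x h1 h2 /eqP x0 Bx.
have xp : 0 < enorm x by rewrite lt_neqAle eq_sym x0 enorm_ge0.
have Tp : 0 < sqn x by rewrite -sqr_enorm exprn_gt0.
have T1 : sqn x < 1 by rewrite -sqr_enorm exprn_ilt1 // enorm_ge0.
have [e1T|Te1] := ltP e1 (sqn x).
  have [n Tn] : exists n : nat, sqn x < 1 - (1 - e0) / n.+2%:R.
    have s0 : 0 < 1 - sqn x by rewrite subr_gt0.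
    have := @near_infty_natSinv_lt R (PosNum s0).
    case=> n _ /(_ n.+1 (leqnSn n)) /= hn; exists n.
    rewrite ltrBrDr -ltrBrDl; apply: le_lt_trans hn.
    by rewrite ler_piMl ?invr_ge0 // gerBl ltW.
  apply: (le_trans (h2 n _)); first by rewrite /shell /= e1T.
  by rewrite lerDl mulr_ge0 ?powR_ge0 // mulr_ge0 ?powR_ge0.
have [n [nlo nhi]] : exists n, dn n.+1 < sqn x /\ sqn x <= dn n.
  have ex : exists n, dn n < sqn x.
    have s0 : 0 < sqn x / e1 by rewrite divr_gt0.
    have := @near_infty_natSinv_expn_lt R (PosNum s0).
    case=> n _ /(_ n (leqnn n)) /= hn; exists n.
    by rewrite /dn mulrC -ltr_pdivlMr // -div1r.
  case: (ex_minnP ex) => -[|n] hn hmin.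
    by move: hn; rewrite /dn expr0 divr1 ltNge Te1.
  exists n; split => //; rewrite leNgt; apply/negP => /hmin.
  by rewrite ltnn.
apply: (le_trans (h1 n.+1 _)).
  by rewrite /shell /= nlo (le_lt_trans Te1).
rewrite lerD2l ler_wpM2l //; first by rewrite mulr_ge0 // powR_ge0.
(* Consecutive levels have ratio 2, so replacing |x|^2 by [dn n.+1] costs at most (log 2)/2 < 1 in
   the logarithm: hence 2 - log |x| instead of 1 - log |x|. *)
have lnle : ln (sqn x) <= ln 2 + ln (dn n.+1).
  rewrite -lnM ?posrE // ler_ln ?posrE ?mulr_gt0 //.
  rewrite (le_trans nhi) // le_eqVlt; apply/orP; left; apply/eqP.
  by rewrite /dn exprS; field; rewrite expf_neq0.
have lnsq : ln (sqn x) = 2 * ln (enorm x).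
  by rewrite -sqr_enorm lnXn // mulr_natl.
have ln2 : ln 2 < 2 :> R by exact: ln_sublinear.
have q1' : q^-1 <= 1 :> R by rewrite invf_le1 // ltW.
have lnd : ln (dn n.+1) <= 0 by rewrite ln_le0 // (le_trans (dn1 _)) // ltW // (lt_trans e1e0).
have lnx : ln (enorm x) <= 0 by rewrite ln_le0 // ltW.
rewrite ge0_ler_powR ?nnegrE //; first by rewrite mulr_ge0 // subr_ge0 // ltW.
all: lra.
Qed.

End pointwise_bound.

(** * Exponential integrability *)

Section exponential_integral.
Context {R : realType} {N : nat}.
Hypothesis N_gt0 : (0 < N)%N.
Local Notation mu := (@lebesgue_rV R N).
Local Notation B := (@unit_ball R N).

Let NR_gt0 : 0 < N%:R :> R. Proof. by rewrite ltr0n. Qed.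

(** The integrand is y^(-th) for y > 0. Its primitive y^(1-th)/(1-th) bounds the integrals over
    [1/(n+2), 1], and monotone convergence reaches 0. *)
Lemma integral_expR_ln (th : R) : th < 1 ->
  (\int[lebesgue_measure]_(y in `[0%R, 1%R[) (expR (- th * ln y))%:E <=
   (1 - th)^-1%:E)%E.
Proof.
move=> th1; have t0 : 0 < 1 - th by rewrite subr_gt0.
pose h (y : R) : R := expR (- th * ln y).
have mh : measurable_fun setT (fun y => (h y)%:E).
  apply/measurable_EFinP; apply: (@measurableT_comp _ _ _ _ _ _ (@expR R)).
    exact: measurable_expR.
  by apply: measurable_funM; [exact: measurable_cst|exact: measurable_ln].
have mhD D : measurable_fun D (fun y => (h y)%:E) by exact: measurable_funTS.
rewrite -(@integral_itv_obnd_cbnd R 0 _ (fun y => (h y)%:E)) //.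
pose F (n : nat) : set R := `[n.+2%:R^-1, 1]%classic.
have Fp n : 0 < n.+2%:R^-1 :> R by rewrite invr_gt0.
have ndF : {homo F : n m / (n <= m)%N >-> (n <= m)%O}.
  move=> n m nm; apply/subsetPset => y; rewrite /F /= !in_itv /= => /andP[yn ->].
  by rewrite andbT (le_trans _ yn) // lef_pV2 ?posrE // ler_nat.
have mF n : measurable (F n) by exact: measurable_itv.
have h0 y : (0 <= (h y)%:E)%E by rewrite lee_fin expR_ge0.
have Fle n : (\int[lebesgue_measure]_(y in F n) (h y)%:E <= (1 - th)^-1%:E)%E.
  have n1 : n.+2%:R^-1 < 1 :> R by rewrite invf_lt1 // ltr1n.
  have dF (y : R) : n.+2%:R^-1 <= y <= 1 ->
      is_derive y 1 (fun y => (1 - th)^-1 * y `^ (1 - th)) (h y).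
    move=> /andP[yn _]; have y0 : 0 < y by exact: lt_le_trans yn.
    have d1 := is_deriveM (is_derive_cst ((1 - th)^-1 : R) y 1)
      (is_derive1_powR (1 - th) y0).
    move: d1; congr (is_derive _ _ _ _).
    rewrite /GRing.scale /= mulr0 addr0 mulKf ?gt_eqF //.
    rewrite (_ : 1 - th - 1 = - th); last by ring.
    by rewrite /powR gt_eqF.
  rewrite (FTC2_is_derive n1 dF).
    rewrite lee_fin powR1 mulr1 gerBl mulr_ge0 ?powR_ge0 //.
    by rewrite invr_ge0 ltW.
  apply/continuous_in_subspaceT => y; rewrite inE /= in_itv /= => /andP[yn _].
  apply: (@continuous_comp _ _ _ (fun y => - th * ln y) (@expR R) y).
    by apply: cvgMr; apply: continuous_ln; exact: lt_le_trans yn.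
  exact: continuous_expR.
have := ge0_nondecreasing_set_cvg_integral ndF mF (fun n => mhD (F n))
  (fun n y _ => h0 y) (mu := @lebesgue_measure R).
move=> c; apply: (@le_trans _ _
    (\int[lebesgue_measure]_(y in \bigcup_i F i) (h y)%:E)%E).
  apply: ge0_subset_integral => //; [exact: bigcupT_measurable|exact: mhD|].
  move=> y; rewrite /= in_itv /= => /andP[y0 y1].
  have := @near_infty_natSinv_lt R (PosNum y0).
  case=> n _ /(_ n.+1 (leqnSn n)) /= hn; exists n => //.
  by rewrite /F /= in_itv /= (ltW hn) (ltW y1).
rewrite -(cvg_lim _ c) //; apply: lime_le; first by apply/cvg_ex; eexists; exact: c.
exact: nearW.
Qed.

(** Enlarging D to D' absorbs C once C <= (D' - D) X; for smaller X the left-hand side is at most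
    its value at X = C/(D' - D). The leading coefficient can thus be kept as close to D^gam as
    desired, at the price of an additive constant. *)
Lemma powR_affine_le (C D D' X gam : R) : 0 <= C -> 0 <= D -> D < D' ->
  0 <= X -> 0 <= gam ->
  (C + D * X) `^ gam <=
  D' `^ gam * X `^ gam + (C + D * (C / (D' - D))) `^ gam.
Proof.
move=> C0 D0 DD' X0 g0; have dp : 0 < D' - D by rewrite subr_gt0.
have D'0 : 0 <= D' by rewrite (le_trans D0) // ltW.
have [CX|XC] := leP C ((D' - D) * X).
  apply: (@le_trans _ _ ((D' * X) `^ gam)).
    rewrite ge0_ler_powR ?nnegrE ?addr_ge0 ?mulr_ge0 //.
    by rewrite -lerBrDr -mulrBl.
  by rewrite powRM // lerDl powR_ge0.
apply: (@le_trans _ _ ((C + D * (C / (D' - D))) `^ gam)).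
  have XY : X <= C / (D' - D) by rewrite ler_pdivlMr // mulrC ltW.
  have Y0 : 0 <= C / (D' - D) by exact: le_trans XY.
  have H : C + D * X <= C + D * (C / (D' - D)) by rewrite lerD2l ler_wpM2l.
  move: (C / _) XY Y0 H => Y XY Y0 H.
  by rewrite ge0_ler_powR ?nnegrE ?addr_ge0 ?mulr_ge0.
by rewrite lerDr mulr_ge0 // powR_ge0.
Qed.

Lemma exp_integral_bound (C D D' P gam : R) : 0 <= C -> 0 <= D -> D < D' ->
  0 < P -> 0 < gam -> P * D' `^ gam < N%:R ->
  exists Bd : R, forall u : 'rV[R]_N -> R, measurable_fun B u ->
    {ae mu, forall x, B x ->
      `|u x| <= C + D * (2 - ln (enorm x)) `^ gam^-1} ->
    (\int[mu]_(x in B) (expR (P * `|u x| `^ gam))%:E <= Bd%:E)%E.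
Proof.
move=> C0 D0 DD' P0 g0 PD.
have g0' : 0 <= gam by exact: ltW.
pose K := (C + D * (C / (D' - D))) `^ gam.
(* The exponential will be at most [E] times |x|^(-kap) = (|x|^N)^(-th); the summand [2 * kap] in
   [E] comes from the 2 in 2 - log |x|. *)
pose kap := P * D' `^ gam; pose th := kap / N%:R.
have th1 : th < 1 by rewrite ltr_pdivrMr // mul1r.
pose E := expR (P * K + 2 * kap).
exists (E * (ball_volume N * (1 - th)^-1)) => u mu_ ub.
have mB : measurable B := measurable_unit_ball.
pose h (y : R) : R := expR (- th * ln y).
have mh : measurable_fun setT (fun y => (h y)%:E).
  apply/measurable_EFinP; apply: (@measurableT_comp _ _ _ _ _ _ (@expR R)).
    exact: measurable_expR.
  by apply: measurable_funM; [exact: measurable_cst|exact: measurable_ln].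
have h0 y : (0 <= (h y)%:E)%E by rewrite lee_fin expR_ge0.
have mhx : measurable_fun B (fun x => (h (enorm x ^+ N))%:E).
  apply: measurable_funTS.
  apply: (@measurableT_comp _ _ _ _ _ _ (fun y => (h y)%:E)) => //.
  by apply: measurable_funX; exact: measurable_enorm.
apply: (@le_trans _ _ (\int[mu]_(x in B) (E%:E * (h (enorm x ^+ N)%R)%:E))%E).
  apply: ae_ge0_le_integral => //.
  - apply/measurable_EFinP; apply: (@measurableT_comp _ _ _ _ _ _ (@expR R)).
      exact: measurable_expR.
    apply: measurable_funM; first exact: measurable_cst.
    apply: (@measurableT_comp _ _ _ _ _ _ (fun t : R => t `^ gam)).
      exact: measurable_powR.
    exact: measurableT_comp.
  - by move=> x _; rewrite mule_ge0 // lee_fin expR_ge0.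
  - exact: measurable_funeM.
  apply: filterS ub => x hx Bx; rewrite -EFinM lee_fin /E /h -expRD ler_expR.
  have L2 : 0 <= 2 - ln (enorm x) by have := log_ge1 Bx; lra.
  have -> : - th * ln (enorm x ^+ N) = - kap * ln (enorm x).
    have := enorm_ge0 x; rewrite le_eqVlt => /predU1P[<-|x0].
      by rewrite expr0n gtn_eqF //= ln0 // !mulr0.
    rewrite lnXn // -[ln _ *+ _]mulr_natl mulrA /th mulNr divfK ?gt_eqF //.
  apply: (@le_trans _ _ (P * (D' `^ gam * (2 - ln (enorm x)) + K))).
    rewrite ler_pM2l //.
    apply: (@le_trans _ _ ((C + D * (2 - ln (enorm x)) `^ gam^-1) `^ gam)).
      by rewrite ge0_ler_powR ?nnegrE ?hx // addr_ge0 // mulr_ge0 // powR_ge0.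
    apply: (le_trans (powR_affine_le C0 D0 DD' (powR_ge0 _ _) g0')).
    by rewrite -powRrM mulVf ?gt_eqF // powRr1.
  by rewrite le_eqVlt; apply/orP; left; apply/eqP; rewrite /kap; ring.
rewrite ge0_integralZl //; last by rewrite lee_fin expR_ge0.
rewrite (integral_radial N_gt0 mh h0) EFinM lee_wpmul2l ?lee_fin ?expR_ge0 //.
rewrite EFinM lee_wpmul2l ?lee_fin ?(ltW (ball_volume_gt0)) //.
exact: integral_expR_ln.
Qed.

End exponential_integral.

Section limits.
Context {R : realType}.

(** Differentiability of the power only settles positive limits; at 0 the condition u_n < e^(1/a) is
    used instead. *)
Lemma cvg_powR (u_ : R ^nat) (u a : R) : 0 < a -> (forall n, 0 <= u_ n) ->
  u_ @ \oo --> u -> (fun n => u_ n `^ a) @ \oo --> u `^ a.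
Proof.
move=> a0 u0 cu.
have : 0 <= u by apply: (cvgr_to_ge cu); exact: nearW.
rewrite le_eqVlt => /predU1P[ue|up]; last first.
  apply: (@continuous_cvg _ _ _ _ _ _ (fun t : R => t `^ a)) => //.
  exact: is_derive_continuous (is_derive1_powR a up).
rewrite -ue powR0 ?gt_eqF //; apply/cvgrPdist_lt => e e0.
have e1 : 0 < e `^ a^-1 by rewrite powR_gt0.
move/cvgrPdist_lt : cu => /(_ _ e1); apply: filterS => n.
rewrite -ue !sub0r !normrN ger0_norm // ger0_norm ?powR_ge0 // => ne.
have -> : e = (e `^ a^-1) `^ a by rewrite -powRrM mulVf ?gt_eqF // powRr1 // ltW.
by rewrite gt0_ltr_powR ?nnegrE ?powR_ge0.
Qed.

Lemma limn_einf_gt (u : (\bar R) ^nat) (x : \bar R) : (x < limn_einf u)%E ->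
  exists K, forall k, (K <= k)%N -> (x < u k)%E.
Proof.
move=> xu; apply: contrapT => /forallNP H.
have : (limn_einf u <= x)%E; last by rewrite leNgt xu.
rewrite limn_einf_lim; apply: lime_le; first exact: is_cvg_einfs.
apply: nearW => n; have := H n => /existsNP[k /not_implyP[nk /negP]].
rewrite -leNgt; apply: le_trans; apply: ereal_inf_lbound.
by exists k.
Qed.

End limits.

(** * Concentration *)

Section sobolev_facts.
Context {R : realType} {N : nat}.
Hypothesis N_ge3 : (3 <= N)%N.
Local Notation q := (N%:R / 2).
Local Notation mu := (@lebesgue_rV R N).
Local Notation B := (@unit_ball R N).

Let N_gt0 : (0 < N)%N. Proof. by case: N N_ge3. Qed.

Let q_gt1 : 1 < q :> R.
Proof. by rewrite ltr_pdivlMr // mul1r ltr_nat. Qed.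

Let mB : measurable B. Proof. exact: measurable_unit_ball. Qed.

Lemma continuous_enorm : continuous (@enorm R N).
Proof.
move=> x; apply: (@continuous_comp _ _ _ (@sqn R N) (@Num.sqrt R) x).
  exact: continuous_sqn.
exact: sqrt_continuous.
Qed.

Lemma open_unit_ball : open B.
Proof.
apply: (@open_comp _ _ (@enorm R N) [set t | t < 1]); last exact: open_lt.
by move=> x _; exact: continuous_enorm.
Qed.

Lemma measurable_within_continuous (V : 'rV[R]_N -> R) :
  {within closed_unit_ball, continuous V} -> measurable_fun B V.
Proof.
move=> cV.
have {}cV : {in B, continuous V}.
  rewrite -continuous_open_subspace; last exact: open_unit_ball.
  by apply: continuous_subspaceW cV => x /ltW.
apply: (measurability (@measurable_realfun.RGenInftyO.G R)).
  exact: measurable_realfun.RGenInftyO.measurableE.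
move=> _ [_ [r ->] <-]; apply: open_measurable_rV; rewrite openE => x [Bx Vx].
apply: filterI; first by apply: open_nbhs_nbhs; split => //; exact: open_unit_ball.
apply: (cV x); first by rewrite inE.
by apply: open_nbhs_nbhs; split => //; exact: interval_open.
Qed.

(** Dominated convergence: off the origin, a null set, the indicators of the balls tend to 0. The
    levels 1/(n+2) are all below 1. *)
Lemma small_near_origin (F : 'rV[R]_N -> R) (e : R) : measurable_fun B F ->
  (forall x, B x -> 0 <= F x) -> (\int[mu]_(x in B) (F x)%:E < +oo)%E ->
  0 < e -> exists2 e0 : R, 0 < e0 < 1 &
    (\int[mu]_(x in sublevel e0) (F x)%:E < e%:E)%E.
Proof.
move=> mF F0 Foo e_gt0.
pose r n : R := n.+2%:R^-1.
have r0 n : 0 < r n by rewrite invr_gt0.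
have r1 n : r n < 1 by rewrite invf_lt1 // ltr1n.
pose G n x := (F x * \1_(sublevel (r n)) x)%:E.
have GE n : (\int[mu]_(x in B) G n x = \int[mu]_(x in sublevel (r n)) (F x)%:E)%E.
  rewrite integral_mkcond [RHS]integral_mkcond; apply: eq_integral => x _.
  rewrite /G !patchE indicE.
  have sub := sqn_le_sub_ball (r1 n).
  have [xs|xs] := boolP (x \in sublevel (r n)).
    by rewrite mem_set ?mulr1 //; apply: sub; rewrite inE in xs.
  by rewrite mulr0; case: ifP.
have iF : mu.-integrable B (EFin \o F).
  apply/integrableP; split; first exact/measurable_EFinP.
  apply: le_lt_trans Foo; rewrite le_eqVlt; apply/orP; left; apply/eqP.
  by apply: eq_integral => x; rewrite inE => Bx; rewrite /= ger0_norm // F0.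
have [| | | | |_ _ c] := @dominated_convergence _ _ _ mu B mB G
    (cst 0%E) (fun x => `|F x|%:E).
- move=> n; apply/measurable_EFinP; apply: measurable_funM => //.
  by apply: measurable_indic; exact: measurable_sqn_le.
- exact: measurable_cst.
- have nul : {ae mu, forall x : 'rV[R]_N, enorm x <> 0}.
    exists [set x : 'rV[R]_N | enorm x = 0]; split => //.
    + rewrite (_ : mkset _ = @enorm R N @^-1` [set 0]) //.
      by rewrite -[X in measurable X]setTI; apply: measurable_enorm.
    + exact: enorm_eq0_null.
    + by move=> x /= /contrapT.
  apply: filterS nul => x /eqP x0 Bx.
  have T0 : 0 < sqn x by rewrite -sqr_enorm exprn_gt0 // lt_neqAle eq_sym x0 enorm_ge0.
  apply: cvg_near_cst.
  have := @near_infty_natSinv_lt R (PosNum T0).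
  case=> n _ hn; exists n => // m /= nm; rewrite /G indicE memNset ?mulr0 //.
  rewrite /sublevel /=; apply/negP; rewrite -ltNge.
  by have := hn m.+1 (leqW nm).
- by have := integrable_abse iF; apply: eq_integrable.
- apply: aeW => x n _; rewrite /G lee_fin normrM ler_piMr // indicE.
  by case: (_ \in _); rewrite ?normr1 ?normr0.
rewrite integral0 in c.
have : \forall n \near \oo, (\int[mu]_(x in B) G n x < e%:E)%E.
  apply: (c [set y | (y < e%:E)%E]).
  apply: open_nbhs_nbhs; split; first exact: open_ereal_lt_ereal.
  by rewrite /= lte_fin.
case=> n _ /(_ n (leqnn n)) /=; rewrite GE => hn.
by exists (r n) => //; rewrite r0 r1.
Qed.

Lemma sobolev0_weak_laplacian beta (v : 'rV[R]_N -> R) : sobolev0 beta v ->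
  is_weak_laplacian v (wlaplacian v).
Proof. by case=> _ _ [g gP] _; apply: (xgetPex (cst 0)); exists g. Qed.

Lemma sobolev0_measurable_grad beta (v : 'rV[R]_N -> R) : sobolev0 beta v ->
  measurable_fun B (fun x => enorm (wgrad v x)).
Proof.
case=> _ h _ _.
have mp i : measurable_fun B (wpartial i v).
  have [g gP] := h i.
  have : is_weak_partial i v (wpartial i v).
    by apply: (xgetPex (cst 0)); exists g.
  by case=> -[].
rewrite (_ : (fun x => _) = (fun t : R => t `^ 2^-1) \o
    (fun x => \sum_(i < N) wpartial i v x ^+ 2)).
  apply: (@measurableT_comp _ _ _ _ _ _ (fun t : R => t `^ 2^-1)).
    exact: measurable_powR.
  by apply: measurable_sum => i; exact: measurable_funX.
apply/funext => x /=; rewrite powR12_sqrt; last first.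
  by apply: sumr_ge0 => i _; exact: sqr_ge0.
by rewrite enormE /sqn; congr (Num.sqrt _); apply: eq_bigr => i _; rewrite mxE.
Qed.

End sobolev_facts.

Section concentration.
Context {R : realType} {N : nat}.
Hypothesis N_ge3 : (3 <= N)%N.
Local Notation q := (N%:R / 2).
Local Notation mu := (@lebesgue_rV R N).
Local Notation B := (@unit_ball R N).
Variables (beta : R) (V : 'rV[R]_N -> R) (V0 : R).
Hypotheses (beta01 : 0 < beta < 1) (V0_gt0 : 0 < V0).
Hypothesis cV : {within closed_unit_ball, continuous V}.
Hypothesis V_ge : forall x, unit_ball x -> V0 <= V x.

Let N_gt0 : (0 < N)%N. Proof. by case: N N_ge3. Qed.

Let NR_gt0 : 0 < N%:R :> R. Proof. by rewrite ltr0n. Qed.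

Let q_gt1 : 1 < q :> R.
Proof. by rewrite ltr_pdivlMr // mul1r ltr_nat. Qed.

Let q_gt0 : 0 < q :> R. Proof. exact: lt_trans q_gt1. Qed.

Let mB : measurable B. Proof. exact: measurable_unit_ball. Qed.

Let BV_gt0 : 0 < ball_volume N :> R. Proof. exact: ball_volume_gt0. Qed.

Definition lap_density (v : 'rV[R]_N -> R) (x : 'rV[R]_N) : R :=
  weight beta x * `|wlaplacian v x| `^ q.

Definition grad_density (v : 'rV[R]_N -> R) (x : 'rV[R]_N) : R :=
  enorm (wgrad v x) `^ q.

Definition pot_density (v : 'rV[R]_N -> R) (x : 'rV[R]_N) : R := V x * `|v x| `^ q.

(** The N/2-th power of the norm, kept in the extended reals so that its terms can be split without
    finiteness conditions. *)
Definition energy (v : 'rV[R]_N -> R) : \bar R :=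
  (\int[mu]_(x in B) (lap_density v x)%:E
   + \int[mu]_(x in B) (grad_density v x)%:E
   + \int[mu]_(x in B) (pot_density v x)%:E)%E.

Let lap_ge0 v x : 0 <= lap_density v x.
Proof. by rewrite mulr_ge0 // powR_ge0. Qed.

Let grad_ge0 v x : 0 <= grad_density v x. Proof. exact: powR_ge0. Qed.

Let pot_ge0 v x : B x -> 0 <= pot_density v x.
Proof.
by move=> Bx; rewrite mulr_ge0 ?powR_ge0 // (le_trans (ltW V0_gt0)) // V_ge.
Qed.

Let mlap v : sobolev0 beta v -> measurable_fun B (wlaplacian v).
Proof. by move=> /sobolev0_weak_laplacian[[]]. Qed.

Let mfun_ v : sobolev0 beta v -> measurable_fun B v.
Proof. by case=> -[]. Qed.

Let mnorm_powR (f : 'rV[R]_N -> R) : measurable_fun B f ->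
  measurable_fun B (fun x => `|f x| `^ q).
Proof.
move=> mf; apply: (@measurableT_comp _ _ _ _ _ _ (fun t : R => t `^ q)).
  exact: measurable_powR.
exact: measurableT_comp.
Qed.

Let mlapd v : sobolev0 beta v -> measurable_fun B (lap_density v).
Proof.
move=> sv; apply: measurable_funM; last exact: mnorm_powR (mlap sv).
by apply: measurable_funTS; exact: measurable_weight.
Qed.

Let mgradd v : sobolev0 beta v -> measurable_fun B (grad_density v).
Proof.
move=> sv; apply: (@measurableT_comp _ _ _ _ _ _ (fun t : R => t `^ q)).
  exact: measurable_powR.
exact: sobolev0_measurable_grad sv.
Qed.

Let mpotd v : sobolev0 beta v -> measurable_fun B (pot_density v).
Proof.
move=> sv; apply: measurable_funM; last exact: mnorm_powR (mfun_ sv).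
exact: measurable_within_continuous.
Qed.

Let int_lap_ge0 v : (0 <= \int[mu]_(x in B) (lap_density v x)%:E)%E.
Proof. by apply: integral_ge0 => x _; rewrite lee_fin. Qed.

Let int_grad_ge0 v : (0 <= \int[mu]_(x in B) (grad_density v x)%:E)%E.
Proof. by apply: integral_ge0 => x _; rewrite lee_fin. Qed.

Let int_pot_ge0 v : (0 <= \int[mu]_(x in B) (pot_density v x)%:E)%E.
Proof. by apply: integral_ge0 => x Bx; rewrite lee_fin pot_ge0. Qed.

Lemma energy_ge0 v : (0 <= energy v)%E.
Proof. by apply: adde_ge0; [apply: adde_ge0|]. Qed.

Let two_N : 2 / N%:R != 0 :> R. Proof. by rewrite gt_eqF // divr_gt0. Qed.

Lemma sobolev_enormE v : sobolev_enorm beta V v = (energy v `^ (2 / N%:R))%E.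
Proof. by []. Qed.

Lemma energy_eq1 v : sobolev_norm beta V v = 1 -> energy v = 1%E.
Proof.
rewrite /sobolev_norm sobolev_enormE.
have := energy_ge0 v; case: (energy v) => [r| |] //=.
- rewrite lee_fin => r0 /eqP; rewrite powR_eq1 (negbTE two_N) orbF.
  by rewrite ltNge r0 orbF => /eqP ->.
(* Since [fine] sends +oo to 0, a norm equal to 1 excludes infinite energy. *)
- by move: (two_N) => /negbTE -> /= _ /eqP; rewrite eq_sym oner_eq0.
Qed.

Let norm_le_powR (a : R) : `|a| <= 1 + `|a| `^ q.
Proof.
have [a1|a1] := leP `|a| 1; first by rewrite (le_trans a1) // lerDl powR_ge0.
by rewrite (le_trans (le1r_powR (ltW a1) (ltW q_gt1))) // lerDr.
Qed.

(** Supplies the L^1 bounds [U] and [G] of [radial_pointwise_bound], through |a| <= 1 + |a|^q. It is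
    applied to the function with w = V, c = V0, and to its Laplacian with c = 1, where the weight is
    at least 1 only off the origin. *)
Let int_norm_le (f w : 'rV[R]_N -> R) (c U : R) : measurable_fun B f ->
  measurable_fun B w -> 0 < c ->
  {ae mu, forall x, B x -> c <= w x} -> (forall x, B x -> 0 <= w x) ->
  (\int[mu]_(x in B) (w x * `|f x| `^ q)%:E <= U%:E)%E ->
  (\int[mu]_(x in B) `|f x|%:E <= (ball_volume N + c^-1 * U)%:E)%E.
Proof.
move=> mf mw c0 cw w0 fU.
have mfq := mnorm_powR mf.
have wf0 x : B x -> (0 <= (w x * `|f x| `^ q)%:E)%E.
  by move=> Bx; rewrite lee_fin mulr_ge0 ?powR_ge0 // w0.
have c1 : (0 <= c^-1%:E)%E by rewrite lee_fin invr_ge0 ltW.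
apply: (@le_trans _ _ (\int[mu]_(x in B)
    (1%:E + c^-1%:E * (w x * `|f x| `^ q)%:E))%E).
  apply: ae_ge0_le_integral => //.
  - by apply/measurable_EFinP; exact: measurableT_comp.
  - by move=> x Bx; rewrite adde_ge0 // mule_ge0 // wf0.
  - apply: emeasurable_funD; first exact: measurable_cst.
    by apply: measurable_funeM; apply/measurable_EFinP; exact: measurable_funM.
  apply: filterS cw => x wx Bx; rewrite -EFinM -EFinD lee_fin.
  apply: (le_trans (norm_le_powR (f x))); rewrite lerD2l.
  rewrite mulrA ler_peMl ?powR_ge0 // mulrC ler_pdivlMr // mul1r.
  exact: wx.
rewrite ge0_integralD //; last 2 first.
- by move=> x Bx; rewrite mule_ge0 // wf0.
- by apply: measurable_funeM; apply/measurable_EFinP; exact: measurable_funM.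
rewrite [leRHS]EFinD; apply: leeD.
  by rewrite integral_cst // mul1e -lebesgue_rV_unit_ballE.
rewrite ge0_integralZl //.
  by rewrite EFinM lee_wpmul2l.
by apply/measurable_EFinP; exact: measurable_funM.
Qed.

Let weight_ge1 : {ae mu, forall x : 'rV[R]_N, B x -> 1 <= weight beta x}.
Proof.
have nul : {ae mu, forall x : 'rV[R]_N, enorm x <> 0}.
  exists [set x : 'rV[R]_N | enorm x = 0]; split => //.
  - rewrite (_ : mkset _ = @enorm R N @^-1` [set 0]) //.
    by rewrite -[X in measurable X]setTI; apply: measurable_enorm.
  - exact: enorm_eq0_null.
  - by move=> x /= /contrapT.
apply: filterS nul => x /eqP x0 Bx; rewrite weightE //.
have L1 := log_ge1 Bx; have /andP[b0 _] := beta01.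
apply: (@le_trans _ _ (1 `^ (beta * (q - 1)))); first by rewrite powR1.
have r0 : 0 <= beta * (q - 1) by rewrite mulr_ge0 ?subr_ge0 ?(ltW b0) ?(ltW q_gt1).
have L0 := le_trans ler01 L1.
by rewrite ge0_ler_powR ?nnegrE.
Qed.

Let gam := gamma_exp N beta.

Let beta1_gt0 : 0 < 1 - beta. Proof. by rewrite subr_gt0; case/andP: beta01. Qed.

Let N2_gt0 : 0 < N%:R - 2 :> R. Proof. by rewrite subr_gt0 ltr_nat. Qed.

Let gam_gt0 : 0 < gam.
Proof. by rewrite /gam /gamma_exp divr_gt0 // mulr_gt0. Qed.

(** Identifies the exponent of the logarithm in the pointwise bound as 1/gamma. *)
Let gamV : gam^-1 = (1 - beta) * (1 - q^-1).
Proof.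
rewrite /gam /gamma_exp.
by field; rewrite !(gt_eqF NR_gt0, gt_eqF N2_gt0, gt_eqF beta1_gt0).
Qed.

Lemma log_const_gt0 : 0 < log_const (N := N) beta.
Proof.
have v0 : 0 < N%:R * ball_volume N :> R by rewrite mulr_gt0.
have a0 : 0 < N%:R * ball_volume N / (1 - beta) by rewrite divr_gt0.
by rewrite /log_const divr_gt0 ?powR_gt0 // !mulr_gt0.
Qed.

Lemma alpha_const_gt0 : 0 < alpha_const N beta.
Proof. by rewrite /alpha_const !mulr_gt0 ?powR_gt0 // !mulr_gt0. Qed.

(** The left-hand side is in fact [N * (N - 2) `^ (- (1 - beta)^-1)]. *)
Lemma alpha_log_const_le : alpha_const N beta * log_const (N := N) beta `^ gam <= N%:R.
Proof.
have b0 := beta1_gt0; set b := 1 - beta in b0 *.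
set v : R := N%:R * ball_volume N.
have v0 : 0 < v by rewrite mulr_gt0.
have n20 := N2_gt0; set n2 : R := N%:R - 2 in n20 *.
have eg : (1 - q^-1) * gam = b^-1.
  rewrite /gam /gamma_exp -/b -/n2 /q.
  have -> : 1 - (N%:R / 2)^-1 = n2 / N%:R :> R.
    by rewrite /n2; field; rewrite gt_eqF.
  by field; rewrite !gt_eqF.
(* In (n2 v)^gam the first summand yields the power present in [alpha_const], the second one
   v^(1/b), which cancels with the numerator, and n2^(1/b), which is at least 1 and remains. *)
have eg2 : gam = 2 / (n2 * b) + b^-1.
  rewrite /gam /gamma_exp -/b -/n2.
  have -> : N%:R = n2 + 2 :> R by rewrite /n2; ring.
  by field; rewrite !gt_eqF.
have logE : log_const (N := N) beta `^ gam =
    v `^ b^-1 * (b `^ b^-1)^-1 *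
    ((n2 * v) `^ (2 / (n2 * b)) * (n2 `^ b^-1 * v `^ b^-1))^-1.
  rewrite /log_const -/b -/n2 -(mulrA n2) -/v.
  rewrite powRM ?powR_ge0 ?invr_ge0 ?mulr_ge0 ?ltW //.
  rewrite -powRrM eg powRM ?(ltW v0) ?invr_ge0 ?(ltW b0) //.
  have inv_powR (x r : R) : 0 < x -> x^-1 `^ r = (x `^ r)^-1.
    move=> x0; rewrite -powR_inv1 ?ltW // -powRrM mulN1r powRN //.
  rewrite !inv_powR ?mulr_gt0 //; congr (_ * _^-1).
  rewrite eg2 powRD; last by rewrite (_ : n2 * v != 0) ?implybT // gt_eqF // mulr_gt0.
  by rewrite [X in _ * X]powRM ?ltW.
rewrite logE /alpha_const -/b -/n2 -(mulrA n2) -/v div1r.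
have p1 : 0 < (n2 * v) `^ (2 / (n2 * b)) by rewrite powR_gt0 // mulr_gt0.
have p2 : 0 < b `^ b^-1 by rewrite powR_gt0.
have p3 : 0 < v `^ b^-1 by rewrite powR_gt0.
have n21 : 1 <= n2 by rewrite /n2 lerBrDr -(natrD _ 1 2) ler_nat.
have p4 : 1 <= n2 `^ b^-1.
  apply: (@le_trans _ _ (1 `^ b^-1)); first by rewrite powR1.
  by rewrite ge0_ler_powR ?nnegrE ?invr_ge0 ?(ltW b0) ?(ltW n20).
have -> : N%:R * (n2 * v) `^ (2 / (n2 * b)) * b `^ b^-1 *
    (v `^ b^-1 / b `^ b^-1 / ((n2 * v) `^ (2 / (n2 * b)) *
    (n2 `^ b^-1 * v `^ b^-1))) = N%:R / n2 `^ b^-1.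
  move: p1 p2 p3 (lt_le_trans ltr01 p4).
  move: (_ `^ _) (b `^ _) (v `^ _) (n2 `^ _) => a1 a2 a3 a4 h1 h2 h3 h4.
  by field; rewrite !gt_eqF.
by rewrite ler_pdivrMr ?(lt_le_trans ltr01) // ler_peMr // ltW.
Qed.


(** Unit energy bounds the L^1 norms of v and of its Laplacian independently of v, so the constant
    of the pointwise bound is uniform. The gap between M and M' is the one that [exp_integral_bound]
    needs to absorb it. *)
Lemma uniform_exp_bound (P M M' e0 : R) : 0 < e0 -> e0 < 1 -> 0 <= M ->
  M < M' -> 0 < P -> P * (log_const (N := N) beta * M' `^ q^-1) `^ gam < N%:R ->
  exists Bd : R, forall v, sobolev0_rad beta v -> energy v = 1%E ->
    (\int[mu]_(x in sublevel e0) (lap_density v x)%:E <= M%:E)%E ->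
    (\int[mu]_(x in B) (expR (P * `|v x| `^ gam))%:E <= Bd%:E)%E.
Proof.
move=> e00 e01 M0 MM' P0 PM'.
have lc0 := log_const_gt0.
pose U := ball_volume N + V0^-1 * 1 : R.
pose G := ball_volume N + 1^-1 * 1 : R.
have U0 : 0 <= U by rewrite addr_ge0 ?mulr_ge0 ?invr_ge0 // ltW.
have G0 : 0 <= G by rewrite addr_ge0 ?mulr_ge0 ?invr_ge0 // ltW.
have [C C0 HC] := radial_pointwise_bound N_ge3 beta01 e00 e01 U0 G0.
have MD : log_const (N := N) beta * M `^ q^-1 <
    log_const (N := N) beta * M' `^ q^-1.
  rewrite ltr_pM2l // gt0_ltr_powR ?nnegrE ?invr_gt0 //.
  by rewrite (le_trans M0) // ltW.
have D0 : 0 <= log_const (N := N) beta * M `^ q^-1.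
  by rewrite mulr_ge0 ?powR_ge0 // ltW.
have [Bd HBd] := exp_integral_bound N_gt0 C0 D0 MD P0 gam_gt0 PM'.
exists Bd => v [sv rv] Ev lapM.
have [[le1 le2] le3] : ((\int[mu]_(x in B) (lap_density v x)%:E <= 1%:E)%E *
    (\int[mu]_(x in B) (grad_density v x)%:E <= 1%:E)%E *
    (\int[mu]_(x in B) (pot_density v x)%:E <= 1%:E)%E).
  rewrite -[1%:E]Ev /energy; do ![split].
  - by rewrite -addeA leeDl // adde_ge0.
  - by rewrite addeAC leeDr // adde_ge0.
  - by rewrite leeDr // adde_ge0.
apply: HBd; first exact: mfun_ sv.
rewrite gamV; apply: (HC v (wlaplacian v) M) => //.
- by case: sv.
- exact: sobolev0_weak_laplacian sv.
- apply: (int_norm_le (mfun_ sv) (measurable_within_continuous cV) V0_gt0).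
  + by apply: aeW => x; exact: V_ge.
  + by move=> x Bx; rewrite (le_trans (ltW V0_gt0)) // V_ge.
  + exact: le3.
- have mw : measurable_fun B (@weight R N beta).
    by apply: measurable_funTS; exact: measurable_weight.
  apply: (int_norm_le (mlap sv) mw ltr01); first exact: weight_ge1.
    by move=> x _; exact: powR_ge0.
  exact: le1.
Qed.

(** The energy density without the Laplacian term on [sublevel e0]. *)
Let rest e0 v x : R := lap_density v x * \1_(~` sublevel e0) x +
  grad_density v x + pot_density v x.

Let mrest e0 v : sobolev0 beta v -> measurable_fun B (rest e0 v).
Proof.
move=> sv; apply: measurable_funD; last exact: mpotd.
apply: measurable_funD; last exact: mgradd.
apply: measurable_funM; first exact: mlapd.
by apply: measurable_indic; apply: measurableC; exact: measurable_sqn_le.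
Qed.

Let indic_ge0 (A : set 'rV[R]_N) x : 0 <= \1_A x :> R.
Proof. by rewrite indicE. Qed.

Let rest_ge0 e0 v x : B x -> 0 <= rest e0 v x.
Proof.
by move=> Bx; rewrite addr_ge0 ?pot_ge0 // addr_ge0 // mulr_ge0 // indic_ge0.
Qed.

Let energy_split e0 v : e0 < 1 -> sobolev0 beta v ->
  energy v = (\int[mu]_(x in B) (rest e0 v x)%:E +
    \int[mu]_(x in sublevel e0) (lap_density v x)%:E)%E.
Proof.
move=> e01 sv; have sub := sqn_le_sub_ball e01.
have mS := @measurable_sqn_le R N e0.
have mI (A : set 'rV[R]_N) : measurable A ->
    measurable_fun B (fun x => (lap_density v x * \1_A x)%:E).
  move=> mA; apply/measurable_EFinP; apply: measurable_funM; first exact: mlapd.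
  exact: measurable_indic.
have nI (A : set 'rV[R]_N) x : B x -> (0 <= (lap_density v x * \1_A x)%:E)%E.
  by move=> _; rewrite lee_fin mulr_ge0.
have n1 x : B x -> (0 <= (grad_density v x)%:E)%E by move=> _; rewrite lee_fin.
have n2 x : B x -> (0 <= (pot_density v x)%:E)%E.
  by move=> Bx; rewrite lee_fin pot_ge0.
have -> : (\int[mu]_(x in sublevel e0) (lap_density v x)%:E =
    \int[mu]_(x in B) (lap_density v x * \1_(sublevel e0) x)%:E)%E.
  rewrite integral_mkcond [RHS]integral_mkcond; apply: eq_integral => x _.
  rewrite !patchE indicE; have [xs|xs] := boolP (x \in sublevel e0).
    by rewrite mem_set ?mulr1 //; apply: sub; rewrite inE in xs.
  by rewrite mulr0; case: ifP.
have m1 : measurable_fun B (fun x => (grad_density v x)%:E).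
  by apply/measurable_EFinP; exact: mgradd.
have m2 : measurable_fun B (fun x => (pot_density v x)%:E).
  by apply/measurable_EFinP; exact: mpotd.
have mC : measurable (~` sublevel e0 : set 'rV[R]_N) by exact: measurableC.
have -> : (\int[mu]_(x in B) (rest e0 v x)%:E =
    \int[mu]_(x in B) (lap_density v x * \1_(~` sublevel e0) x)%:E +
    \int[mu]_(x in B) (grad_density v x)%:E +
    \int[mu]_(x in B) (pot_density v x)%:E)%E.
  have nI1 x : B x -> (0 <= (lap_density v x * \1_(~` sublevel e0) x)%:E +
      (grad_density v x)%:E)%E by move=> Bx; rewrite adde_ge0 ?nI ?n1.
  have mI1 := emeasurable_funD (mI _ mC) m1.
  rewrite -(ge0_integralD _ mB (nI _) (mI _ mC) n1 m1).
  rewrite -(ge0_integralD _ mB nI1 mI1 n2 m2).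
  by apply: eq_integral => x _; rewrite -!EFinD.
have lapE : (\int[mu]_(x in B) (lap_density v x)%:E =
    \int[mu]_(x in B) (lap_density v x * \1_(sublevel e0) x)%:E +
    \int[mu]_(x in B) (lap_density v x * \1_(~` sublevel e0) x)%:E)%E.
  rewrite -(ge0_integralD _ mB (nI _) (mI _ mS) (nI _) (mI _ mC)).
  apply: eq_integral => x _; rewrite -EFinD -mulrDr; congr (_%:E).
  rewrite !indicE; have [xs|xs] := boolP (x \in sublevel e0).
    by rewrite memNset ?addr0 ?mulr1 //; rewrite inE in xs; exact.
  by rewrite mem_set ?add0r ?mulr1 // => xs'; move/negP: xs; rewrite inE.
by rewrite /energy lapE [RHS]addeC !addeA.
Qed.

(** * The energy of the sequence near the origin and the resulting uniform bound *)

Section sequence.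
Variables (u_ : nat -> 'rV[R]_N -> R) (u : 'rV[R]_N -> R).
Hypotheses (su_ : forall k, sobolev0_rad beta (u_ k)).
Hypothesis su : sobolev0_rad beta u.
Hypothesis Eu_ : forall k, energy (u_ k) = 1%E.
Hypothesis hae : {ae mu, forall x, unit_ball x -> u_ k x @[k --> \oo] --> u x}.
Hypothesis hgrad : {ae mu, forall x, unit_ball x ->
    wgrad (u_ k) x @[k --> \oo] --> wgrad u x}.
Hypothesis hlap : {ae mu, forall x, unit_ball x ->
    wlaplacian (u_ k) x @[k --> \oo] --> wlaplacian u x}.

Let rest_cvg e0 : {ae mu, forall x, B x ->
  rest e0 (u_ k) x @[k --> \oo] --> rest e0 u x}.
Proof.
apply: filterS3 hae hgrad hlap => x h1 h2 h3 Bx.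
apply: cvgD; first apply: cvgD.
- apply: cvgMl; apply: cvgMr; apply: cvg_powR => //.
  by apply: cvg_norm; exact: h3.
- apply: cvg_powR => //; first by move=> n; exact: enorm_ge0.
  apply: (@continuous_cvg _ _ _ _ _ _ (@enorm R N)); last exact: h2.
  exact: continuous_enorm.
- by apply: cvgMr; apply: cvg_powR => //; apply: cvg_norm; exact: h1.
Qed.

Lemma rest_fatou e0 : (\int[mu]_(x in B) (rest e0 u x)%:E <=
  limn_einf (fun k => \int[mu]_(x in B) (rest e0 (u_ k) x)%:E))%E.
Proof.
have [Z [mZ Z0 Zsub]] := rest_cvg e0.
have mE v : sobolev0 beta v -> measurable_fun B (fun x => (rest e0 v x)%:E).
  by move=> sv; apply/measurable_EFinP; exact: mrest.
have E v : sobolev0 beta v -> (\int[mu]_(x in B) (rest e0 v x)%:E =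
    \int[mu]_(x in B `\` Z) (rest e0 v x)%:E)%E.
  move=> sv; apply: ge0_negligible_integral => //; first exact: mE.
  by move=> x Bx; rewrite lee_fin rest_ge0.
rewrite E; last by case: su.
rewrite (_ : (fun k => _) = (fun k =>
    \int[mu]_(x in B `\` Z) (rest e0 (u_ k) x)%:E)%E); last first.
  by apply/funext => k; rewrite E //; case: (su_ k).
have mBZ : measurable (B `\` Z) by exact: measurableD.
apply: le_trans (fatou mu mBZ _ _).
- rewrite le_eqVlt; apply/orP; left; apply/eqP; apply: eq_integral => x.
  rewrite inE => -[Bx nZ]; apply/esym.
  have c : rest e0 (u_ k) x @[k --> \oo] --> rest e0 u x.
    by apply: contrapT => nc; apply: nZ; apply: Zsub => /= /(_ Bx).
  have /cvg_limn_einf_sup[+ _] : (fun k => (rest e0 (u_ k) x)%:E) @ \oo -->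
      (rest e0 u x)%:E by apply: cvg_EFin; [exact: nearW|exact: c].
  by [].
- move=> k; have [sk _] := su_ k.
  by apply: measurable_funS (mE _ sk) => //; exact: subDsetl.
- by move=> k x [Bx _]; rewrite lee_fin rest_ge0.
Qed.

(** The rest of the energy is lower semicontinuous (Fatou), and by absolute
    continuity it keeps almost all of the energy [s] of [u]. *)
Lemma eventually_small_near_origin (s M : R) : energy u = s%:E -> 1 - s < M ->
  exists e0 : R, 0 < e0 < 1 /\ exists K, forall k, (K <= k)%N ->
    (\int[mu]_(x in sublevel e0) (lap_density (u_ k) x)%:E <= M%:E)%E.
Proof.
move=> Es sM; have [su0 _] := su.
have lap_oo : (\int[mu]_(x in B) (lap_density u x)%:E < +oo)%E.
  apply: (@le_lt_trans _ _ s%:E); last exact: ltry.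
  by rewrite -Es /energy -addeA leeDl // adde_ge0.
(* With this margin the rest of the energy of u exceeds s - (M - (1 - s)) = 1 - M, hence so does
   that of u_k for large k, which leaves less than M for the Laplacian near 0. *)
have e_gt0 : 0 < M - (1 - s) by rewrite subr_gt0.
have [e0 e01 small] := small_near_origin N_ge3 (mlapd su0)
  (fun x _ => lap_ge0 u x) lap_oo e_gt0.
exists e0; split => //; have /andP[_ e0_lt1] := e01.
have := energy_split e0_lt1 su0; rewrite Es => Eu.
have lt1 : ((1 - M)%:E < \int[mu]_(x in B) (rest e0 u x)%:E)%E.
  move: small; move: Eu.
  set a := (\int[mu]_(x in B) (rest e0 u x)%:E)%E.
  set b := (\int[mu]_(x in _) _)%E.
  have a0 : (0 <= a)%E by apply: integral_ge0 => x Bx; rewrite lee_fin rest_ge0.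
  have b0 : (0 <= b)%E by apply: integral_ge0 => x Bx; rewrite lee_fin.
  case: a a0 => [a| |] // a0; case: b b0 => [b| |] // b0.
  by rewrite -EFinD => -[->]; rewrite !lte_fin => ?; lra.
have [K HK] := limn_einf_gt (lt_le_trans lt1 (rest_fatou e0)).
exists K => k Kk; have := HK k Kk.
have [sk _] := su_ k; have := energy_split e0_lt1 sk; rewrite Eu_.
set a := (\int[mu]_(x in B) (rest e0 _ x)%:E)%E.
set b := (\int[mu]_(x in _) _)%E.
have a0 : (0 <= a)%E by apply: integral_ge0 => x Bx; rewrite lee_fin rest_ge0.
have b0 : (0 <= b)%E by apply: integral_ge0 => x Bx; rewrite lee_fin.
case: a a0 => [a| |] // a0; case: b b0 => [b| |] // b0.
by rewrite -EFinD => -[E1]; rewrite lte_fin lee_fin => ?; lra.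
Qed.

Lemma sup_exp_lty (P s M M' : R) : energy u = s%:E -> 1 - s < M -> 0 < M ->
  M < M' -> 0 < P -> P * (log_const (N := N) beta * M' `^ q^-1) `^ gam < N%:R ->
  (ereal_sup (range (fun k : nat =>
    \int[mu]_(x in B) (expR (P * `|u_ k x| `^ gam))%:E)) < +oo)%E.
Proof.
move=> Es sM M0 MM' P0 PM'.
have [e0 [/andP[e00 e01] [K HK]]] := eventually_small_near_origin Es sM.
have [Bd HBd] := uniform_exp_bound e00 e01 (ltW M0) MM' P0 PM'.
have /choice[b Hb] : forall k, exists b : R,
    (\int[mu]_(x in B) (expR (P * `|u_ k x| `^ gam))%:E <= b%:E)%E.
  move=> k; have [sk _] := su_ k.
  have lap_oo : (\int[mu]_(x in B) (lap_density (u_ k) x)%:E < +oo)%E.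
    apply: (@le_lt_trans _ _ 1%:E); last exact: ltry.
    by rewrite -[1%:E](Eu_ k) /energy -addeA leeDl // adde_ge0.
  have [ek /andP[ek0 ek1] small] := small_near_origin N_ge3 (mlapd sk)
    (fun x _ => lap_ge0 (u_ k) x) lap_oo M0.
  have [bk Hbk] := uniform_exp_bound ek0 ek1 (ltW M0) MM' P0 PM'.
  by exists bk; apply: Hbk => //; exact: ltW.
apply: (@le_lt_trans _ _ (Num.max Bd (\sum_(k < K) `|b k|))%:E); last exact: ltry.
apply: ub_ereal_sup => _ [k _ <-].
have [Kk|kK] := leqP K k.
  by apply: (le_trans (HBd _ (su_ k) (Eu_ k) (HK k Kk))); rewrite lee_fin le_max lexx.
apply: (le_trans (Hb k)); rewrite lee_fin le_max; apply/orP; right.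
rewrite (bigD1 (Ordinal kK)) //= (le_trans (ler_norm _)) // lerDl.
by apply: sumr_ge0 => i _.
Qed.

End sequence.

End concentration.

(** Let Y solve p Y^c = 1. For s < 1 the hypothesis on p says that 1 - s < Y; for s >= 1 this is
    clear from Y > 0. Then M and M' fit between max(0, 1 - s) and Y. *)
Lemma threshold_margin {R : realType} (p s c : R) : 0 < p -> 0 < c ->
  (s < 1 -> p < 1 / (1 - s) `^ c) ->
  exists M M' : R, [/\ 1 - s < M, 0 < M, M < M' & p * M' `^ c < 1].
Proof.
move=> p0 c0 hp.
have [Y Y0 Yc] : exists2 Y : R, 0 < Y & Y `^ c = p^-1.
  exists (p^-1 `^ c^-1); first by rewrite powR_gt0 // invr_gt0.
  by rewrite -powRrM mulVf ?gt_eqF // powRr1 // invr_ge0 ltW.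
have sY : 1 - s < Y.
  have [s1|s1] := ltP s 1; last by apply: le_lt_trans Y0; rewrite subr_le0.
  have s10 : 0 < 1 - s by rewrite subr_gt0.
  have h : (1 - s) `^ c < Y `^ c.
    rewrite Yc -[ltLHS]invrK ltf_pV2 ?posrE ?invr_gt0 ?powR_gt0 //.
    by rewrite -[ltRHS]mul1r; exact: hp.
  rewrite ltNge; apply/negP => le; move: h; rewrite ltNge.
  by rewrite ge0_ler_powR // ?nnegrE ltW.
have [M [sM M0 MY]] : exists M : R, [/\ 1 - s < M, 0 < M & M < Y].
  have [s1|s1] := ltP 0 (1 - s).
    by exists ((1 - s + Y) / 2); split; lra.
  by exists (Y / 2); split; lra.
exists M, ((M + Y) / 2); split => //; first lra.
rewrite -(ltr_pdivlMl _ _ p0) mulr1 -Yc.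
by apply: gt0_ltr_powR; rewrite ?nnegrE //; lra.
Qed.

Theorem lemma3 (R : realType) (N : nat) (hN : (3 <= N)%N)
  (beta : R) (hbeta : 0 < beta < 1)
  (V : 'rV[R]_N -> R) (V0 : R) (hV0 : 0 < V0)
  (hVc : {within closed_unit_ball, continuous V})
  (hV : forall x, unit_ball x -> V0 <= V x)
  (u_ : nat -> 'rV[R]_N -> R) (u : 'rV[R]_N -> R)
  (hu_ : forall k, sobolev0_rad beta (u_ k))
  (hu : sobolev0_rad beta u)
  (hnorm : forall k, sobolev_norm beta V (u_ k) = 1)
  (hweak : weak_cvg beta V u_ u)
  (hae : {ae lebesgue_rV N, forall x, unit_ball x ->
    u_ k x @[k --> \oo] --> u x})
  (hgrad : {ae lebesgue_rV N, forall x, unit_ball x ->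
    wgrad (u_ k) x @[k --> \oo] --> wgrad u x})
  (hlap : {ae lebesgue_rV N, forall x, unit_ball x ->
    wlaplacian (u_ k) x @[k --> \oo] --> wlaplacian u x})
  (hu0 : ~ {ae lebesgue_rV N, forall x, unit_ball x -> u x = 0})
  (p : R) (hp1 : 1 < p)
  (hpU : (p%:E < threshold N beta (sobolev_norm beta V u))%E) :
  (ereal_sup (range (fun k : nat =>
     \int[lebesgue_rV N]_(x in unit_ball)
       (expR (p * alpha_const N beta * `|u_ k x| `^ gamma_exp N beta))%:E))
   < +oo)%E.
Proof.
have Eu_ k : energy beta V (u_ k) = 1%E by exact: (energy_eq1 hN hV0 hV (hnorm k)).
have p0 : 0 < p by exact: lt_trans hp1.
have NR0 : 0 < N%:R :> R by rewrite ltr0n; case: (N) hN.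
have q0 : N%:R / 2 != 0 :> R by rewrite gt_eqF ?divr_gt0.
have iq0 : 2 / N%:R != 0 :> R by rewrite gt_eqF ?divr_gt0.
have N3 : 3 <= N%:R :> R by rewrite ler_nat.
have g0 : 0 < gamma_exp N beta.
  have /andP[b0 b1] := hbeta.
  by rewrite /gamma_exp divr_gt0 // mulr_gt0 // subr_gt0 //; lra.
set c := 2 * gamma_exp N beta / N%:R.
have c0 : 0 < c by rewrite divr_gt0 // mulr_gt0.
have [s Es] : exists s : R, energy beta V u = s%:E.
  have := energy_ge0 beta hV0 hV u; case E : (energy beta V u) => [s| |] // _.
    by exists s.
  (* An infinite energy would give norm 0 through [fine], hence threshold 1, against 1 < p. *)
  exfalso; move: hpU; rewrite /threshold /sobolev_norm sobolev_enormE // E /=.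
  rewrite (negbTE iq0) /= ltr01 powR0 // subr0 powR1 divr1 lte_fin.
  by move=> /(lt_trans hp1); rewrite ltxx.
have s0 : 0 <= s by rewrite -lee_fin -Es; exact: (energy_ge0 beta hV0 hV u).
(* The threshold is stated for t = s^(2/N), whose N/2-th power is the energy s. *)
have hp : s < 1 -> p < 1 / (1 - s) `^ c.
  move=> s1; move: hpU; rewrite /threshold /sobolev_norm sobolev_enormE // Es /=.
  rewrite -powRrM (_ : 2 / N%:R * (N%:R / 2) = 1) ?powRr1 //; last first.
    by field; rewrite gt_eqF.
  have -> // : s `^ (2 / N%:R) < 1.
  have := @gt0_ltr_powR _ (2 / N%:R) (divr_gt0 (ltr0n _ 2) NR0) s 1.
  by rewrite powR1 !nnegrE; apply.
have [M [M' [sM M0 MM' pM']]] := threshold_margin p0 c0 hp.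
have M'0 : 0 < M' by exact: lt_trans MM'.
apply: (sup_exp_lty hN hbeta hV0 hVc hV hu_ hu Eu_ hae hgrad hlap Es sM M0 MM').
  by rewrite mulr_gt0 // (alpha_const_gt0 hN hbeta).
have L0 := log_const_gt0 hN hbeta.
rewrite powRM ?ltW ?powR_gt0 // -powRrM.
rewrite (_ : (N%:R / 2)^-1 * gamma_exp N beta = c); last first.
  by rewrite /c invf_div mulrAC.
rewrite [p * _]mulrC mulrACA mulrC.
(* The bound alpha_beta kappa^gamma <= N separates from p M'^c < 1. *)
apply: (@le_lt_trans _ _ (p * M' `^ c * N%:R)); last first.
  by rewrite -[ltRHS]mul1r ltr_pM2r.
by rewrite ler_wpM2l ?alpha_log_const_le // mulr_ge0 ?powR_ge0 // ltW.
Qed.
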